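(* In the scaled framework described in the context, assume (A1)–(A11), (H1)–(H3), that $F(u) > 0$ and $G(u) = 0$ for all $u \in W\setminus\{0\}$, and that (for every $c\in\mathbb{R}$) $h(u)\neq 0$ for all $u\in\mathcal{N}_c$. Let $I^- = (-\infty,0)$. Then: (i) For each $c \in I^-$, $\lambda_{c,k} \nearrow \infty$ ($k\ge1$) is a sequence of critical values of $\lambda_c$. Moreover, $\Phi_{\lambda_{c,k}}$ has a nontrivial critical point $u_{c,k}$ with $\Phi_{\lambda_{c,k}}(u_{c,k}) = c$. (ii) For each $k \ge 1$, the mapping $I^- \to \mathbb{R}$, $c \mapsto \lambda_{c,k}$ is continuous, decreasing, and satisfies $\lim_{c \to 0^-} \lambda_{c,k} = -\infty$ and $\lim_{c \to -\infty} \lambda_{c,k} = \lambda_k$. (iii) For each $\lambda \in \mathbb{R}$, $\Phi_\lambda$ has a sequence of nontrivial critical points $(v_{\lambda,k})$ such that $\Phi_\lambda(v_{\lambda,k}) \nearrow 0$ and $\|v_{\lambda,k}\| \to 0$. Moreover, $\Phi_\lambda$ has no nontrivial critical point with critical value in $\mathbb{R}\setminus I^-$.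
   Context: Scaled framework. $W$ is a reflexive (real) Banach space with dual $W^*$; $\rightharpoonup$ is weak convergence. $W$ carries a scaling: a continuous map $W\times[0,\infty)\to W$, $(u,t)\mapsto u_t$, with (A1) $(u_{t_1})_{t_2}=u_{t_1t_2}$ for all $u\in W$, $t_1,t_2\ge0$; (A2) $(\tau u)_t=\tau u_t$ for all $u\in W$, $\tau\in\mathbb{R}$, $t\ge0$; (A3) $u_0=0$, $u_1=u$; (A4) $u_t$ is bounded on bounded sets in $W\times[0,\infty)$; (A5) for some (fixed) $s>0$, $\|u_t\|=O(t^s)$ as $t\to\infty$ uniformly in $u$ on bounded sets. A potential operator is $p\in C(W,W^* )$ that is the Fréchet derivative of some $P\in C^1(W,\mathbb{R})$ (its potential, normalized by $P(0)=0$). A scaled operator is an odd potential operator $A_s$ that maps bounded sets into bounded sets and satisfies $A_s(u_t)v_t=t^sA_s(u)v$ for all $u,v\in W$, $t\ge0$. Given are scaled operators $A_s,B_s$ with potentials $I_s(u)=\int_0^1A_s(\tau u)u\,d\tau$, $J_s(u)=\int_0^1B_s(\tau u)u\,d\tau$, and odd potential operators $f,g\in C(W,W^* )$ with potentials $F(u)=\int_0^1f(\tau u)u\,d\tau$, $G(u)=\int_0^1g(\tau u)u\,d\tau$, satisfying: (A6) $A_s(u)u>0$ for $u\ne0$; (A7) every sequence with $u_j\rightharpoonup u$ and $A_s(u_j)(u_j-u)\to0$ has a subsequence converging strongly to $u$; (A8) $B_s(u)u>0$ for $u\neq0$; (A9) $u_j\rightharpoonup u$ implies $B_s(u_j)\to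 B_s(u)$ in $W^*$; (A10) $I_s(u)\to\infty$ as $\|u\|\to\infty$; (A11) every solution of $A_s(u)=\lambda B_s(u)$ ($\lambda\in\mathbb{R}$) satisfies $I_s(u)=\lambda J_s(u)$; (H1) for some $r>s>q>0$, $f(u_t)v_t=t^qf(u)v$ and $g(u_t)v_t=t^rg(u)v$ for all $u,v\in W$, $t\ge0$; (H2) $u_j\rightharpoonup u$ implies $f(u_j)\to f(u)$ and $g(u_j)\to g(u)$ in $W^*$ (in particular $f,g$ map bounded sets into bounded sets); (H3) for all $\alpha,\beta,\gamma,\delta\in\mathbb{R}$, every solution of $\alpha A_s(u)=\beta B_s(u)+\gamma f(u)+\delta g(u)$ satisfies $s\alpha I_s(u)=s\beta J_s(u)+q\gamma F(u)+r\delta G(u)$. Notation. $\Phi_\lambda(u)=I_s(u)-\lambda J_s(u)-F(u)-G(u)$ on $W$. For $c\in\mathbb{R}$, $\lambda_c(u)=\dfrac{I_s(u)-F(u)-G(u)-c}{J_s(u)}$ on $W\setminus\{0\}$ (note $J_s>0$ there). $\mathcal{M}_s=\{u\in W:I_s(u)=1\}$. The scaled Nehari set is $\mathcal{N}_c=\{u_t:u\in\mathcal{M}_s,\ t>0,\ \varphi_{c,u}'(t)=0\}$ with $\varphi_{c,u}(t)=\lambda_c(u_t)$; equivalently $\mathcal{N}_c=\{u\in W\setminus\{0\}:(s-q)F(u)-(r-s)G(u)+cs=0\}$. $h(u)=(s-q)f(u)-(r-s)g(u)$. $\Lambda_c=\lambda_c|_{\mathcal{N}_c}$. $i(M)$ is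 the Fadell–Rabinowitz $\mathbb{Z}_2$-cohomological index of a symmetric ($M=-M$) set $M\subset W\setminus\{0\}$: $i(\emptyset)=0$, and for $M\neq\emptyset$, with $\overline M=M/\{u\sim-u\}$, classifying map $\theta:\overline M\to\mathbb{RP}^\infty$ of $M\to\overline M$, and $\omega$ the generator of $H^1(\mathbb{RP}^\infty;\mathbb{Z}_2)$, $i(M)=\sup\{m\ge1:\theta^*(\omega^{m-1})\neq0\}$ (Alexander–Spanier cohomology, $\mathbb{Z}_2$ coefficients). For $k\ge1$, $$\lambda_k=\inf\Big\{\sup_{u\in M}\tfrac{1}{J_s(u)}: M\subset\mathcal{M}_s\text{ symmetric},\ i(M)\ge k\Big\},\qquad \lambda_{c,k}=\inf\Big\{\sup_{u\in M}\Lambda_c(u): M\subset\mathcal{N}_c\text{ symmetric},\ i(M)\ge k\Big\}.$$ $a_k\nearrow a$ means $(a_k)$ is nondecreasing with limit $a$ (possibly $\infty$). ''Decreasing'' means strictly decreasing.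
   Formalization: W is assumed infinite-dimensional; in finite dimension (e.g. W = ℝ, u_t = tu, s = 2, q = 3/2, A_s = B_s = u, f = sgn(u)|u|^{1/2}, g = 0) λ_{c,k} is the infimum of an empty set for k > dim W, and (i) and (iii) fail. *)

(* Defs.v *)
From HB Require Import structures.
From mathcomp Require Import all_boot all_order all_algebra.
From mathcomp Require Import generic_quotient.
From mathcomp Require Import all_classical all_reals all_analysis.

Set Implicit Arguments.
Unset Strict Implicit.
Unset Printing Implicit Defensive.

Import Order.TTheory GRing.Theory Num.Theory.
Import numFieldNormedType.Exports.

Local Open Scope classical_set_scope.
Local Open Scope ring_scope.

(* Alexander-Spanier cohomology with coefficients in Z/2 = 'F_2, at the level
   of cochains: a p-cochain is an arbitrary function of p+1 points, and the
   complex is the quotient by the locally zero cochains. *)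
Section AlexanderSpanier.
Context {X : topologicalType}.

Definition cochain (p : nat) := ('I_p.+1 -> X) -> 'F_2.

Definition locally_zero p (phi : cochain p) :=
  forall y : X, exists2 V : set X,
    nbhs y V & forall x : 'I_p.+1 -> X, (forall i, V (x i)) -> phi x = 0.

(* The signs (-1)^i are trivial modulo 2. *)
Definition coboundary p (phi : cochain p) : cochain p.+1 :=
  fun x => \sum_(i < p.+2) phi (fun j => x (lift i j)).

Definition cocycle p (phi : cochain p) := locally_zero (coboundary phi).

(* The class of phi in H^p vanishes. *)
Definition null_class p : cochain p -> Prop :=
  match p with
  | 0 => fun phi => locally_zero phi
  | p'.+1 => fun phi => exists psi : cochain p',
               locally_zero (fun x => phi x - coboundary psi x)
  end.

(* (phi \cup psi)(x_0,...,x_(p+q)) = phi(x_0,...,x_p) psi(x_p,...,x_(p+q)) *)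
Definition cup p q (phi : cochain p) (psi : cochain q) : cochain (p + q) :=
  fun x => phi (fun i => x (inord i)) * psi (fun i => x (inord (p + i))).

Fixpoint cup_power (w : cochain 1) (n : nat) : cochain n :=
  match n with
  | 0 => fun=> 1
  | n'.+1 => cup w (@cup_power w n')
  end.

(* w is a cocycle whose class spans H^1 over Z/2. *)
Definition H1_generator (w : cochain 1) :=
  cocycle w /\
  forall z : cochain 1, cocycle z ->
    exists a : 'F_2, null_class (fun x => z x - a * w x).

End AlexanderSpanier.

Arguments cochain : clear implicits.
Arguments cup_power {X} w n.

Definition pullback {X Y : topologicalType} (theta : X -> Y) p
  (phi : cochain Y p) : cochain X p := fun x => phi (theta \o x).

Definition symmetric_set {V : zmodType} (M : set V) := forall u, M u -> M (- u).

(* The quotient of a subset M, with its subspace topology, by u ~ -u. *)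
Section AntipodalQuotient.
Context {V : PreTopologicalZmodule.type} (M : set V).

Definition antipodal_rel (x y : M) : bool :=
  (\val x == \val y) || (\val x == - \val y).

Lemma antipodal_refl : reflexive antipodal_rel.
Proof. by move=> x; rewrite /antipodal_rel eqxx. Qed.

Lemma antipodal_sym : symmetric antipodal_rel.
Proof.
by move=> x y; rewrite /antipodal_rel eq_sym -eqr_oppLR [- _ == _]eq_sym.
Qed.

Lemma antipodal_trans : transitive antipodal_rel.
Proof.
move=> y x z; rewrite /antipodal_rel.
by move=> /orP[]/eqP-> /orP[]/eqP->; rewrite ?opprK eqxx ?orbT.
Qed.

Definition antipodal_equiv :=
  EquivRel antipodal_rel antipodal_refl antipodal_sym antipodal_trans.

Definition antipodal_quot := quotient_topology {eq_quot antipodal_equiv}%qT.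

Definition antipodal_proj (x : M) : antipodal_quot :=
  (\pi_antipodal_quot x)%qT.

End AntipodalQuotient.

(* R^oo, the space of finitely supported sequences, is encoded by {poly R}
   (the sequence of coefficients); rVpoly is the inclusion R^n -> R^oo.
   The topology is that of the direct limit (union) of the R^n. *)
Definition Rinfty (R : realType) : Type := {poly R}.

HB.instance Definition _ (R : realType) := GRing.Zmodule.on (Rinfty R).

Section RinftyTopology.
Context {R : realType}.

Definition Rinfty_open (U : set (Rinfty R)) :=
  forall n, open ((fun x : 'rV[R]_n => rVpoly x : Rinfty R) @^-1` U).

Lemma Rinfty_openT : Rinfty_open setT.
Proof. by move=> n; rewrite preimage_setT; exact: openT. Qed.

Lemma Rinfty_openI : setI_closed Rinfty_open.
Proof. by move=> A B oA oB n; rewrite preimage_setI; exact: openI. Qed.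

Lemma Rinfty_open_bigcup (I : Type) (f : I -> set (Rinfty R)) :
  (forall i, Rinfty_open (f i)) -> Rinfty_open (\bigcup_i f i).
Proof. by move=> oF n; apply: bigcup_open => i _; exact: oF. Qed.

HB.instance Definition _ := @isOpenTopological.Build (Rinfty R)
  Rinfty_open Rinfty_openT Rinfty_openI Rinfty_open_bigcup.

End RinftyTopology.

Definition Sinfty (R : realType) : set (Rinfty R) :=
  [set p : Rinfty R | \sum_(i < size (p : {poly R})) (p : {poly R})`_i ^+ 2 = 1].

Definition RPinfty (R : realType) : topologicalType :=
  antipodal_quot (@Sinfty R).

Section Index.
Context {R : realType} {V : PreTopologicalZmodule.type}.

(* theta classifies the double cover M -> M/{u ~ -u}: it is covered by an
   equivariant map from M to S^oo.  Such a theta is unique up to homotopy. *)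
Definition classifying_map (M : set V)
    (theta : antipodal_quot M -> RPinfty R) :=
  continuous theta /\
  exists theta' : M -> @Sinfty R,
    [/\ continuous theta',
        forall x y : M, \val y = - \val x ->
          (\val (theta' y) : Rinfty R) = - \val (theta' x) &
        forall x : M,
          theta (antipodal_proj x) = antipodal_proj (theta' x)].

(* The Fadell-Rabinowitz index of a symmetric subset M of V \ {0}, with values
   in {0, 1, 2, ..., +oo}.  Neither the homotopy class of theta nor the class
   of w in H^1(RP^oo) depends on a choice, so the existential quantifiers just
   name "the" classifying map and "the" generator. *)
Definition fr_index (M : set V) : \bar R :=
  if `[< M = set0 >] then 0%E else
  ereal_sup [set (m%:R)%:E | m in [set m : nat | (1 <= m)%N /\
    exists theta : antipodal_quot M -> RPinfty R, classifying_map theta /\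
    exists w : cochain (RPinfty R) 1, H1_generator w /\
      ~ null_class (pullback theta (cup_power w m.-1))]].

Definition minimax (N : set V) (phi : V -> R) (k : nat) : \bar R :=
  ereal_inf [set ereal_sup [set (phi u)%:E | u in M] | M in
    [set M : set V | [/\ M `<=` N, symmetric_set M &
                         (k%:R%:E <= fr_index M)%E]]].

End Index.

(* Functionals on W are plain functions W -> R; in_dual singles out W^*. *)
Section Dual.
Context {R : realType} {W : completeNormedModType R}.

Definition in_dual (phi : W -> R) := scalar phi /\ continuous phi.

Definition dual_norm (phi : W -> R) : R :=
  sup [set `|phi v| | v in [set v : W | `|v| <= 1]].

Definition reflexive_space :=
  forall xi : (W -> R) -> R,
    (forall (a : R) phi psi, in_dual phi -> in_dual psi ->
       xi (fun v => a * phi v + psi v) = a * xi phi + xi psi) ->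
    (exists C : R, forall phi, in_dual phi -> `|xi phi| <= C * dual_norm phi) ->
    exists u : W, forall phi, in_dual phi -> xi phi = phi u.

Definition infinite_dimensional :=
  ~ exists (n : nat) (e : 'I_n -> W),
      forall u, exists a : 'I_n -> R, u = \sum_i a i *: e i.

Definition weak_cvg (u_ : nat -> W) (u : W) :=
  forall phi, in_dual phi -> phi (u_ j) @[j --> \oo] --> phi u.

Definition weak_to_strong (p : W -> W -> R) :=
  forall (u_ : nat -> W) (u : W), weak_cvg u_ u ->
    dual_norm (fun v => p (u_ j) v - p u v) @[j --> \oo] --> (0 : R).

Definition potential_operator (p : W -> W -> R) :=
  [/\ forall u, in_dual (p u),
      forall u, dual_norm (fun v => p w v - p u v) @[w --> u] --> (0 : R) &
      exists P : W -> R, forall u,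
        differentiable P u /\ forall v, 'd P u v = p u v].

Definition potential (p : W -> W -> R) (u : W) : R :=
  \int[lebesgue_measure]_(tau in `[0 : R, 1]) p (tau *: u) u.

Definition odd_operator (p : W -> W -> R) := forall u v, p (- u) v = - p u v.

Definition critical_point (phi : W -> R) (u : W) :=
  differentiable phi u /\ forall v, 'd phi u v = 0.

End Dual.

Arguments reflexive_space {R} W.
Arguments infinite_dimensional {R} W.

Section ScaledFramework.
Context {R : realType} {W : completeNormedModType R}.

(* u_t is sc u t; only the values at t >= 0 are meaningful. *)
Record is_scaling (sc : W -> R -> W) (s : R) : Prop := {
  scaling_continuous :
    {within [set x : W * R | 0 <= x.2], continuous (fun x => sc x.1 x.2)};
  scaling_comp : forall u t1 t2, 0 <= t1 -> 0 <= t2 ->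
    sc (sc u t1) t2 = sc u (t1 * t2);
  scaling_scale : forall u (tau t : R), 0 <= t ->
    sc (tau *: u) t = tau *: sc u t;
  scaling0 : forall u, sc u 0 = 0;
  scaling1 : forall u, sc u 1 = u;
  scaling_bounded : forall (B : set W) (T : R), bounded_set B ->
    bounded_set [set sc u t | u in B & t in [set t : R | 0 <= t <= T]];
  scaling_exponent_gt0 : 0 < s;
  scaling_bigO : forall B : set W, bounded_set B ->
    exists C T : R, forall u t, B u -> 0 <= t -> T <= t ->
      `|sc u t| <= C * t `^ s }.

Definition homogeneous_operator (sc : W -> R -> W) (a : R) (p : W -> W -> R) :=
  forall u v t, 0 <= t -> p (sc u t) (sc v t) = t `^ a * p u v.

Definition maps_bounded_to_bounded (p : W -> W -> R) :=
  forall B : set W, bounded_set B ->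
    exists C : R, forall u, B u -> dual_norm (p u) <= C.

Definition scaled_operator (sc : W -> R -> W) (s : R) (p : W -> W -> R) :=
  [/\ odd_operator p, potential_operator p, maps_bounded_to_bounded p &
      homogeneous_operator sc s p].

Record scaled_framework (sc : W -> R -> W) (s q r : R)
    (A B f g : W -> W -> R) : Prop := {
  sf_reflexive : reflexive_space W;
  sf_scaling : is_scaling sc s;
  sf_A : scaled_operator sc s A;
  sf_B : scaled_operator sc s B;
  sf_A_gt0 : forall u, u != 0 -> 0 < A u u;
  sf_A_compactness : forall (u_ : nat -> W) (u : W), weak_cvg u_ u ->
    A (u_ j) (u_ j - u) @[j --> \oo] --> (0 : R) ->
    exists sigma : nat -> nat,
      (forall m n, (m < n)%N -> (sigma m < sigma n)%N) /\
      u_ (sigma j) @[j --> \oo] --> u;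
  sf_B_gt0 : forall u, u != 0 -> 0 < B u u;
  sf_B_compact : weak_to_strong B;
  sf_A_coercive : forall K : R, exists rho : R, forall u : W,
    rho <= `|u| -> K <= potential A u;
  sf_AB_eigen : forall (u : W) (lambda : R),
    (forall v, A u v = lambda * B u v) ->
    potential A u = lambda * potential B u;
  sf_f : odd_operator f /\ potential_operator f;
  sf_g : odd_operator g /\ potential_operator g;
  sf_exponents : [/\ 0 < q, q < s & s < r];
  sf_f_homogeneous : homogeneous_operator sc q f;
  sf_g_homogeneous : homogeneous_operator sc r g;
  sf_f_compact : weak_to_strong f;
  sf_g_compact : weak_to_strong g;
  sf_Pohozaev : forall (alpha beta gamma delta : R) (u : W),
    (forall v, alpha * A u v = beta * B u v + gamma * f u v + delta * g u v) ->
    s * alpha * potential A u = s * beta * potential B u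
      + q * gamma * potential f u + r * delta * potential g u }.

Definition energy (A B f g : W -> W -> R) (lambda : R) (u : W) : R :=
  potential A u - lambda * potential B u - potential f u - potential g u.

(* Meaningful for u <> 0, where potential B u > 0. *)
Definition lambda_fun (A B f g : W -> W -> R) (c : R) (u : W) : R :=
  (potential A u - potential f u - potential g u - c) / potential B u.

Definition unit_level (A : W -> W -> R) : set W :=
  [set u | potential A u = 1].

Definition nehari (sc : W -> R -> W) (A B f g : W -> W -> R) (c : R) : set W :=
  [set w | exists u (t : R), [/\ unit_level A u, 0 < t,
     is_derive t 1 (fun x : R => lambda_fun A B f g c (sc u x)) 0 &
     w = sc u t]].

Definition eigenvalue_k (A B : W -> W -> R) (k : nat) : \bar R :=
  minimax (unit_level A) (fun u => (potential B u)^-1) k.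

Definition lambda_ck (sc : W -> R -> W) (A B f g : W -> W -> R)
    (c : R) (k : nat) : \bar R :=
  minimax (nehari sc A B f g c) (lambda_fun A B f g c) k.

Definition nehari_h (s q r : R) (f g : W -> W -> R) (u v : W) : R :=
  (s - q) * f u v - (r - s) * g u v.

End ScaledFramework.

(* Main.v *)
(* Since the potential of g vanishes, so does g, and for c < 0 the set N_c is
   {u != 0 : F u = -cs/(s-q)}.  Along each ray t |-> u_t the functional lambda_c
   is smallest at the point of N_c (Young's inequality), so a deformation of
   W \ {0} that lowers lambda_c can be followed by the projection onto N_c, and
   no manifold structure on N_c is needed.  The Palais-Smale condition near N_c
   follows from (A7) and the weak continuity of B_s and f; the deformation
   iterates steps along an odd continuous pseudo-gradient field.  Hence every
   lambda_{c,k} is a critical value.  Scaling by t = (-c)^(1/q) maps N_{-1} onto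
   N_c and gives lambda_{c,k} = mu_k ((-c)^(1-s/q)), where mu_k th is the k-th
   minimax level of (I_s - q/(s-q) th)/J_s on N_{-1}; likewise
   lambda_k = mu_k 0.  The function mu_k is strictly decreasing, locally
   Lipschitz and unbounded below on [0,oo), and mu_k th -> oo as k -> oo; this
   gives (ii), and (iii) by solving mu_k th = lambda for th.
     Only three properties of the index are used.  Monotonicity under odd maps
   and the bound i(M) <= n for sets with an odd map to R^n \ {0} hold because
   every 1-cocycle on RP^oo pulls back to S^oo as, locally, the coboundary of a
   0-cochain b with b(-x) - b(x) constant, so that its cup powers are computed
   from b.  That S^(n-1) has index n is seen by evaluating the cup power on a
   chain of small simplices made by pushing the lower spheres to the pole. *)
Require Import Defs.
From HB Require Import structures.
From mathcomp Require Import all_boot all_order all_algebra.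
From mathcomp Require Import generic_quotient.
From mathcomp Require Import all_classical all_reals all_analysis.
From mathcomp Require Import ring lra.
Set Implicit Arguments.
Unset Strict Implicit.
Unset Printing Implicit Defensive.
Import Order.TTheory GRing.Theory Num.Theory.
Import numFieldNormedType.Exports.
Local Open Scope classical_set_scope.
Local Open Scope ring_scope.

(** * Cochains modulo 2 *)

(** Monotonicity of the index needs a classifying map on the target set, which for an arbitrary
    symmetric set would call for a partition of unity. All images that occur are bounded with [J_s]
    bounded below, and there weak compactness yields finitely many functionals [B u v_i] of [u]
    without common zero: normalised, they form an odd map to a finite sphere. The same functionals
    bound the index on sublevel sets, which makes the levels tend to infinity. Homotopy invariance
    of cohomology is bypassed: two odd maps to [S^oo] pull [b] back with the same jump, so the sum
    of the pullbacks descends to the quotient and links the two cocycles. The derivative of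
    [lambda_c] is merely continuous, so step lengths have no uniform lower bound and the number of
    steps varies with the point. A path of steps that stays in the strip has finite length, and at
    its limit the field would vanish; a continuous bound on the exit time then glues the steps into
    one odd map. As the deformation acts on [W \ {0}], the critical points are free ones and no
    multiplier has to be removed. *)

Lemma F2P (x : 'F_2) : x = 0 \/ x = 1.
Proof. by case: x => [[|[|//]] ?]; [left|right]; apply/val_inj. Qed.

Lemma addF2 (x : 'F_2) : x + x = 0.
Proof. by case: (F2P x) => ->; apply/val_inj. Qed.

Lemma addF2_eq0 (x y : 'F_2) : x + y = 0 -> x = y.
Proof. by case: (F2P x) => ->; case: (F2P y) => -> // /eqP. Qed.

Section SequenceCochains.
Context {X : Type}.
Implicit Types (phi psi : seq X -> 'F_2) (w : nat -> X -> X -> 'F_2).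
Implicit Types (x t : seq X).

(** The mod 2 coboundary, by recursion on the first vertex: it is dropped, or it is kept and a later
    one is dropped. On lists a single function serves as a cochain in all degrees. *)
Fixpoint dseq phi x : 'F_2 :=
  if x is a :: t then phi t + dseq (fun l => phi (a :: l)) t else 0.

(** The cup product of the 1-cochains [w 0], [w 1], ... along consecutive edges of an ordered
    simplex. The factors may differ, so that each can be changed separately within its class. *)
Fixpoint altseq w x : 'F_2 :=
  match x with
  | a :: ((b :: _) as t) => w 0 a b * altseq (fun i => w i.+1) t
  | _ => 1
  end.

Lemma dseq_ext phi psi x :
  (forall l, (size l).+1 = size x -> phi l = psi l) -> dseq phi x = dseq psi x.
Proof.
elim: x phi psi => //= a t IH phi psi h.
by rewrite h//; congr (_ + _); apply: IH => l hl; apply: h; rewrite /= hl.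
Qed.

Lemma dseqM c phi x : dseq (fun l => c * phi l) x = c * dseq phi x.
Proof.
elim: x phi => [|a t IH] phi /=; first by rewrite mulr0.
by rewrite IH mulrDr.
Qed.

Lemma dseqD phi psi x : dseq (fun l => phi l + psi l) x = dseq phi x + dseq psi x.
Proof.
elim: x phi psi => [|a t IH] phi psi /=; first by rewrite addr0.
by rewrite IH addrACA.
Qed.

Lemma dseq_cons phi a t :
  dseq phi (a :: t) = phi t + dseq (fun l => phi (a :: l)) t.
Proof. by []. Qed.

Lemma altseq_cons w a b t :
  altseq w [:: a, b & t] = w 0 a b * altseq (fun i => w i.+1) (b :: t).
Proof. by []. Qed.

Definition cup1 (e : X -> X -> 'F_2) psi x : 'F_2 :=
  if x is a :: ((b :: _) as t) then e a b * psi t else 0.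

(** Leibniz rule: the faces omitting [a] and [b] have coefficients [e b c] and [e a c], whose sum is
    [e a b] because [e] is closed on the triangle. *)
Lemma dseq_cup1 e psi a b c t : e a b + e b c + e a c = 0 ->
  dseq (cup1 e psi) [:: a, b, c & t] = e a b * dseq psi [:: b, c & t].
Proof.
move=> h; have heq : e a b = e b c + e a c by apply: addF2_eq0; rewrite addrA.
rewrite !(dseq_cons _ a) !dseq_cons /= dseqM addrA -mulrDl -heq.
by rewrite !mulrDr.
Qed.

Definition cup0 (gam : X -> 'F_2) psi x : 'F_2 :=
  if x is a :: _ then gam a * psi x else 0.

Lemma dseq_cup0 gam psi a b t : dseq psi [:: a, b & t] = 0 ->
  dseq (cup0 gam psi) [:: a, b & t] = (gam a + gam b) * psi (b :: t).
Proof.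
rewrite dseq_cons => /addF2_eq0 h.
by rewrite dseq_cons dseqM -h mulrDl addrC.
Qed.

Definition cocycle_on (e : X -> X -> 'F_2) (V : set X) :=
  forall a b c, V a -> V b -> V c -> e a b + e b c + e a c = 0.

Fixpoint all_in (V : set X) x : Prop :=
  if x is a :: t then V a /\ all_in V t else True.

Lemma dseq_altseq w (V : set X) x : (forall i, cocycle_on (w i) V) ->
  all_in V x -> (1 < size x)%N -> dseq (altseq w) x = 0.
Proof.
elim: x w => // a [|b [|c t]] IH w hw // [Va [Vb hV]] _.
  by rewrite /= addr0 addF2.
rewrite (@dseq_ext _ (cup1 (w 0%N) (altseq (fun i => w i.+1)))); last first.
  by case=> [|a' [|b' l]].
rewrite dseq_cup1; last by apply: hw => //; case: hV.
by rewrite IH ?mulr0// => i; exact: hw.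
Qed.

Definition twist w (gam : nat -> X -> 'F_2) (i : nat) (a b : X) : 'F_2 :=
  w i a b + (gam i a + gam i b).

Lemma twist_cocycle w gam V i : cocycle_on (w i) V -> cocycle_on (twist w gam i) V.
Proof.
move=> h a b c Va Vb Vc; rewrite /twist -[RHS](h a b c)//.
rewrite -[RHS]addr0 -(addF2 (gam i a + gam i b + gam i c)).
by ring.
Qed.

(** Comes from [w0 P + (w0 + d gam0) P' = w0 (P + P') + d gam0 P'], where [P] and [P'] are the
    products of the remaining factors before and after twisting: [P + P'] is treated recursively,
    and [d gam0 P'] is the coboundary of [gam0 \cup P'] as [P'] is closed. *)
Fixpoint homotopy w gam (n : nat) : seq X -> 'F_2 :=
  if n is n'.+1 then fun x =>
    cup1 (w 0%N) (homotopy (fun i => w i.+1) (fun i => gam i.+1) n') x +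
    cup0 (gam 0%N) (altseq (twist (fun i => w i.+1) (fun i => gam i.+1))) x
  else fun=> 0.

Lemma altseq_twist w gam V x n : (forall i, cocycle_on (w i) V) ->
  all_in V x -> size x = n.+1 ->
  altseq w x + altseq (twist w gam) x = dseq (homotopy w gam n) x.
Proof.
elim: n w gam x => [|n IH] w gam [|a [|b t]] hw //.
  by move=> _ _; rewrite /= addF2 addr0.
move=> [Va [Vb hV]] [sz].
set w' := fun i => w i.+1; set gam' := fun i => gam i.+1.
have hw' i : cocycle_on (w' i) V by exact: hw.
set w'' := twist w' gam'.
have hw'' i : cocycle_on (w'' i) V by exact: twist_cocycle.
have IHt := IH w' gam' (b :: t) hw' (conj Vb hV) (congr1 S sz).
have hA : dseq (altseq w'') [:: a, b & t] = 0.
  by apply: (@dseq_altseq _ V).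
rewrite [homotopy _ _ _]/= dseqD dseq_cup0// 2!altseq_cons.
rewrite [twist w gam 0 a b]/(w 0%N a b + _) mulrDl addrA -mulrDr; congr (_ + _).
case: t hV sz IHt {hA} => [|c t] hV sz IHt.
  by rewrite [X in _ * (X + _)]/= [X in _ * (_ + X)]/= addF2 mulr0 /= !addr0.
rewrite dseq_cup1; first by rewrite -IHt.
by apply: hw => //; case: hV.
Qed.

End SequenceCochains.

Definition pairfun {T} (a b : T) (i : 'I_2) : T := if i == ord0 then a else b.

Lemma codom_ord {X : Type} n (x : 'I_n.+1 -> X) :
  codom x = x ord0 :: codom (fun j => x (lift ord0 j)).
Proof.
by rewrite /codom /image_mem enum_ordSl /= -map_comp.
Qed.

Lemma coboundary_dseq {X : Type} (phi : seq X -> 'F_2) n (x : 'I_n -> X) :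
  \sum_(i < n) phi (codom (fun j => x (lift i j))) = dseq phi (codom x).
Proof.
elim: n phi x => [|n IH] phi x.
  by rewrite big_ord0 /codom /image_mem enum_ord0.
rewrite big_ord_recl codom_ord dseq_cons; congr (_ + _).
rewrite -IH; apply: eq_bigr => -[i hi] _; congr (phi _).
case: n hi {IH} x => // n hi x.
rewrite codom_ord; congr (x _ :: _); first exact/val_inj.
congr codom; apply/funext => j; congr x; apply/val_inj.
by rewrite /= /bump /= !add1n ltnS addnS.
Qed.

Lemma cup_power_altseq {X : topologicalType} (w : cochain X 1) n (x : 'I_n.+1 -> X) :
  cup_power w n x = altseq (fun=> fun a b => w (pairfun a b)) (codom x).
Proof.
elim: n x => [|n IH] x.
  by rewrite codom_ord /codom /image_mem enum_ord0.
rewrite [cup_power _ _]/= /cup IH !codom_ord altseq_cons.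
congr (_ * _); first congr (w _); last congr (altseq _ _).
  apply/funext => i; rewrite /pairfun.
  case: i => [[|[|//]] hi]; rewrite ?eqxx; congr x; apply/val_inj => /=; rewrite inordK//.
congr (_ :: _); first by congr x; apply/val_inj; rewrite /= inordK.
congr codom; apply/funext => i; congr x; apply/val_inj.
by rewrite /= inordK// ltnS; apply: (ltn_ord (lift ord0 i)).
Qed.

Section SeqNull.
Context {X : topologicalType}.
Implicit Types (Phi psi : seq X -> 'F_2).

Definition tuple_of_seq (a : X) n (s : seq X) : 'I_n -> X := fun i => nth a s i.

Lemma nth_codom_ord a n (x : 'I_n -> X) (i : 'I_n) : nth a (codom x) i = x i.
Proof.
rewrite /codom /image_mem (nth_map i) ?size_enum_ord ?ltn_ord//.
by rewrite nth_ord_enum.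
Qed.

Lemma codom_tuple_of_seq a n (s : seq X) : size s = n ->
  codom (@tuple_of_seq a n s) = s.
Proof.
move=> sz; apply: (@eq_from_nth _ a); first by rewrite size_codom card_ord.
move=> i; rewrite size_codom card_ord => hi.
by rewrite (nth_codom_ord _ _ (Ordinal hi)) /tuple_of_seq.
Qed.

Lemma tuple_of_seq_codom a n (x : 'I_n -> X) : tuple_of_seq a (codom x) = x.
Proof.
by apply/funext => i; rewrite /tuple_of_seq nth_codom_ord.
Qed.

Lemma all_in_nth (V : set X) a (s : seq X) :
  all_in V s <-> forall i, (i < size s)%N -> V (nth a s i).
Proof.
elim: s => [|b s IH] /=; first by split.
split=> [[Vb /IH h] [|i]//|h]; first exact: h.
by split; [exact: (h 0%N)|apply/IH => i hi; exact: (h i.+1)].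
Qed.

Lemma all_in_tuple (V : set X) a n (s : seq X) : size s = n -> all_in V s ->
  forall i : 'I_n, V (tuple_of_seq a s i).
Proof. by move=> sz /(@all_in_nth V a) h i; apply: h; rewrite sz. Qed.

Lemma all_in_codom (V : set X) n (x : 'I_n -> X) :
  (forall i, V (x i)) -> all_in V (codom x).
Proof.
case: n x => [|n] x h; first by rewrite /codom /image_mem enum_ord0.
apply/(@all_in_nth V (x ord0)) => i; rewrite size_codom card_ord => hi.
by rewrite (nth_codom_ord _ _ (Ordinal hi)).
Qed.

Definition seq_null (n : nat) Phi := exists psi, forall y : X,
  exists2 V, nbhs y V & forall x, all_in V x -> size x = n.+1 -> Phi x = dseq psi x.

Lemma null_class_seq p Phi :
  null_class (fun x : 'I_p.+2 -> X => Phi (codom x)) <-> seq_null p.+1 Phi.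
Proof.
split=> [[psi' h]|[psi h]].
  (* Simplices are non-empty, so the head of the list can serve as the default value of [nth]. *)
  pose psi (s : seq X) := if s is a :: _ then psi' (tuple_of_seq a s) else 0.
  exists psi => y; have [V yV hV] := h y; exists V => // x xV sz.
  have := hV (@tuple_of_seq y p.+2 x) (all_in_tuple y sz xV).
  rewrite codom_tuple_of_seq// => /eqP; rewrite subr_eq0 => /eqP ->.
  rewrite -{2}(codom_tuple_of_seq y sz) -coboundary_dseq.
  apply: eq_bigr => i _; set z := (fun j => _).
  rewrite codom_ord /= -codom_ord; congr psi'.
  by rewrite tuple_of_seq_codom.
exists (fun x => psi (codom x)) => y; have [V yV hV] := h y.
exists V => // x xV; rewrite (hV (codom x)) ?size_codom ?card_ord//.
  by rewrite [coboundary _ _](@coboundary_dseq _ psi p.+2) subrr.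
exact: all_in_codom.
Qed.

Definition edge (w : cochain X 1) (a b : X) : 'F_2 := w (pairfun a b).

Lemma cocycleP (w : cochain X 1) :
  cocycle w <-> forall y : X, exists2 V, nbhs y V & cocycle_on (edge w) V.
Proof.
pose Phi (s : seq X) := if s is [:: a; b] then edge w a b else 0.
have wE (x : 'I_2 -> X) : w x = Phi (codom x).
  rewrite !codom_ord /codom /image_mem enum_ord0 /= /edge; congr w.
  by apply/funext => -[[|[|//]] hi]; rewrite /pairfun /=; congr x; apply/val_inj.
have cE (x : 'I_3 -> X) : coboundary w x = dseq Phi (codom x).
  rewrite -coboundary_dseq; apply: eq_bigr => i _; exact: wE.
split=> h y; have [V yV hV] := h y; exists V => //.
  move=> a b c Va Vb Vc.
  have := hV (@tuple_of_seq y 3 [:: a; b; c]).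
  rewrite cE codom_tuple_of_seq//= !addr0 => <-.
    by rewrite [RHS]addrA [RHS]addrC addrA.
  by apply: (@all_in_tuple V).
move=> x xV; rewrite cE !codom_ord /codom /image_mem enum_ord0 /= !addr0.
set a := x _; set b := x _; set c := x _.
have <- : edge w c a + edge w a b + edge w c b = 0 by apply: hV; exact: xV.
by ring.
Qed.

End SeqNull.

(** * Antipodal quotients *)

Section AntipodalQuotientTheory.
Context {V : PreTopologicalZmodule.type} (M : set V).
Implicit Types (x y : M).

Lemma antipodal_projP x y :
  antipodal_proj x = antipodal_proj y <-> (\val x = \val y \/ \val x = - \val y).
Proof.
rewrite /antipodal_proj; split=> [/eqmodP/orP[]/eqP|h]; [by left|by right|].
by apply/eqmodP/orP; case: h => ->; rewrite eqxx; [left|right].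
Qed.

(** Descent through a chosen representative, meaningful for even [f]. It also applies to 0-cochains,
    which need not be continuous. *)
Definition antipodal_lift {T} (f : M -> T) (z : antipodal_quot M) : T :=
  f (repr z).

Lemma antipodal_repr (z : antipodal_quot M) : antipodal_proj (repr z) = z.
Proof. by rewrite /antipodal_proj reprK. Qed.

Definition even_on {T} (f : M -> T) := forall x y, \val y = - \val x -> f y = f x.

Lemma antipodal_liftE T (f : M -> T) x : even_on f ->
  antipodal_lift f (antipodal_proj x) = f x.
Proof.
move=> fe; rewrite /antipodal_lift.
have /antipodal_projP := antipodal_repr (antipodal_proj x).
by case=> h; [congr f; exact: val_inj|exact: fe].
Qed.

Lemma antipodal_proj_continuous : continuous (@antipodal_proj V M).
Proof. exact: pi_continuous. Qed.

Lemma antipodal_lift_continuous (T : topologicalType) (f : M -> T) :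
  continuous f -> even_on f -> continuous (antipodal_lift f).
Proof.
move=> fc fe; apply/quotient_continuous.
rewrite (_ : _ \o _ = f)//; apply/funext => x; exact: antipodal_liftE.
Qed.

Hypothesis opp_cont : continuous (-%R : V -> V).
Hypothesis symM : symmetric_set M.

(** The projection is open: the saturation of an open set is its union with the antipodal one. *)
Lemma nbhs_antipodal_proj y (U : set M) : nbhs y U ->
  nbhs (antipodal_proj y) (@antipodal_proj V M @` U).
Proof.
rewrite nbhsE => -[Q [[Q' oQ' Q'E] Qy] QU].
rewrite nbhsE; exists (@antipodal_proj V M @` Q); last exact: image_subset.
split; last by exists y.
exists (Q' `|` (-%R @^-1` Q')).
  by apply: openU => //; move/continuousP: opp_cont; apply.
apply/seteqP; split => x /=.
  case=> [Q'x|Q'x]; first by exists x => //; rewrite -Q'E.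
  have Mx : M (- \val x) by apply: symM; exact: set_mem (valP x).
  exists (SigSub (mem_set Mx)); first by rewrite -Q'E.
  by apply/antipodal_projP; right.
case=> z Qz /antipodal_projP; rewrite -Q'E/= in Qz.
case=> h; [left|right].
  by have <- : set_val z = set_val x := h.
by have <- : set_val z = - set_val x by [].
Qed.

End AntipodalQuotientTheory.

Lemma altseq_eq_on {X : Type} (w w' : nat -> X -> X -> 'F_2) (V : set X) x :
  (forall i a b, V a -> V b -> w i a b = w' i a b) -> all_in V x ->
  altseq w x = altseq w' x.
Proof.
elim: x w w' => [|a [|b t] IH] w w' h // [Va [Vb hV]].
rewrite !altseq_cons h//; congr (_ * _).
by apply: IH => // i; exact: h.
Qed.

Lemma altseq_eq0 {X : Type} (w : nat -> X -> X -> 'F_2) (V : set X) x i :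
  (forall a b, V a -> V b -> w i a b = 0) -> all_in V x -> (i.+1 < size x)%N ->
  altseq w x = 0.
Proof.
elim: x w i => [|a [|b t] IH] w [|i] h // [Va [Vb hV]] sz; rewrite altseq_cons.
  by rewrite h// mul0r.
by rewrite (IH (fun i => w i.+1) i) ?mulr0.
Qed.

Lemma altseq_map {X Y : Type} (h : X -> Y) (w : nat -> Y -> Y -> 'F_2) x :
  altseq w (map h x) = altseq (fun i a b => w i (h a) (h b)) x.
Proof.
elim: x w => [|a [|b t] IH] w //.
by rewrite [map _ _]/= !altseq_cons -(IH (fun i => w i.+1)).
Qed.

Lemma dseq_map {X Y : Type} (h : X -> Y) (phi : seq Y -> 'F_2) x :
  dseq phi (map h x) = dseq (fun s => phi (map h s)) x.
Proof. by elim: x phi => //= a t IH phi; rewrite IH. Qed.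

Lemma all_in_map {X Y : Type} (h : X -> Y) (V : set Y) x :
  all_in V (map h x) <-> all_in (h @^-1` V) x.
Proof. by elim: x => //= a t ->. Qed.

Lemma all_inI {X : Type} (V W : set X) x :
  all_in (V `&` W) x <-> all_in V x /\ all_in W x.
Proof.
elim: x => [|a t IH]; first by split.
by split=> /=; [move=> [[? ?] /IH[]]|move=> [[? ?] [? ?]]; split=> //; exact/IH].
Qed.

Lemma all_inS {X : Type} (V W : set X) x : V `<=` W -> all_in V x -> all_in W x.
Proof. by move=> VW; elim: x => //= a t IH [/VW ? /IH]. Qed.

Lemma codom_comp {X Y : Type} n (h : X -> Y) (x : 'I_n -> X) :
  codom (h \o x) = map h (codom x).
Proof. by rewrite /codom /image_mem -map_comp. Qed.

Lemma pullback_cup_power {X Y : topologicalType} (theta : X -> Y)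
    (w : cochain Y 1) n : pullback theta (cup_power w n) =
  (fun x => altseq (fun=> fun a b => edge w (theta a) (theta b)) (codom x)).
Proof.
by apply/funext => x; rewrite /pullback cup_power_altseq codom_comp altseq_map.
Qed.

Lemma cocycle_on_pullback {X Y : topologicalType} (theta : X -> Y)
    (w : cochain Y 1) : cocycle w -> continuous theta ->
  forall y : X, exists2 V, nbhs y V &
    cocycle_on (fun a b => edge w (theta a) (theta b)) V.
Proof.
move=> /cocycleP cw ct y; have [V yV hV] := cw (theta y).
exists (theta @^-1` V); first exact: ct.
by move=> a b c Va Vb Vc; exact: hV.
Qed.

(** * Comparison and vanishing of cup powers *)

Section Transfer.
Context {X Y Z : topologicalType}.
Variables (w : cochain Z 1) (t1 : X -> Z).
Hypotheses (cw : cocycle w) (ct1 : continuous t1).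

(** A cup power is insensitive to adding the coboundary of a global 0-cochain [gam] to its factors.
    This takes the place of the homotopy invariance of classifying maps. *)
Lemma null_class_transfer (t2 : Y -> Z) (h : X -> Y) (gam : X -> 'F_2) m :
  continuous h ->
  (forall y : X, exists2 V, nbhs y V & forall a b, V a -> V b ->
     edge w (t1 a) (t1 b) + (gam a + gam b) = edge w (t2 (h a)) (t2 (h b))) ->
  null_class (pullback t2 (cup_power w m)) ->
  null_class (pullback t1 (cup_power w m)).
Proof.
move=> ch hgam; case: m => [|m].
  move=> h2 y; have [V yV hV] := h2 (h y).
  by exists (h @^-1` V); [exact: ch|move=> x xV; exact: (hV (h \o x))].
rewrite !pullback_cup_power => /(null_class_seq _ (altseq _)) [psi hpsi].
apply/(null_class_seq _ (altseq _)).
pose e1 (i : nat) a b := edge w (t1 a) (t1 b).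
pose g1 (i : nat) := gam.
exists (fun s => homotopy e1 g1 m.+1 s + psi (map h s)) => y.
have [V1 yV1 hV1] := hgam y.
have [V2 yV2 hV2] := hpsi (h y).
have [V3 yV3 hV3] := cocycle_on_pullback cw ct1 y.
exists (V1 `&` (h @^-1` V2 `&` V3)); first by do 2 ?[apply: filterI => //]; exact: ch.
move=> x /all_inI[xV1] /all_inI[xV2 xV3] sz.
rewrite dseqD -dseq_map -hV2 ?size_map//; last exact/all_in_map.
rewrite -(@altseq_twist _ e1 g1 V3)//.
rewrite altseq_map -addrA -[LHS]addr0; congr (_ + _).
rewrite (@altseq_eq_on _ _ (fun _ a b => edge w (t2 (h a)) (t2 (h b))) V1)//.
  by rewrite addF2.
Qed.

(** Each factor is twisted by its own [gam i]. Near a given point one of the twisted factors is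
    zero, hence so is the product, and [homotopy] is a primitive of the untwisted one. *)
Lemma null_class_vanish n (gam : nat -> X -> 'F_2) m : (n <= m)%N -> (0 < m)%N ->
  (forall y : X, exists i, (i < n)%N /\ exists2 V, nbhs y V & forall a b,
     V a -> V b -> edge w (t1 a) (t1 b) = gam i a + gam i b) ->
  null_class (pullback t1 (cup_power w m)).
Proof.
case: m => // m nm _ h.
rewrite !pullback_cup_power; apply/(null_class_seq _ (altseq _)).
pose e1 (i : nat) a b := edge w (t1 a) (t1 b).
exists (homotopy e1 gam m.+1) => y.
have [i [lin [V1 yV1 hV1]]] := h y.
have [V3 yV3 hV3] := cocycle_on_pullback cw ct1 y.
exists (V1 `&` V3); first exact: filterI.
move=> x /all_inI[xV1 xV3] sz.
rewrite -(@altseq_twist _ e1 gam V3)//.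
rewrite [X in _ + X](@altseq_eq0 _ _ V1 _ i) ?addr0//.
  by move=> a b Va Vb; rewrite /twist /e1 hV1// addF2.
by rewrite sz ltnS (leq_trans lin).
Qed.

End Transfer.

(** * Spheres and the classifying space *)

Section SphereGeometry.
Context {R : realType}.
Implicit Types (p e : Rinfty R).

Definition pcoef p (i : nat) : R := (p : {poly R})`_i.

(** The direct limit topology of [Rinfty] is not metric, but on each finite-dimensional sphere this
    coefficientwise distance describes it. *)
Definition pclose (d : R) p e := forall i, `|pcoef p i - pcoef e i| < d.

Definition psphere (n : nat) : set (Rinfty R) :=
  [set p | @Sinfty R p /\ (size (p : {poly R}) <= n)%N].

Lemma sum_sqr_widen p n : (size (p : {poly R}) <= n)%N ->
  \sum_(i < size (p : {poly R})) (pcoef p i) ^+ 2 = \sum_(i < n) (pcoef p i) ^+ 2.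
Proof.
move=> sz; rewrite (big_ord_widen n (fun i => (pcoef p i) ^+ 2))//.
rewrite big_mkcond; apply: eq_bigr => i _; case: ifPn => //.
by rewrite -leqNgt => /(nth_default 0); rewrite /pcoef => ->; rewrite expr0n.
Qed.

Lemma psphereP n p : (size (p : {poly R}) <= n)%N ->
  psphere n p <-> \sum_(i < n) (pcoef p i) ^+ 2 = 1.
Proof.
move=> sz; rewrite -(sum_sqr_widen sz); split=> [[]//|h]; split=> //.
Qed.

Lemma psphere_coef_le1 n p i : psphere n p -> `|pcoef p i| <= 1.
Proof.
move=> ps; have [lin|nli] := ltnP i n; last first.
  by rewrite /pcoef nth_default ?normr0//; apply: leq_trans nli; case: ps.
have /(psphereP (proj2 ps)) := ps; rewrite (bigD1 (Ordinal lin))//= => h.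
rewrite -(@ler_pXn2r _ 2)// ?nnegrE// expr1n -normrX ger0_norm ?sqr_ge0//.
by rewrite -[X in _ <= X]h lerDl sumr_ge0// => j _; exact: sqr_ge0.
Qed.

Lemma psphereW n m p : (n <= m)%N -> psphere n p -> psphere m p.
Proof. by move=> nm [? sz]; split=> //; exact: leq_trans nm. Qed.

Lemma pcoefN p i : pcoef (- p) i = - pcoef p i.
Proof. exact: coefN. Qed.

Lemma SinftyN p : @Sinfty R p -> @Sinfty R (- p).
Proof.
move=> h; rewrite /Sinfty /= size_polyN -[RHS]h; apply: eq_bigr => i _.
by rewrite coefN sqrrN.
Qed.

Lemma psphereN n p : psphere n p -> psphere n (- p).
Proof. by move=> [/SinftyN ? ?]; split=> //; rewrite size_polyN. Qed.

Lemma rVpoly_psphere n (x : 'rV[R]_n) :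
  @Sinfty R (rVpoly x) <-> \sum_i (x 0 i) ^+ 2 = 1.
Proof.
have sz : (size (rVpoly x) <= n)%N by exact: size_poly.
rewrite [X in X = _ <-> _](_ : _ = \sum_(i < n) (pcoef (rVpoly x) i) ^+ 2).
  by under eq_bigr do rewrite /pcoef coef_rVpoly_ord.
by rewrite -(sum_sqr_widen sz).
Qed.

Lemma compact_sphere n : compact [set x : 'rV[R]_n | @Sinfty R (rVpoly x)].
Proof.
have -> : [set x : 'rV[R]_n | @Sinfty R (rVpoly x)] =
    (fun x : 'rV[R]_n => \sum_i (x 0 i) ^+ 2) @^-1` [set 1].
  by apply/seteqP; split=> x /rVpoly_psphere.
have cc : compact [set v : 'rV[R]_n | forall i, [set` `[(-1 : R), 1]] (v ord0 i)].
  by apply: (@rV_compact R n (fun=> [set` `[(-1 : R), 1]])) => i; exact: segment_compact.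
apply: (subclosed_compact _ cc).
  apply: (continuous_closedP _).1; last exact: closed_eq.
  apply: continuous_big => [|i _ x]; first exact: add_continuous.
  apply: (@continuous_comp _ _ _ (fun x : 'rV[R]_n => x 0 i)
    (fun y : R => y ^+ 2)); first exact: coord_continuous.
  exact: exprn_continuous.
move=> x /= xS i; rewrite in_itv /= -ler_norml.
rewrite -(@ler_pXn2r _ 2)// ?nnegrE// expr1n -normrX ger0_norm ?sqr_ge0//.
by rewrite -[leRHS]xS (bigD1 i)//= lerDl sumr_ge0// => j _; exact: sqr_ge0.
Qed.

(** Lebesgue numbers on a compact sphere: the topology supplies neighbourhoods, while simplices are
    measured by [pclose]. [P] is meant to be a cochain identity on all simplices inside the set,
    which subsets inherit. *)
Lemma psphere_lebesgue (P : set (Rinfty R) -> Prop) n :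
  (forall A B, A `<=` B -> P B -> P A) ->
  (forall p, psphere n p -> exists2 U, nbhs p U & P (U `&` psphere n)) ->
  exists2 d : R, 0 < d & forall p, psphere n p ->
    P [set q | psphere n q /\ pclose d p q].
Proof.
move=> Panti Ploc.
have cov := (compact_near_coveringP _).1 (@compact_sphere n).
have := cov R (0 : R)^'+ (fun d x =>
  P [set q | psphere n q /\ pclose d (rVpoly x) q]) _ _.
case=> [x Sx|].
  have /Ploc[U] : psphere n (rVpoly x) by split => //; exact: size_poly.
  rewrite nbhsE => -[Q [oQ Qx] QU] PU.
  have /nbhs_ballP[e /= e0 eQ] : nbhs x ((fun x : 'rV[R]_n => rVpoly x : Rinfty R) @^-1` Q).
    by apply: open_nbhs_nbhs; split => //; exact: oQ.
  exists (ball x (e / 2), [set d | 0 < d < e / 2]) => /=.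
    split; first by apply: nbhsx_ballx; rewrite divr_gt0.
    by near=> d; apply/andP; split; near: d;
       [exact: nbhs_right_gt|apply: nbhs_right_lt; rewrite divr_gt0].
  move=> [x' d] [/= xx' /andP[d0 de]]; apply: Panti PU => q [[Sq sq] qx'].
  split=> //; apply: QU; rewrite -[q](poly_rV_K sq); apply: eQ.
  rewrite (splitr e); apply: (ball_triangle xx').
  split; first by rewrite divr_gt0.
  move=> i j; rewrite /ball/= (ord1 i); apply: lt_trans de.
  have := qx' j; rewrite /pcoef coef_rVpoly_ord.
  by rewrite -{1}(poly_rV_K sq) coef_rVpoly_ord.
move=> Q Q0 sub.
have : \forall d \near (0 : R)^'+, 0 < d /\ ([set x : 'rV[R]_n | @Sinfty R (rVpoly x)] `<=` (fun x => P [set q | psphere n q /\ pclose d (rVpoly x) q])).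
  near=> d; split.
    by near: d; exact: nbhs_right_gt.
  by near: d; exists Q.
move=> /filter_ex [d [d0 hd]]; exists d => // p [Sp sp].
by rewrite -(poly_rV_K sp); apply: hd; rewrite /= (poly_rV_K sp).
Unshelve. all: end_near. Qed.

End SphereGeometry.

Section SphereRotation.
Context {R : realType}.
Implicit Types (p e : Rinfty R) (t : R).

(* Rational parametrization of the quarter circle, so that [rot n t] moves p
   to the orthogonal unit vector 'X^n inside the unit sphere. *)
Definition ralpha t : R := (1 - t ^+ 2) / (1 + t ^+ 2).
Definition rbeta t : R := 2 * t / (1 + t ^+ 2).

Lemma ralpha_den t : 0 < 1 + t ^+ 2.
Proof. by rewrite ltr_wpDr// sqr_ge0. Qed.

Lemma ralpha_rbeta t : ralpha t ^+ 2 + rbeta t ^+ 2 = 1.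
Proof. by rewrite /ralpha /rbeta; field; rewrite gt_eqF ?ralpha_den. Qed.

Lemma ralpha_le1 t : `|ralpha t| <= 1.
Proof.
rewrite -(@ler_pXn2r _ 2)// ?nnegrE// expr1n -normrX ger0_norm ?sqr_ge0//.
by rewrite -(ralpha_rbeta t) lerDl sqr_ge0.
Qed.

Lemma ralpha_lip t u : 0 <= t <= 1 -> 0 <= u <= 1 ->
  `|ralpha t - ralpha u| <= 4 * `|t - u|.
Proof.
move=> /andP[t0 t1] /andP[u0 u1].
have -> : ralpha t - ralpha u =
    2 * (t + u) / ((1 + t ^+ 2) * (1 + u ^+ 2)) * (u - t).
  by rewrite /ralpha; field; rewrite !gt_eqF ?ralpha_den.
rewrite normrM (distrC u) ler_wpM2r// ger0_norm.
  rewrite ler_pdivrMr ?mulr_gt0 ?ralpha_den//.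
  have : 1 <= (1 + t ^+ 2) * (1 + u ^+ 2).
    by rewrite mulr_ege1// lerDl sqr_ge0.
  by lra.
by rewrite divr_ge0 ?mulr_ge0 ?addr_ge0 ?sqr_ge0.
Qed.

Lemma rbeta_lip t u : 0 <= t <= 1 -> 0 <= u <= 1 ->
  `|rbeta t - rbeta u| <= 2 * `|t - u|.
Proof.
move=> /andP[t0 t1] /andP[u0 u1].
have -> : rbeta t - rbeta u =
    2 * (1 - t * u) / ((1 + t ^+ 2) * (1 + u ^+ 2)) * (t - u).
  by rewrite /rbeta; field; rewrite !gt_eqF ?ralpha_den.
have tu0 : 0 <= t * u by rewrite mulr_ge0.
have tu1 : t * u <= 1 by rewrite mulr_ile1.
rewrite normrM ler_wpM2r// ger0_norm.
  rewrite ler_pdivrMr ?mulr_gt0 ?ralpha_den//.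
  have : 1 <= (1 + t ^+ 2) * (1 + u ^+ 2).
    by rewrite mulr_ege1// lerDl sqr_ge0.
  by lra.
by apply: divr_ge0; apply: mulr_ge0; rewrite ?subr_ge0// addr_ge0 ?sqr_ge0.
Qed.

Definition rot n t p : Rinfty R :=
  (ralpha t *: (p : {poly R}) + rbeta t *: 'X^n)%R.

Lemma coef_rot n t p i :
  pcoef (rot n t p) i = ralpha t * pcoef p i + rbeta t * (i == n)%:R.
Proof. by rewrite /pcoef /rot coefD !coefZ coefXn. Qed.

Lemma rot0 n p : rot n 0 p = p.
Proof.
rewrite /rot /ralpha /rbeta expr0n/= subr0 addr0 divr1 mulr0 mul0r scale1r.
by rewrite scale0r addr0.
Qed.

Lemma rot1 n p : rot n 1 p = 'X^n.
Proof.
rewrite /rot /ralpha /rbeta expr1n subrr mul0r scale0r add0r mulr1.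
by rewrite divff ?scale1r.
Qed.

Lemma rot_sphere n t p : psphere n p -> psphere n.+1 (rot n t p).
Proof.
move=> [Sp sp]; apply/psphereP.
  rewrite (leq_trans (size_polyD _ _))// geq_max.
  rewrite (leq_trans (size_scale_leq _ _)) ?(leq_trans sp)//=.
  by rewrite (leq_trans (size_scale_leq _ _))// size_polyXn.
rewrite big_ord_recr/= coef_rot eqxx mulr1.
rewrite /pcoef (nth_default 0 sp) mulr0 add0r -/(pcoef _ _).
under eq_bigr => i _ do
  rewrite -/(pcoef _ _) coef_rot ltn_eqF// mulr0 addr0 exprMn.
rewrite -mulr_sumr; have /(psphereP sp) -> : psphere n p by split.
by rewrite mulr1 ralpha_rbeta.
Qed.

Lemma rot_close n t p e d : 0 < d -> pclose d p e -> pclose d (rot n t p) (rot n t e).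
Proof.
move=> d0 h i; rewrite !coef_rot opprD addrACA subrr addr0 -mulrBr normrM.
apply: le_lt_trans (h i); rewrite -[leRHS]mul1r ler_wpM2r//.
exact: ralpha_le1.
Qed.

Lemma rot_step n t u p : psphere n p -> 0 <= t <= 1 -> 0 <= u <= 1 ->
  forall i, `|pcoef (rot n t p) i - pcoef (rot n u p) i| <= 6 * `|t - u|.
Proof.
move=> Sp ht hu i; rewrite !coef_rot opprD addrACA -!mulrBl.
apply: le_trans (ler_normD _ _) _.
have -> : 6 * `|t - u| = 4 * `|t - u| + 2 * `|t - u| by ring.
apply: lerD; rewrite normrM -[leRHS]mulr1; apply: ler_pM => //.
- exact: ralpha_lip.
- exact: psphere_coef_le1 Sp.
- exact: rbeta_lip.
- by case: eqP; rewrite ?normr1 ?normr0.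
Qed.

Definition grid (N k : nat) : R := k%:R / N%:R.

Lemma grid_itv N k : (0 < N)%N -> (k <= N)%N -> 0 <= grid N k <= 1.
Proof.
move=> N0 kN; rewrite divr_ge0//= ler_pdivrMr ?ltr0n// mul1r ler_nat//.
Qed.

Lemma fine_grid (d : R) : 0 < d -> exists2 N, (0 < N)%N &
  forall n p k, psphere n p -> (k < N)%N ->
    pclose d (rot n (grid N k) p) (rot n (grid N k.+1) p).
Proof.
(* [6] is the Lipschitz constant of [rot n t p] in [t]. *)
move=> d0; exists (Num.truncn (6 / d)).+1 => // n p k Sp kN i.
set N := (Num.truncn _).+1 in kN *.
have N0 : 0 < N%:R :> R by rewrite ltr0n.
apply: le_lt_trans (rot_step Sp _ _ i) _; try exact: grid_itv (ltnW _).
  exact: grid_itv.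
rewrite distrC /grid -mulrBl -(natr1 k) addrAC subrr add0r mul1r.
rewrite ger0_norm ?invr_ge0 ?(ltW N0)// ltr_pdivrMr// mulrC -ltr_pdivrMr//.
exact: truncnS_gt.
Qed.

(** [b p] sums [z] over a discrete path from [p] to the pole ['X^n], which needs the extra dimension
    of [psphere n.+1]. For neighbouring [p] and [e] the two paths bound a ladder of small squares on
    which [z] is closed. *)
Lemma sphere_primitive (z : Rinfty R -> Rinfty R -> 'F_2) n (d : R) : 0 < d ->
  (forall p, psphere n.+1 p -> cocycle_on z [set e | psphere n.+1 e /\ pclose d p e]) ->
  exists b : Rinfty R -> 'F_2, exists2 d' : R, 0 < d' &
    forall p e, psphere n p -> psphere n e -> pclose d' p e -> z p e = b p + b e.
Proof.
move=> d0 hz; have d2 : 0 < d / 2 by rewrite divr_gt0.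
have [N N0 hN] := fine_grid d2.
pose P k p := rot n (grid N k) p.
exists (fun p => \sum_(k < N) z (P k p) (P k.+1 p)); exists (d / 2) => //.
move=> p e Sp Se pe.
(* A diagonal cuts each square into two triangles; sides and rungs shorter than [d / 2] keep it
   below [d]. *)
have ladder k : (k <= N)%N -> z p e + z (P k p) (P k e) =
    \sum_(i < k) z (P i p) (P i.+1 p) + \sum_(i < k) z (P i e) (P i.+1 e).
  elim: k => [|k IH] kN.
    by rewrite !big_ord0 /P /grid mul0r !rot0 addF2 addr0.
  rewrite !big_ord_recr/= addrACA -IH ?(ltnW kN)//.
  have pin q k' : psphere n q -> psphere n.+1 (P k' q) by exact: rot_sphere.
  have c0 : pclose d (P k p) (P k p).
    by move=> i; rewrite subrr normr0.
  have h2 i : `|pcoef (P k p) i - pcoef (P k e) i| < d / 2 by exact: rot_close.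
  have h3 i : `|pcoef (P k p) i - pcoef (P k.+1 p) i| < d / 2 by exact: hN.
  have h4 i : `|pcoef (P k e) i - pcoef (P k.+1 e) i| < d / 2 by exact: hN.
  have dlt : d / 2 < d by rewrite ltr_pdivrMr// ltr_pMr// ltr1n.
  have c1 : pclose d (P k p) (P k e) by move=> i; exact: lt_trans (h2 i) _.
  have c2 : pclose d (P k p) (P k.+1 p) by move=> i; exact: lt_trans (h3 i) _.
  have c3 : pclose d (P k p) (P k.+1 e).
    move=> i; rewrite (splitr d) -(subrKA (pcoef (P k e) i)).
    by apply: le_lt_trans (ler_normD _ _) _; apply: ltrD.
  have hc := hz (P k p) (pin _ _ Sp).
  have e1 := hc (P k p) (P k e) (P k.+1 e) (conj (pin _ _ Sp) c0)
    (conj (pin _ _ Se) c1) (conj (pin _ _ Se) c3).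
  have e2 := hc (P k p) (P k.+1 p) (P k.+1 e) (conj (pin _ _ Sp) c0)
    (conj (pin _ _ Sp) c2) (conj (pin _ _ Se) c3).
  have -> : z (P k p) (P k e) = z (P k e) (P k.+1 e) + z (P k p) (P k.+1 e).
    by apply: addF2_eq0; rewrite addrA.
  have -> : z (P k.+1 p) (P k.+1 e) = z (P k p) (P k.+1 p) + z (P k p) (P k.+1 e).
    by apply: addF2_eq0; rewrite addrA [X in X + _]addrC.
  set a := z p e; set u := z (P k p) (P k.+1 p); set v := z (P k e) (P k.+1 e).
  set w := z (P k p) (P k.+1 e).
  by rewrite -[LHS]addr0 -(addF2 v); ring.
(* The last rung is the constant edge at the pole, where a cocycle vanishes: the sum of three equal
   terms is that term modulo 2. *)
have PN q : P N q = 'X^n.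
  by rewrite /P /grid divff ?rot1// pnatr_eq0 -lt0n.
have := ladder N (leqnn _).
have XS : psphere n.+1 ('X^n : {poly R}).
  rewrite -(rot1 n p); exact: rot_sphere.
have := hz _ XS 'X^n 'X^n 'X^n.
rewrite !PN addF2 add0r => ->; first by rewrite addr0.
all: by split=> // i; rewrite subrr normr0.
Qed.

(** The rotations join every point of [psphere n] to the pole by steps shorter than [d]. *)
Lemma sphere_loc_const (gam : Rinfty R -> 'F_2) n (d : R) : 0 < d ->
  (forall p e, psphere n.+1 p -> psphere n.+1 e -> pclose d p e -> gam p = gam e) ->
  forall p, psphere n p -> gam p = gam ('X^n : {poly R}).
Proof.
move=> d0 h p Sp; have [N N0 hN] := fine_grid d0.
have chain k : (k <= N)%N -> gam p = gam (rot n (grid N k) p).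
  elim: k => [|k IH] kN; first by rewrite /grid mul0r rot0.
  by rewrite IH ?(ltnW kN)//; apply: h; [exact: rot_sphere..|exact: hN].
by rewrite (chain N)// /grid divff ?rot1// pnatr_eq0 -lt0n.
Qed.

End SphereRotation.

Section InfiniteSphere.
Context {R : realType}.
Implicit Types (p e : Rinfty R).
Local Notation S := (@Sinfty R).

Lemma Sinfty1 : S (1 : {poly R}).
Proof.
rewrite /Sinfty /= size_poly1 big_ord1 coefC eqxx expr1n//.
Qed.

Definition spole : S := SigSub (mem_set Sinfty1).
Definition spt p : S := insubd spole p.

Lemma val_spt p : S p -> \val (spt p) = p.
Proof. by move=> Sp; rewrite /spt insubdK//; exact: mem_set. Qed.

Lemma spt_val (x : S) : spt (\val x) = x.
Proof. exact: valKd. Qed.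

Lemma Sinfty_val (x : S) : S (\val x).
Proof. exact: set_mem (valP x). Qed.

Lemma psphere_size p : S p -> psphere (size (p : {poly R})) p.
Proof. by []. Qed.

Lemma psphere1 n : (0 < n)%N -> psphere n (1 : {poly R}).
Proof. by move=> n0; split; [exact: Sinfty1|rewrite size_poly1]. Qed.

Lemma size_Sinfty_gt0 p : S p -> (0 < size (p : {poly R}))%N.
Proof.
rewrite /Sinfty/=; case: size => //; rewrite big_ord0 => /eqP.
by rewrite eq_sym oner_eq0.
Qed.

Lemma Rinfty_openE (A : set (Rinfty R)) : open A = Rinfty_open A.
Proof. by []. Qed.

Lemma Rinfty_opp_continuous : continuous (-%R : Rinfty R -> Rinfty R).
Proof.
apply/continuousP => A; rewrite !Rinfty_openE => oA n.
have -> : (fun x : 'rV[R]_n => rVpoly x : Rinfty R) @^-1` (-%R @^-1` A) =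
   (-%R) @^-1` ((fun x : 'rV[R]_n => rVpoly x : Rinfty R) @^-1` A).
  by apply/seteqP; split=> x /=; rewrite raddfN.
move: (oA n) => {}oA; rewrite openE => x /= Ax.
have : nbhs (- x) ((fun x : 'rV[R]_n => rVpoly x : Rinfty R) @^-1` A).
  by apply: open_nbhs_nbhs.
move=> /nbhs_ballP[d /= d0 dA]; apply/nbhs_ballP; exists d => // y [_ xy].
apply: dA; split => // i j; rewrite !mxE /ball/= -opprD normrN.
exact: xy.
Qed.

Section Primitive.
Variable w : cochain (RPinfty R) 1.
Hypothesis cw : cocycle w.

Let z p e := edge w (antipodal_proj (spt p)) (antipodal_proj (spt e)).

Lemma nbhs_Sinfty (y : S) (V : set S) : nbhs y V ->
  exists2 U : set (Rinfty R), open U /\ U (\val y) &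
    forall p, U p -> S p -> V (spt p).
Proof.
rewrite nbhsE => -[Q [[Q' oQ' Q'E] Qy] QV]; exists Q'.
  by split=> //; rewrite -Q'E in Qy.
move=> p Qp Sp; apply: QV; rewrite -Q'E /=.
by have -> : set_val (spt p) = p by exact: val_spt.
Qed.

Let z_local p : S p -> exists2 U : set (Rinfty R), open U /\ U p & cocycle_on z (U `&` S).
Proof.
move=> Sp; have /cocycleP := cw; move=> /(_ (antipodal_proj (spt p)))[V yV hV].
have := @antipodal_proj_continuous _ S (spt p) _ yV.
move=> /nbhs_Sinfty [U [oU]]; rewrite val_spt// => Up UV.
exists U => // a b c [Ua Sa] [Ub Sb] [Uc Sc]; apply: hV; exact: UV.
Qed.

Let z_primitive n : exists b : Rinfty R -> 'F_2, exists2 d : R, 0 < d &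
  forall p e, psphere n p -> psphere n e -> pclose d p e -> z p e = b p + b e.
Proof.
have [d d0 hd] : exists2 d : R, 0 < d & forall p, psphere n.+1 p ->
    cocycle_on z [set q | psphere n.+1 q /\ pclose d p q].
  apply: psphere_lebesgue => [A B AB hB a b c Aa Ab Ac|p [/z_local[U [oU Up] hU] _]].
    by apply: hB; exact: AB.
  exists U; first exact: open_nbhs_nbhs.
  by move=> a b' c [? [? _]] [? [? _]] [? [? _]]; exact: hU.
exact: sphere_primitive hd.
Qed.

(** Primitives exist on each finite sphere and two of them differ there by a constant; normalised to
    0 at [one] they fit together on all of [S^oo]. The pulled back cocycle does not distinguish
    antipodes, so [b (- p) + b p] is locally constant, hence constant. *)
Lemma exists_primitive : exists b : Rinfty R -> 'F_2,
  (forall y : S, exists2 V, nbhs y V & forall x x', V x -> V x' ->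
     edge w (antipodal_proj x) (antipodal_proj x') = b (\val x) + b (\val x')) /\
  exists eps, forall p, S p -> b (- p) = b p + eps.
Proof.
have [bn hb'] := choice z_primitive.
have [dn hbn] := choice (fun n => proj1 (exists2P _ _) (hb' n)).
pose one : Rinfty R := (1 : {poly R}).
(* One more than the size of [p]: two primitives are compared on [psphere m] through local constancy
   of their sum on [psphere m.+1]. *)
pose b p := bn (size (p : {poly R})).+1 p + bn (size (p : {poly R})).+1 one.
have bE p n : S p -> ((size (p : {poly R})).+1 <= n)%N -> b p = bn n p + bn n one.
  move=> Sp pn; set m := size _ in pn.
  have [dm0 hm] := hbn m.+1; have [dn0 hn] := hbn n.
  have gc := @sphere_loc_const _ (fun p => bn m.+1 p + bn n p) m
    (Num.min (dn m.+1) (dn n)) _ _.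
  have {}gc q : psphere m q -> bn m.+1 q + bn n q =
      bn m.+1 ('X^m : {poly R}) + bn n ('X^m : {poly R}).
    apply: gc; first by rewrite lt_min dm0.
    move=> q1 q2 S1 S2 q12; have q1m : pclose (dn m.+1) q1 q2.
      by move=> i; have := q12 i; rewrite lt_min => /andP[].
    have q1n : pclose (dn n) q1 q2.
      by move=> i; have := q12 i; rewrite lt_min => /andP[].
    have e1 := hm _ _ S1 S2 q1m.
    have e2 := hn _ _ (psphereW pn S1) (psphereW pn S2) q1n.
    by apply: addF2_eq0; rewrite addrACA -e1 -e2 addF2.
  have h1 := gc _ (psphere_size Sp).
  have h2 := gc _ (psphere1 (size_Sinfty_gt0 Sp)).
  by apply: addF2_eq0; rewrite /b -/m addrACA h1 h2 addF2.
have bclose n p e : psphere n p -> psphere n e -> pclose (dn n.+1) p e ->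
    z p e = b p + b e.
  move=> Sp Se pe; have [_ hn] := hbn n.+1.
  rewrite (hn _ _ (psphereW (leqnSn _) Sp) (psphereW (leqnSn _) Se) pe).
  rewrite (bE p n.+1) ?(bE e n.+1)//; try by [case: Sp|case: Se].
  by rewrite addrACA addF2 addr0.
exists b; split.
  move=> y; have Sy := Sinfty_val y.
  have [U [oU Uy] hU] := z_local Sy.
  pose c := b (\val y) + z (\val y) (\val y).
  (* The scale [dn] depends on the dimension, so no ball serves as neighbourhood. The wanted
     identity itself defines [Q], which is open as soon as its trace on every R^n is. *)
  pose Q : set (Rinfty R) := [set p | U p /\ (S p -> b p + z (\val y) p = c)].
  have oQ : open Q.
    rewrite Rinfty_openE => n; rewrite openE => x /= [Ux hx].
    rewrite Rinfty_openE in oU.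
    have nU : nbhs x ((fun x : 'rV[R]_n => rVpoly x : Rinfty R) @^-1` U).
      by apply: open_nbhs_nbhs; split=> //; exact: oU.
    have [Sx|nSx] := pselect (S (rVpoly x)); last first.
      have : nbhs x (~` [set x : 'rV[R]_n | S (rVpoly x)]).
        apply: open_nbhs_nbhs; split=> //; apply: closed_openC.
        by apply: compact_closed; [exact: norm_hausdorff|exact: compact_sphere].
      by move=> nS; apply: filterS2 nU nS => x' /= Ux' nS'; split.
    have [dn0 _] := hbn n.+1.
    have nb : nbhs x (ball x (dn n.+1)) by exact: nbhsx_ballx.
    apply: filterS2 nU nb => x' /= Ux' [_ xx']; split=> // Sx'.
    have Px : psphere n (rVpoly x) by split=> //; exact: size_poly.
    have Px' : psphere n (rVpoly x') by split=> //; exact: size_poly.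
    have xx'c : pclose (dn n.+1) (rVpoly x) (rVpoly x').
      move=> i; rewrite /pcoef; have [lin|nli] := ltnP i n.
        by rewrite (coef_rVpoly_ord x (Ordinal lin)) (coef_rVpoly_ord x' (Ordinal lin)); exact: xx'.
      by rewrite !nth_default ?subrr ?normr0//; [apply: leq_trans nli; exact: size_poly..].
    have e1 := bclose _ _ _ Px Px' xx'c.
    have e2 := hU (\val y) (rVpoly x) (rVpoly x') (conj Uy Sy) (conj Ux Sx) (conj Ux' Sx').
    rewrite -(hx Sx); apply: addF2_eq0.
    by rewrite addrACA [b _ + b _]addrC -e1 -[RHS]e2; ring.
  have Qy : Q (\val y) by [].
  exists (set_val @^-1` Q).
    by apply: open_nbhs_nbhs; split=> //; exists Q.
  move=> x x' [Ux hx] [Ux' hx'].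
  have Sx := Sinfty_val x; have Sx' := Sinfty_val x'.
  have := hU (\val y) (\val x) (\val x') (conj Uy Sy) (conj Ux Sx) (conj Ux' Sx').
  have := hx Sx; have := hx' Sx'; rewrite /z !spt_val -!/(z _ _).
  set u := edge w _ _; set u' := edge w _ _; set v := edge w _ _ => e1 e2 e3.
  have uE : u' = b (\val x) + c.
    by rewrite -e2 addrA addF2 add0r.
  have u'E : u = b (\val x') + c.
    by rewrite -e1 addrA addF2 add0r.
  apply: addF2_eq0; rewrite -[RHS]e3 uE u'E.
  by rewrite -[LHS]addr0 -(addF2 c); ring.
pose g p := b (- p) + b p.
have gE n p : psphere n p -> g p = g ('X^n : {poly R}).
  have [d0 _] := hbn n.+2.
  apply: (@sphere_loc_const _ g n (dn n.+2)) => // q q' Sq Sq' qq'.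
  apply: addF2_eq0; rewrite /g addrACA -(bclose _ _ _ Sq Sq' qq').
  rewrite -(bclose _ _ _ (psphereN Sq) (psphereN Sq')); last first.
    by move=> i; rewrite !pcoefN -opprD normrN; exact: qq'.
  have zN q1 : S q1 -> antipodal_proj (spt (- q1)) = antipodal_proj (spt q1).
    by move=> S1; apply/antipodal_projP; right; rewrite !val_spt//; exact: SinftyN.
  by rewrite /z !zN ?addF2//; [case: Sq'|case: Sq].
exists (g one) => p Sp.
rewrite (gE _ _ (psphere1 (size_Sinfty_gt0 Sp))) -(gE _ _ (psphere_size Sp)).
by rewrite /g addrCA addF2 addr0.
Qed.

End Primitive.

End InfiniteSphere.

(** * Prisms and small chains on spheres *)

Section Prism.
Context {X : eqType}.
Variables h h' : X -> X.

(** The prism operator: its simplices are [h a_0, ..., h a_i, h' a_i, ..., h' a_n], and they fill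
    the space between the images under [h] and [h']. *)
Fixpoint prism (x : seq X) : seq (seq X) :=
  if x is a :: t then (h a :: map h' x) :: map (cons (h a)) (prism t) else [::].

(** The chain homotopy identity, tested on a cochain: a chain is a list of simplices, and its
    boundary is seen only through [dseq]. *)
Lemma prism_boundary (phi : seq X -> 'F_2) x :
  \sum_(y <- prism x) dseq phi y + dseq (fun s => \sum_(y <- prism s) phi y) x =
  phi (map h' x) + phi (map h x).
Proof.
elim: x phi => [|a t IH] phi; first by rewrite /= big_nil addF2 add0r.
rewrite dseq_cons [prism (a :: t)]/= !big_cons big_map.
under eq_bigr => y _ do rewrite dseq_cons.
rewrite big_split/= !dseq_map.
set L := \sum_(y <- prism t) phi y.
rewrite [X in _ + (L + X)](@dseq_ext _ _ (fun l =>
  phi [:: h a, h' a & map h' l] + \sum_(y <- prism l) phi (h a :: y))); last first.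
  by move=> l _; rewrite big_cons big_map.
rewrite dseqD; set v := dseq (fun l => \sum_(y <- _) _) t.
set u := dseq _ t; set u4 := \sum_(y <- _) _.
have e : u4 + v = phi (h a :: map h' t) + phi (h a :: map h t).
  exact: (IH (fun s => phi (h a :: s))).
set u1 := phi (h' a :: _); set u2 := phi (h a :: map h' t).
transitivity (u1 + u2 + (u4 + v) + (u + u) + (L + L)); first by ring.
rewrite !addF2 !addr0 e -/u2.
by rewrite -[RHS]addr0 -(addF2 u2); ring.
Qed.

Lemma size_prism x y : y \in prism x -> size y = (size x).+1.
Proof.
elim: x y => //= a t IH y; rewrite in_cons => /orP[/eqP->/=|].
  by rewrite size_map.
by case/mapP => y' /IH sz -> /=; rewrite sz.
Qed.

Lemma mem_prism x y a : y \in prism x -> a \in y ->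
  exists2 u, u \in x & a = h u \/ a = h' u.
Proof.
elim: x y a => //= b t IH y a; rewrite in_cons => /orP[/eqP->/=|].
  rewrite in_cons => /orP[/eqP->|/(mapP (s := b :: t))[u ut ->]].
    by exists b; [rewrite mem_head|left].
  by exists u => //; right.
case/mapP => y' y't ->; rewrite in_cons => /orP[/eqP->|ay'].
  by exists b; [rewrite mem_head|left].
by have [u ut au] := IH _ _ y't ay'; exists u => //; rewrite in_cons ut orbT.
Qed.

End Prism.

Section SphereChains.
Context {R : realType}.
Variable b : Rinfty R -> 'F_2.
Hypothesis bN : forall p, @Sinfty R p -> b (- p) = b p + 1.

Definition alternation (s : seq (Rinfty R)) : 'F_2 :=
  altseq (fun=> fun p e => b p + b e) s.

Let opps (s : seq (Rinfty R)) := map -%R s.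

Let oppsK s : opps (opps s) = s.
Proof. by rewrite /opps -map_comp map_id_in// => x _; rewrite /= opprK. Qed.

(* [c] is a mod-2 chain of small ordered j-simplices on the sphere S^j whose
   boundary is z + (- z), so that c projects to a cycle in RP^j; the pairing of
   [c] with the j-th power of the generator is 1. *)
Record small_chain (j : nat) (d : R) (c : seq (seq (Rinfty R))) : Prop := {
  chain_size : forall s, s \in c -> size s = j.+1;
  chain_sphere : forall s p, s \in c -> p \in s -> psphere j.+1 p;
  chain_small : forall s p e, s \in c -> p \in s -> e \in s -> pclose d p e;
  chain_alternation : \sum_(s <- c) alternation s = 1;
  chain_cycle : forall phi, \sum_(s <- c) dseq phi s = \sum_(s <- c) dseq phi (opps s);
  chain_even : (0 < j)%N -> forall phi, (forall s, phi (opps s) = phi s) ->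
    \sum_(s <- c) dseq phi s = 0 }.

Lemma alternation_opps s : (forall p, p \in s -> @Sinfty R p) ->
  alternation (opps s) = alternation s.
Proof.
move=> hs; rewrite /alternation /opps altseq_map.
apply: (@altseq_eq_on _ _ _ [set p | @Sinfty R p]).
  move=> _ p e Sp Se; rewrite !bN// -[RHS]addr0 -(addF2 1); ring.
elim: s hs => //= p s IH hs; split; first by apply: hs; rewrite mem_head.
by apply: IH => e es; apply: hs; rewrite in_cons es orbT.
Qed.

(** The new chain is the cone over the cycle [c + (- c)], cut into prisms along the rotation to the
    pole. By Stokes its pairing with the next cup power is that of [b \cup alternation] with
    [c + (- c)], and [b (- p) + b p = 1] reduces this to the pairing on [c]. *)
Lemma exists_small_chain j d : 0 < d -> exists c, small_chain j d c.
Proof.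
elim: j d => [|j IH] d d0.
  exists [:: [:: (1 : {poly R})]]; split => //.
  - by move=> s; rewrite mem_seq1 => /eqP->.
  - by move=> s p; rewrite mem_seq1 => /eqP->; rewrite mem_seq1 => /eqP->; exact: psphere1.
  - move=> s p e; rewrite mem_seq1 => /eqP->; rewrite !mem_seq1 => /eqP-> /eqP-> i.
    by rewrite subrr normr0.
  - by rewrite big_seq1.
  - by move=> phi; rewrite !big_seq1.
have d2 : 0 < d / 2 by rewrite divr_gt0.
have [c [csz csp csm calt ccyc _]] := IH _ d2.
have [N N0 hN] := fine_grid d2.
pose h k := rot j.+1 (grid N k : R).
pose z := c ++ map opps c.
have zP s : s \in z -> size s = j.+1 /\ (forall p, p \in s -> psphere j.+1 p) /\
    (forall p e, p \in s -> e \in s -> pclose (d / 2) p e).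
  rewrite mem_cat => /orP[sc|/mapP[s' sc ->]].
    split; [exact: csz|split]; [move=> p; exact: csp|move=> p e; exact: csm].
  split; first by rewrite size_map; exact: csz.
  split=> [p /mapP[p' p's ->]|p e /mapP[p' p's ->] /mapP[e' e's ->]].
    exact/psphereN/(csp _ _ sc p's).
  by move=> i; rewrite !pcoefN -opprD normrN; exact: (csm _ _ _ sc p's e's).
have zcyc phi : \sum_(s <- z) dseq phi s = 0.
  by rewrite big_cat big_map/= ccyc addF2.
pose c' := flatten [seq flatten [seq prism (h k) (h k.+1) s | s <- z] | k <- iota 0 N].
have c'P s : s \in c' -> exists k, exists2 s', (k < N)%N /\ s' \in z & s \in prism (h k) (h k.+1) s'.
  case/flattenP => l /mapP[k]; rewrite mem_iota => /andP[_ kN] -> /flattenP[l'].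
  by case/mapP => s' s'z -> ss'; exists k, s'.
have bd phi : \sum_(s <- c') dseq phi s = \sum_(s <- c) (phi s + phi (opps s)).
  rewrite big_flatten big_map.
  transitivity (\sum_(k <- iota 0 N) \sum_(s <- z) (phi (map (h k.+1) s) + phi (map (h k) s))).
    apply: eq_bigr => k _; rewrite big_flatten big_map.
    transitivity (\sum_(s <- z) (phi (map (h k.+1) s) + phi (map (h k) s)) +
       \sum_(s <- z) dseq (fun s => \sum_(y <- prism (h k) (h k.+1) s) phi y) s).
      rewrite -big_split; apply: eq_bigr => s _.
      by rewrite /= -prism_boundary -addrA addF2 addr0.
    by rewrite zcyc addr0.
  rewrite exchange_big/=.
  have tele s k : \sum_(i <- iota 0 k) (phi (map (h i.+1) s) + phi (map (h i) s)) =
      phi (map (h k) s) + phi (map (h 0%N) s).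
    elim: k => [|k IHk]; first by rewrite big_nil addF2.
    have -> : iota 0 k.+1 = iota 0 k ++ [:: k] by rewrite -addn1 iotaD.
    rewrite big_cat/= big_seq1 IHk.
    set u := phi (map (h k) s).
    by rewrite -[RHS]addr0 -(addF2 u); ring.
  rewrite (eq_bigr (fun s => phi (map (h N) s) + phi (map (h 0%N) s)))//.
  (* At the last grid time every vertex is at the pole. The resulting constant simplices cancel in
     pairs, one from [c] and one from its antipode. *)
  pose pole : Rinfty R := ('X^(j.+1) : {poly R}).
  rewrite big_seq.
  rewrite (eq_bigr (fun s => phi (nseq j.+1 pole) + phi s)); last first.
    move=> s /zP[sz _]; congr (phi _ + phi _).
      rewrite -sz; apply/esym; elim: (s) => //= p t ->; congr (_ :: _).
      by rewrite /h /grid divff ?rot1// pnatr_eq0 -lt0n.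
    by rewrite map_id_in// => p _; rewrite /h /grid mul0r rot0.
  rewrite -big_seq big_split/= /z !big_cat/= !big_map/=.
  by rewrite addF2 add0r -big_split.
exists c'; split.
- by move=> s /c'P[k [s' [_ /zP[sz _]] /size_prism->]]; rewrite sz.
- move=> s p /c'P[k [s' [_ /zP[_ [sp _]]] ss'] ps].
  by have [u /sp us' [->|->]] := mem_prism ss' ps; exact: rot_sphere.
- move=> s p e /c'P[k [s' [kN /zP[_ [sp sm]]] ss'] ps es].
  have hc u v : u \in s' -> v \in s' -> pclose (d / 2) (h k u) (h k v).
    by move=> us vs; apply: rot_close => //; exact: sm.
  have hc' u v : u \in s' -> v \in s' -> pclose (d / 2) (h k.+1 u) (h k.+1 v).
    by move=> us vs; apply: rot_close => //; exact: sm.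
  have hs u : u \in s' -> pclose (d / 2) (h k u) (h k.+1 u).
    by move=> us; apply: hN => //; exact: sp.
  have dlt : d / 2 < d by rewrite ltr_pdivrMr// ltr_pMr// ltr1n.
  have hm u v : u \in s' -> v \in s' -> pclose d (h k u) (h k.+1 v).
    move=> us vs i; rewrite (splitr d) -(subrKA (pcoef (h k v) i)).
    apply: le_lt_trans (ler_normD _ _) _; apply: ltrD; [exact: hc|exact: hs].
  have [u us' pu] := mem_prism ss' ps; have [v vs' ev] := mem_prism ss' es.
  case: pu => ->; case: ev => ->.
  + by move=> i; apply: lt_trans (hc _ _ us' vs' i) _.
  + exact: hm.
  + by move=> i; rewrite distrC; exact: hm.
  + by move=> i; apply: lt_trans (hc' _ _ us' vs' i) _.
- have dalt s : (1 < size s)%N -> dseq alternation s = 0.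
    move=> sz; apply: (@dseq_altseq _ _ setT) => //; last by elim: s {sz}.
    move=> _ p e q _ _ _; rewrite -[RHS](addF2 (b p + b e + b q)); ring.
  (* The cup power is the coboundary of [b] times the power of one degree less, so the boundary
     formula applies. *)
  rewrite big_seq (eq_bigr (fun s => dseq (cup0 b alternation) s)); last first.
    move=> s /c'P[k [s' [_ /zP[sz _]] /size_prism]]; rewrite sz.
    case: s => [|p [|e s]]// szs; rewrite dseq_cup0//; exact: dalt.
  rewrite -big_seq bd -calt big_seq [RHS]big_seq; apply: eq_bigr => s sc.
  have hs p : p \in s -> @Sinfty R p by move=> ps; have [] := csp _ _ sc ps.
  have {}hs' := hs; move/alternation_opps: hs; have := csz _ sc.
  case: s sc hs' => // p s sc hs' _ es.
  rewrite [cup0 _ _ (p :: s)]/= [cup0 _ _ _]/= -/(opps (p :: s)) es bN; last first.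
    by apply: hs'; rewrite mem_head.
  by rewrite -mulrDl addrA addF2 add0r mul1r.
- move=> phi; rewrite bd.
  under [RHS]eq_bigr do rewrite /opps dseq_map.
  rewrite bd; apply: eq_bigr => s _; rewrite addrC; congr (phi _ + phi _).
  by rewrite -/(opps _) -/(opps _) oppsK.
- move=> _ phi phiN; rewrite bd big1// => s _.
  by rewrite phiN addF2.
Qed.

End SphereChains.

(** * The generator of the first cohomology of projective space *)

Lemma oppF2 (x : 'F_2) : - x = x.
Proof. by apply: addF2_eq0; rewrite addNr. Qed.

Lemma cochain1E {X : topologicalType} (w : cochain X 1) (x : 'I_2 -> X) :
  w x = edge w (x ord0) (x (lift ord0 ord0)).
Proof.
rewrite /edge; congr w.
by apply/funext => -[[|[|//]] hi]; rewrite /pairfun /=; congr x; apply/val_inj.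
Qed.

Lemma codom_I2 {X : Type} (x : 'I_2 -> X) :
  codom x = [:: x ord0; x (lift ord0 ord0)].
Proof. by rewrite !codom_ord /codom /image_mem enum_ord0. Qed.

Section Generator.
Context {R : realType}.
Implicit Types (p e : Rinfty R).
Local Notation S := (@Sinfty R).
Local Notation proj := (@antipodal_proj (Rinfty R) S).

Definition dotp e p : R := \sum_(i < size (e : {poly R})) pcoef e i * pcoef p i.

Lemma dotp_widen n e p : (size (e : {poly R}) <= n)%N ->
  dotp e p = \sum_(i < n) pcoef e i * pcoef p i.
Proof.
move=> sz; rewrite /dotp (big_ord_widen n (fun i => pcoef e i * pcoef p i))//.
rewrite big_mkcond; apply: eq_bigr => i _; case: ifPn => //.
by rewrite -leqNgt => /(nth_default 0); rewrite /pcoef => ->; rewrite mul0r.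
Qed.

Lemma dotpN e p : dotp e (- p) = - dotp e p.
Proof.
by rewrite /dotp -sumrN; apply: eq_bigr => i _; rewrite pcoefN mulrN.
Qed.

Lemma dotNp e p : dotp (- e) p = - dotp e p.
Proof.
by rewrite /dotp size_polyN -sumrN; apply: eq_bigr => i _; rewrite pcoefN mulNr.
Qed.

Lemma dotpp p : S p -> dotp p p = 1.
Proof. by move=> <-; apply: eq_bigr => i _; rewrite expr2. Qed.

(** [3 / 4] is the threshold at which [0 <= |p + e - 2 y|^2 = 6 + 2 <p, e> - 4 (<y, p> + <y, e>)]
    forces [<p, e>] to be positive. *)
Lemma dotp_near y p e : S y -> S p -> S e -> 3 / 4 < dotp y p -> 3 / 4 < dotp y e ->
  0 < dotp p e.
Proof.
move=> Sy Sp Se; have := dotpp Sy; have := dotpp Sp; have := dotpp Se.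
pose n := maxn (size (y : {poly R})) (maxn (size (p : {poly R})) (size (e : {poly R}))).
have sy : (size (y : {poly R}) <= n)%N by exact: leq_maxl.
have sp : (size (p : {poly R}) <= n)%N by rewrite /n leq_max leq_maxl orbT.
have se : (size (e : {poly R}) <= n)%N by rewrite /n !leq_max leqnn !orbT.
rewrite !(dotp_widen _ sy) !(dotp_widen _ sp) !(dotp_widen _ se).
have : 0 <= \sum_(i < n) (pcoef p i + pcoef e i - 2 * pcoef y i) ^+ 2.
  by apply: sumr_ge0 => i _; exact: sqr_ge0.
have -> : \sum_(i < n) (pcoef p i + pcoef e i - 2 * pcoef y i) ^+ 2 =
  (\sum_(i < n) pcoef p i * pcoef p i + \sum_(i < n) pcoef e i * pcoef e i +
   4 * (\sum_(i < n) pcoef y i * pcoef y i) + 2 * (\sum_(i < n) pcoef p i * pcoef e i)) -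
  4 * (\sum_(i < n) pcoef y i * pcoef p i + \sum_(i < n) pcoef y i * pcoef e i).
  rewrite -!big_split !mulr_sumr -!big_split/= -sumrB; apply: eq_bigr => i _.
  by ring.
move=> h h1 h2 h3; rewrite h1 h2 h3 in h => h4 h5; move: h4 h5 h.
by lra.
Qed.

Lemma open_dotp y (c : R) : open [set p : Rinfty R | c < dotp y p].
Proof.
rewrite Rinfty_openE => n.
have cdot : continuous (fun x : 'rV[R]_n => dotp y (rVpoly x)).
  apply: continuous_big => [|i _ x]; first exact: add_continuous.
  apply: (@continuousM _ _ (fun=> pcoef y i) (fun x : 'rV[R]_n => pcoef (rVpoly x) i)).
    exact: cst_continuous.
  have [lin|nli] := ltnP i n.
    rewrite (_ : (fun x : 'rV[R]_n => _) = (fun x : 'rV[R]_n => x 0 (Ordinal lin))).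
      exact: coord_continuous.
    by apply/funext => x'; rewrite /pcoef (coef_rVpoly_ord x' (Ordinal lin)).
  rewrite (_ : (fun x : 'rV[R]_n => _) = (fun=> 0)); first exact: cst_continuous.
  apply/funext => x'; rewrite /pcoef nth_default//.
  by apply: leq_trans nli; exact: size_poly.
apply: (@open_comp _ _ (fun x : 'rV[R]_n => dotp y (rVpoly x)) [set t | c < t]).
  by move=> x _; exact: cdot.
exact: open_gt.
Qed.

(** A choice of sheet of the antipodal cover, by the sign of the leading coefficient; it is not
    continuous, which a 0-cochain need not be. *)
Definition negb0 p : 'F_2 := ((lead_coef (p : {poly R}) < 0)%R : nat)%:R.

Lemma negb0N p : S p -> negb0 (- p) = negb0 p + 1.
Proof.
move=> Sp; rewrite /negb0 lead_coefN oppr_lt0.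
have : lead_coef (p : {poly R}) != 0.
  rewrite lead_coef_eq0; apply/eqP => p0; have := size_Sinfty_gt0 Sp.
  by rewrite p0 size_poly0.
by case: ltrgt0P => // _ _; rewrite ?addF2 ?add0r.
Qed.

(** Records whether the chosen sheet changes between two lines at a small angle. The last term
    corrects the sum when the representatives picked by [repr] are at an obtuse angle. *)
Definition gen_edge (u v : RPinfty R) : 'F_2 :=
  let x := \val (repr u) in let y := \val (repr v) in
  negb0 x + negb0 y + ((dotp x y < 0)%R : nat)%:R.

Definition gen_cochain : cochain (RPinfty R) 1 :=
  fun x => gen_edge (x ord0) (x (lift ord0 ord0)).

Lemma edge_gen_cochain u v : edge gen_cochain u v = gen_edge u v.
Proof. by []. Qed.

Lemma gen_edgeE (x y : S) : 0 < dotp (\val x) (\val y) ->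
  gen_edge (proj x) (proj y) = negb0 (\val x) + negb0 (\val y).
Proof.
have r u : \val (repr (proj u)) = \val u \/ \val (repr (proj u)) = - \val u.
  exact/antipodal_projP/antipodal_repr.
have Sx := Sinfty_val x; have Sy := Sinfty_val y.
rewrite /gen_edge => d0.
have t1 : (true : nat)%:R = 1 :> 'F_2 by [].
case: (r x) => ->; case: (r y) => ->;
  rewrite ?dotNp ?dotpN ?opprK ?oppr_lt0 ?d0 ?(le_gtF (ltW d0)) ?addr0 ?negb0N ?t1//.
all: rewrite -[RHS]addr0 -(addF2 1).
all: by set u := negb0 _; set v := negb0 _; ring.
Qed.

Lemma gen_primitive (y : S) : exists2 V : set S, nbhs y V & forall x x', V x -> V x' ->
  edge gen_cochain (proj x) (proj x') = negb0 (\val x) + negb0 (\val x').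
Proof.
exists (set_val @^-1` [set p | 3 / 4 < dotp (\val y) p]).
  apply: open_nbhs_nbhs; split.
    by exists [set p | 3 / 4 < dotp (\val y) p] => //; exact: open_dotp.
  by rewrite /= dotpp; [lra|exact: Sinfty_val].
move=> x x' hx hx'; rewrite edge_gen_cochain gen_edgeE//.
by apply: (dotp_near (Sinfty_val y)) => //; exact: Sinfty_val.
Qed.

Lemma nbhs_proj_Sinfty (y : S) (U : set S) : nbhs y U -> nbhs (proj y) (proj @` U).
Proof.
apply: nbhs_antipodal_proj; first exact: Rinfty_opp_continuous.
by move=> p; exact: SinftyN.
Qed.

(** If [z] has upstairs the primitive [b] with jump [eps], then [b + eps negb0] is even and descends
    to the quotient, where its coboundary is [z - eps gen_cochain]. *)
Lemma gen_cochain_generator : H1_generator gen_cochain.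
Proof.
split.
  apply/cocycleP => y'; rewrite -(antipodal_repr y').
  have [V yV hV] := gen_primitive (repr y'); exists (proj @` V).
    exact: nbhs_proj_Sinfty.
  move=> _ _ _ [a Va <-] [b Vb <-] [c Vc <-]; rewrite !hV//.
  set u := negb0 _; set v := negb0 _; set t := negb0 _.
  by rewrite -[RHS](addF2 (u + v + t)); ring.
move=> z /exists_primitive[b [hb [eps hbe]]].
exists eps; pose Phi (s : seq (RPinfty R)) : 'F_2 :=
  if s is [:: u; v] then edge z u v - eps * edge gen_cochain u v else 0.
have -> : (fun x : 'I_2 -> RPinfty R => z x - eps * gen_cochain x) =
    (fun x => Phi (codom x)).
  by apply/funext => x; rewrite codom_I2 /= -!cochain1E.
apply/null_class_seq.
pose g (x : S) : 'F_2 := b (\val x) + eps * negb0 (\val x).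
have ge : even_on g.
  move=> x y xy; rewrite /g xy hbe ?negb0N; try exact: Sinfty_val.
  rewrite mulrDr mulr1 -[RHS]addr0 -(addF2 eps).
  by ring.
exists (fun s => if s is [:: u] then antipodal_lift g u else 0) => y'.
rewrite -(antipodal_repr y'); set y := repr y'.
have [V1 yV1 hV1] := hb y; have [V2 yV2 hV2] := gen_primitive y.
exists (proj @` (V1 `&` V2)); first exact/nbhs_proj_Sinfty/filterI.
move=> [|u [|v [|]]]//= [[x [Vx1 Vx2] <-] [[x' [Vx1' Vx2'] <-] _]] _.
rewrite hV1// hV2// !antipodal_liftE// /g oppF2 addr0.
by ring.
Qed.

End Generator.

(** * The Fadell-Rabinowitz index *)

Definition odd_map {V V' : zmodType} {M : set V} {N : set V'} (h : M -> N) :=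
  forall x y : M, \val y = - \val x -> \val (h y) = - \val (h x).

Section FadellRabinowitz.
Context {R : realType}.
Local Notation S := (@Sinfty R).
Local Notation proj := (@antipodal_proj (Rinfty R) S).

Definition index_witness {V : PreTopologicalZmodule.type} (M : set V) (m : nat) :=
  exists theta : antipodal_quot M -> RPinfty R, classifying_map theta /\
  exists w : cochain (RPinfty R) 1, H1_generator w /\
      ~ null_class (pullback theta (cup_power w m)).

(** Integrality: without a witness reaching [k] the supremum is at most [k - 1]. An exponent [m] of
    the cup power counts for the index [m.+1]. *)
Lemma fr_index_geP {V : PreTopologicalZmodule.type} (M : set V) k : (0 < k)%N ->
  (k%:R%:E <= (fr_index M : \bar R))%E <->
  M !=set0 /\ exists2 m, (k <= m.+1)%N & index_witness M m.
Proof.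
move=> k0; rewrite /fr_index; case: asboolP => [->|/eqP/set0P M0].
  split; first by rewrite lee_fin leNgt ltr0n k0.
  by move=> [/set0P]; rewrite eqxx.
split=> [h|[_ [m km hm]]]; last first.
  apply: le_trans (_ : (m.+1%:R)%:E <= _)%E; first by rewrite lee_fin ler_nat.
  by apply: ereal_sup_ubound => /=; exists m.+1.
split=> //; apply: contrapT => hn.
suff : (ereal_sup [set (m%:R)%:E | m in [set m : nat | (1 <= m)%N /\
    index_witness M m.-1]] <= (k.-1%:R : R)%:E)%E.
  move=> h'; have := le_trans h h'; rewrite lee_fin ler_nat.
  by rewrite leqNgt prednK ?leqnn.
apply: ub_ereal_sup => _ [[|m] [//= _ hm] <-]; rewrite lee_fin ler_nat.
rewrite leqNgt; apply/negP; rewrite prednK// => km; apply: hn; exists m => //.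
Qed.

Section Monotonicity.
Context {V V' : PreTopologicalZmodule.type} {M : set V} {N : set V'}.
Hypotheses (opp_cont : continuous (-%R : V -> V)) (symM : symmetric_set M).

Lemma theta_of_odd (f : N -> S) : continuous f -> odd_map f ->
  classifying_map (antipodal_lift (proj \o f)) /\
  forall x, antipodal_lift (proj \o f) (antipodal_proj x) = proj (f x).
Proof.
move=> cf of_.
have ev : even_on (proj \o f).
  by move=> x y xy /=; apply/antipodal_projP; right; exact: of_.
have e x : antipodal_lift (proj \o f) (antipodal_proj x) = proj (f x).
  exact: antipodal_liftE.
split=> //; split; last by exists f.
apply: antipodal_lift_continuous => //.
move=> x; apply: continuous_comp; first exact: cf.
exact: antipodal_proj_continuous.
Qed.

(** [f] provides a classifying map of [N]. Since [t] and [f \o h] pull [b] back with the same jump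
    [eps], the sum [g] of the pullbacks is even, and its descent makes the two cocycles cohomologous
    on the quotient of [M]. *)
Lemma fr_index_mono (h : M -> N) (f : N -> S) k : (0 < k)%N ->
  continuous h -> odd_map h -> continuous f -> odd_map f ->
  (k%:R%:E <= (fr_index M : \bar R))%E -> (k%:R%:E <= (fr_index N : \bar R))%E.
Proof.
move=> k0 ch oh cf of_ /(fr_index_geP _ k0)[[x0 Mx0] [m km]].
move=> [theta [[ctheta [t [ct ot tE]]] [w [gw nw]]]].
apply/fr_index_geP => //; split.
  by exists (\val (h (SigSub (mem_set Mx0)))); exact: set_mem (valP _).
exists m => //.
have [ctN eN] := theta_of_odd cf of_.
exists (antipodal_lift (proj \o f)); split=> //; exists w; split=> // nN.
apply: nw; have cw := gw.1.
have [b [hb [eps hbe]]] := exists_primitive cw.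
pose g (x : M) : 'F_2 := b (\val (t x)) + b (\val (f (h x))).
have ge : even_on g.
  move=> x y xy; rewrite /g (ot _ _ xy) (of_ _ _ (oh _ _ xy)) !hbe; try exact: Sinfty_val.
  by rewrite addrACA addF2 addr0.
have hev : even_on (@antipodal_proj V' N \o h).
  by move=> x y xy /=; apply/antipodal_projP; right; exact: oh.
apply: (null_class_transfer cw ctheta (t2 := antipodal_lift (proj \o f))
  (h := antipodal_lift (@antipodal_proj V' N \o h)) (gam := antipodal_lift g)) => //.
  apply: antipodal_lift_continuous => //.
  move=> x; apply: continuous_comp; first exact: ch.
  exact: antipodal_proj_continuous.
move=> y'; rewrite -(antipodal_repr y'); set y := repr y'.
have [V1 yV1 hV1] := hb (t y); have [V2 yV2 hV2] := hb (f (h y)).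
exists (@antipodal_proj V M @` ((t @^-1` V1) `&` ((f \o h) @^-1` V2))).
  apply: nbhs_antipodal_proj => //; apply: filterI; first exact: ct.
  have cfh : continuous (f \o h) by move=> x; apply: continuous_comp; [exact: ch|exact: cf].
  exact: cfh.
move=> _ _ [x [Vx1 Vx2] <-] [x' [Vx1' Vx2'] <-].
rewrite !tE hV1// !(antipodal_liftE _ ge) !(antipodal_liftE _ hev) /= !eN hV2// /g.
rewrite -[RHS]addr0 -(addF2 (b (\val (t x)) + b (\val (t x')))).
by set u := b _; set v := b _; set u' := b _; set v' := b _; ring.
Qed.

(* Near a point where the i-th coordinate does not vanish, its sign splits the
   double cover, hence represents the classifying class by a cocycle vanishing
   there; the product of the n representatives is locally zero. *)
Lemma fr_index_le (n : nat) (f : nat -> M -> R) :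
  (forall i, continuous (f i)) ->
  (forall i (x y : M), \val y = - \val x -> f i y = - f i x) ->
  (forall x, exists2 i, (i < n)%N & f i x != 0) ->
  forall k, (k%:R%:E <= (fr_index M : \bar R))%E -> (k <= n)%N.
Proof.
move=> cf of_ f0 [//|k] /(fr_index_geP _ (ltn0Sn k))[[x0 Mx0] [m km]].
move=> [theta [[ctheta [t [ct ot tE]]] [w [gw nw]]]].
rewrite leqNgt; apply/negP => nk; apply: nw; have cw := gw.1.
have [b [hb [eps hbe]]] := exists_primitive cw.
(* The sign of [f i], multiplied by [eps], compensates the jump of [b \o t], so [g i] is even; the
   value 0 at the zeros of [f i] does not spoil this. *)
pose g i (x : M) : 'F_2 := if f i x == 0 then 0 else
  b (\val (t x)) + eps * ((f i x < 0)%R : nat)%:R.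
have ge i : even_on (g i).
  move=> x y xy; rewrite /g (of_ _ _ _ xy) oppr_eq0; case: eqP => // /eqP fx.
  rewrite (ot _ _ xy) hbe; last exact: Sinfty_val.
  rewrite oppr_lt0; have t1 : (true : nat)%:R = 1 :> 'F_2 by [].
  case: ltrgt0P fx => // _ _; rewrite ?t1 ?mulr1 ?mulr0 ?addr0//.
  by rewrite -addrA addF2 addr0.
have [i0 i0n _] := f0 (SigSub (mem_set Mx0)).
apply: (null_class_vanish cw ctheta (n := n) (gam := fun i => antipodal_lift (g i))).
- by apply: leq_trans (ltnSE km).
- by apply: leq_trans (ltnSE km); apply: leq_trans (ltnSE nk); apply: leq_trans i0n.
move=> y'; rewrite -(antipodal_repr y'); set y := repr y'.
have [i lin fiy] := f0 y; exists i; split=> //.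
have [V1 yV1 hV1] := hb (t y).
pose V2 : set M := [set x | f i x != 0 /\ (f i x < 0) = (f i y < 0)].
have yV2 : nbhs y V2.
  have := cf i y; case: (ltrgtP (f i y) 0) fiy => // fiy _ ciy.
    have h : \forall x \near y, f i x < 0 by exact: (cvgr_lt _ ciy).
    apply: filterS h => x fx.
    by rewrite /V2/=; split; rewrite ?lt_eqF// fx fiy.
  have h : \forall x \near y, 0 < f i x by exact: (cvgr_gt _ ciy).
  apply: filterS h => x fx.
  by rewrite /V2/=; split; rewrite ?gt_eqF// !ltNge !ltW.
exists (@antipodal_proj V M @` ((t @^-1` V1) `&` V2)).
  apply: nbhs_antipodal_proj => //; apply: filterI => //; exact: ct.
move=> _ _ [x [Vx1 [fx0 fx]] <-] [x' [Vx1' [fx'0 fx']] <-].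
rewrite !tE hV1// !(antipodal_liftE _ (ge i)) /g (negPf fx0) (negPf fx'0) fx fx'.
by rewrite addrACA addF2 addr0.
Qed.

End Monotonicity.

(** * The index of finite-dimensional spheres *)

Section FiniteSphere.
Variable n : nat.
Hypothesis n0 : (0 < n)%N.
Local Notation X := (@psphere R n).

Definition ppt (p : Rinfty R) : X := insubd (SigSub (mem_set (psphere1 (R := R) n0)) : X) p.

Lemma val_ppt p : psphere n p -> \val (ppt p) = p.
Proof. by move=> Sp; rewrite /ppt insubdK//; exact: mem_set. Qed.

Definition pincl (x : X) : S := spt (\val x).

Lemma val_pincl (x : X) : \val (pincl x) = \val x.
Proof. by rewrite val_spt//; have [] := set_mem (valP x). Qed.

Lemma pincl_continuous : continuous pincl.
Proof.
move=> x U /nbhs_Sinfty [Q [oQ Qx] QU].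
rewrite /= nbhs_simpl /=.
have : nbhs x (set_val @^-1` Q).
  apply: open_nbhs_nbhs; split; first by exists Q.
  by rewrite val_pincl in Qx.
apply: filterS => y Qy; apply: QU => //.
by have [] := set_mem (valP y).
Qed.

Lemma pincl_odd : odd_map pincl.
Proof. by move=> x y xy; rewrite !val_pincl. Qed.

(** If the cup power were null, [alternation] would agree on small simplices with the coboundary of
    a cochain from the quotient, which is even. A small chain pairs to 1 with the former and to 0
    with the latter. *)
Lemma fr_index_psphere : (n%:R%:E <= (fr_index X : \bar R))%E.
Proof.
apply/fr_index_geP => //; split.
  by exists (1 : {poly R}); exact: psphere1.
exists n.-1; first by rewrite prednK.
have [cth eN] := theta_of_odd pincl_continuous pincl_odd.
exists (antipodal_lift (proj \o pincl)); split=> //.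
exists (@gen_cochain R); split; first exact: gen_cochain_generator.
(* In degree 0 a class is null only if the cochain vanishes locally, and the power is the constant
   1. *)
case nE : n.-1 => [|m].
  move=> /(_ (antipodal_proj (ppt (1 : {poly R}))))[U yU hU].
  have /eqP := hU (fun=> antipodal_proj (ppt (1 : {poly R}))) (fun=> nbhs_singleton yU).
  by rewrite /pullback/= oner_eq0.
rewrite pullback_cup_power => /(null_class_seq _ (altseq _))[psi hpsi].
pose q p := antipodal_proj (ppt p).
pose P (A : set (Rinfty R)) := forall s, all_in A s -> size s = m.+2 ->
  alternation (@negb0 R) s = dseq (fun s => psi (map q s)) s.
have [d d0 hd] : exists2 d : R, 0 < d & forall p, psphere n p ->
    P [set e | psphere n e /\ pclose d p e].
  apply: psphere_lebesgue => [A B AB PB s sA|p Sp]; first exact/PB/(all_inS AB sA).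
  have [U yU hU] := hpsi (q p).
  have [V1 yV1 hV1] := gen_primitive (pincl (ppt p)).
  have cq : nbhs (ppt p) ((@antipodal_proj (Rinfty R) X @^-1` U) `&` (pincl @^-1` V1)).
    apply: filterI; first exact: antipodal_proj_continuous.
    exact: pincl_continuous.
  move: cq; rewrite nbhsE => -[Q [[Q' oQ' Q'E] Qy] QV].
  exists Q'.
    apply: open_nbhs_nbhs; split=> //; rewrite -Q'E /= in Qy.
    by have <- : set_val (ppt p) = p by exact: val_ppt.
  move=> s sQ sz.
  have hQ e : (Q' `&` psphere n) e -> U (q e) /\ V1 (pincl (ppt e)).
    move=> [Qe Se]; have /QV[] : Q (ppt e); last by [].
    by rewrite -Q'E/=; have -> : set_val (ppt e) = e by exact: val_ppt.
  have := hU (map q s); rewrite dseq_map size_map => <- //; last first.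
    by apply/all_in_map; apply: all_inS sQ => e /hQ[].
  rewrite altseq_map; apply: altseq_eq_on sQ => _ a c Qa Qc.
  rewrite /q !eN hV1; [|exact: (hQ _ _).2..].
  by rewrite !val_pincl !val_ppt//; [case: Qc|case: Qa].
have [c [csz csp csm calt _ cev]] := exists_small_chain (@negb0N R) m.+1 d0.
(* Off the sphere [ppt] returns the same default for [p] and [- p], so evenness holds on all lists,
   as [chain_even] demands. *)
have qN p : q (- p) = q p.
  have [Sp|nSp] := pselect (psphere n p).
    by apply/antipodal_projP; right; rewrite !val_ppt//; exact: psphereN.
  have nSN : ~ psphere n (- p) by move=> /psphereN; rewrite opprK.
  rewrite /q /ppt /insubd !insubN//; first by apply/negP => /set_mem.
  by apply/negP => /set_mem.
have := cev isT (fun s => psi (map q s)).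
have -> : \sum_(s <- c) dseq (fun s => psi (map q s)) s = \sum_(s <- c) alternation (@negb0 R) s.
  rewrite big_seq [RHS]big_seq; apply: eq_bigr => s sc; apply/esym.
  have := csz _ sc; case: s sc => // p s sc sz.
  have ps : p \in p :: s by rewrite mem_head.
  have mn : m.+2 = n by rewrite -nE prednK.
  have Sp e : e \in p :: s -> psphere n e by move=> /(csp _ _ sc); rewrite mn.
  apply: (hd _ (Sp _ ps)) => //.
  have : {subset p :: s <= p :: s} by [].
  elim: {1 3}(p :: s) => // e l IH sub; split; last first.
    by apply: IH => e' e'l; apply: sub; rewrite in_cons e'l orbT.
  by have es := sub _ (mem_head _ _); split; [exact: Sp|exact: (csm _ _ _ sc)].
rewrite calt => h; have /eqP : (1 : 'F_2) = 0; last by [].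
apply: h => s; congr psi; rewrite -map_comp; apply: eq_map => p; exact: qN.
Qed.

End FiniteSphere.

End FadellRabinowitz.

(** * Weak sequential compactness in reflexive spaces *)

Section HahnBanach.
Context {R : realType} {V : lmodType R}.
Implicit Types (p : V -> R) (x y : V).

Definition sublinear p :=
  (forall x y, p (x + y) <= p x + p y) /\
  (forall (t : R) x, 0 < t -> p (t *: x) = t * p x).

Lemma sublinear0 p : sublinear p -> p 0 = 0.
Proof.
move=> [_ h]; have := h 2 0; rewrite scaler0 => /(_ _)/eqP.
rewrite ltr0n => /(_ isT); rewrite -subr_eq0 -{1}[p 0]mul1r -mulrBl mulf_eq0.
by move=> /orP[|/eqP//]; rewrite subr_eq0 => /eqP; lra.
Qed.

(* The largest sublinear functional below p that is additive along y. *)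
Definition tilt p y x := inf [set p (x + t *: y) - t * p y | t in [set t : R | 0 <= t]].

Section Tilt.
Variables (p : V -> R) (y : V).
Hypothesis sp : sublinear p.

Lemma sublinearZ (t : R) x : 0 <= t -> p (t *: x) = t * p x.
Proof.
rewrite le_eqVlt => /orP[/eqP <-|]; last exact: sp.2.
by rewrite scale0r mul0r sublinear0.
Qed.

Lemma tilt_le x (t : R) : 0 <= t -> tilt p y x <= p (x + t *: y) - t * p y.
Proof.
move=> t0; apply: ge_inf; last by exists t.
exists (- p (- x)) => _ [u u0 <-].
have := sp.1 (x + u *: y) (- x); rewrite addrAC subrr add0r sublinearZ//.
by lra.
Qed.

Lemma le_tilt (c : R) x : (forall t, 0 <= t -> c <= p (x + t *: y) - t * p y) ->
  c <= tilt p y x.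
Proof.
move=> h; apply: lb_le_inf; first by exists (p (x + 0 *: y) - 0 * p y); exists 0 => //=.
by move=> _ [t t0 <-]; exact: h.
Qed.

Lemma tilt_sublinear : sublinear (tilt p y).
Proof.
split=> [x1 x2|t x t0].
  rewrite -lerBlDr; apply: le_tilt => t1 t10.
  rewrite lerBlDr -lerBlDl; apply: le_tilt => t2 t20.
  rewrite lerBlDl; apply: le_trans (tilt_le _ (addr_ge0 t10 t20)) _.
  have := sp.1 (x1 + t1 *: y) (x2 + t2 *: y).
  by rewrite addrACA -scalerDl; lra.
have half u z : 0 < u -> tilt p y (u *: z) <= u * tilt p y z.
  move=> u0; rewrite mulrC -ler_pdivrMr//; apply: le_tilt => w w0.
  rewrite ler_pdivrMr//; apply: le_trans (tilt_le _ (_ : 0 <= u * w)) _.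
    by rewrite mulr_ge0// ltW.
  rewrite -scalerA -scalerDr sp.2// le_eqVlt; apply/orP; left; apply/eqP; ring.
apply/eqP; rewrite eq_le half//=.
have := half t^-1 (t *: x); rewrite invr_gt0 t0 scalerA mulVf ?gt_eqF// scale1r.
by move=> /(_ isT); rewrite mulrC ler_pdivlMr// mulrC.
Qed.

Lemma tilt_ler x : tilt p y x <= p x.
Proof. by apply: le_trans (tilt_le x (lexx 0)) _; rewrite scale0r addr0 mul0r subr0. Qed.

Lemma tiltN : tilt p y (- y) <= - p y.
Proof.
apply: le_trans (tilt_le _ ler01) _.
by rewrite scale1r addNr sublinear0// mul1r sub0r.
Qed.

End Tilt.

(** A minimal sublinear [q] is linear: [tilt q y] cannot lie strictly below [q], which forces
    additivity along [y]. Minimising below [tilt p x0] pins the value at [x0] through [tiltN]. *)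
Lemma hahn_banach p x0 : sublinear p -> exists phi : V -> R,
  [/\ scalar phi, phi x0 = p x0 & forall x, phi x <= p x].
Proof.
move=> sp; pose T := {q : V -> R | sublinear q /\ forall x, q x <= tilt p x0 x}.
have t0 : T by exists (tilt p x0); split=> //; exact: tilt_sublinear.
(* The reversed pointwise order, since Zorn's lemma yields maximal elements. *)
pose R1 (q1 q2 : T) : bool := `[< forall x, sval q2 x <= sval q1 x >].
have R1P q1 q2 : R1 q1 q2 <-> forall x, sval q2 x <= sval q1 x.
  by rewrite /R1; split=> [/asboolP//|h]; apply/asboolP.
have [||| |q hq] := @Zorn T R1.
- by move=> q; apply/R1P.
- by move=> q1 q2 q3 /R1P h1 /R1P h2; apply/R1P => x; exact: le_trans (h1 x).
- move=> [q1 hq1] [q2 hq2] /R1P /= h1 /R1P /= h2; apply: eq_exist.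
  by apply/funext => x; apply/eqP; rewrite eq_le h2 h1.
- move=> A totA.
  have [[q0 Aq0]|nA] := pselect (exists q, A q); last first.
    by exists t0 => q Aq; exfalso; apply: nA; exists q.
  pose m x := inf [set sval q x | q in A].
  have lbq (q : T) x : - sval q (- x) <= sval q x.
    have := (svalP q).1.1 x (- x); rewrite subrr (sublinear0 (svalP q).1); lra.
  have m_le (q : T) x : A q -> m x <= sval q x.
    move=> Aq; apply: ge_inf; last by exists q.
    exists (- p (- x)) => _ [q' _ <-].
    apply: le_trans (lbq q' x); rewrite lerN2.
    apply: le_trans ((svalP q').2 _) _; exact: tilt_ler.
  have le_m c x : (forall q : T, A q -> c <= sval q x) -> c <= m x.
    move=> h; apply: lb_le_inf; first by exists (sval q0 x); exists q0.
    by move=> _ [q Aq <-]; exact: h.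
  have sm : sublinear m.
    split=> [x y|t x tgt0].
      rewrite -lerBlDr; apply: (le_m _ _) => q1 Aq1.
      rewrite lerBlDr -lerBlDl; apply: (le_m _ _) => q2 Aq2.
      rewrite lerBlDl.
      have [/R1P h|/R1P h] := totA _ _ Aq1 Aq2.
        apply: le_trans (m_le _ _ Aq2) _; apply: le_trans ((svalP q2).1.1 _ _) _.
        by rewrite lerD2r; exact: h.
      apply: le_trans (m_le _ _ Aq1) _; apply: le_trans ((svalP q1).1.1 _ _) _.
      by rewrite lerD2l; exact: h.
    apply/eqP; rewrite eq_le; apply/andP; split.
      rewrite mulrC -ler_pdivrMr//; apply: (le_m _ _) => q Aq.
      by rewrite ler_pdivrMr// mulrC -(svalP q).1.2//; exact: m_le.
    apply: (le_m _ _) => q Aq; rewrite (svalP q).1.2// ler_pM2l//; exact: m_le.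
  have mp x : m x <= tilt p x0 x.
    by apply: le_trans (m_le _ _ Aq0) _; exact: (svalP q0).2.
  by exists (exist _ m (conj sm mp)) => q Aq; apply/R1P => x; exact: m_le.
have [sq qp] := svalP q.
have qadd x y : sval q x + sval q y <= sval q (x + y).
  have tq : forall z, tilt (sval q) y z <= tilt p x0 z.
    by move=> z; apply: le_trans (tilt_ler _ _ _) _.
  have e := hq (exist _ (tilt (sval q) y) (conj (tilt_sublinear y sq) tq)).
  have {}e := congr1 sval (e _).
  have := tilt_le y sq x ler01; rewrite scale1r mul1r /=.
  rewrite lerBrDr; apply: le_trans; rewrite lerD2r.
  rewrite /= in e; rewrite e//; apply/R1P => z /=; exact: tilt_ler.
have qD x y : sval q (x + y) = sval q x + sval q y.
  by apply/eqP; rewrite eq_le qadd sq.1.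
have qN x : sval q (- x) = - sval q x.
  by apply/eqP; rewrite -addr_eq0 -qD addNr sublinear0.
have pq x : sval q x <= p x by apply: le_trans (qp x) _; exact: tilt_ler.
have qZ (a : R) x : sval q (a *: x) = a * sval q x.
  have [a0|a0] := leP 0 a; first exact: sublinearZ.
  rewrite -[a]opprK scaleNr qN sublinearZ ?oppr_ge0 ?ltW//.
  by rewrite [RHS]mulNr.
exists (sval q); split=> //.
- by move=> a x y; rewrite qD qZ.
apply/eqP; rewrite eq_le pq /=.
have := le_trans (qp (- x0)) (tiltN x0 sp); rewrite qN; lra.
Qed.

End HahnBanach.

Section DualSpace.
Context {R : realType} {W : completeNormedModType R}.
Implicit Types (phi psi : W -> R) (u v : W).

Lemma in_dualD phi u v : in_dual phi -> phi (u + v) = phi u + phi v.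
Proof. by move=> [h _]; have := h 1 u v; rewrite scale1r mul1r. Qed.

Lemma in_dual0 phi : in_dual phi -> phi 0 = 0.
Proof.
move=> h; have := in_dualD 0 0 h; rewrite addr0 => /eqP.
by rewrite -subr_eq0 opprD addNKr oppr_eq0 => /eqP.
Qed.

Lemma in_dualZ phi (a : R) u : in_dual phi -> phi (a *: u) = a * phi u.
Proof.
by move=> hp; have := hp.1 a u 0; rewrite addr0 (in_dual0 hp) addr0.
Qed.

Lemma in_dualN phi u : in_dual phi -> phi (- u) = - phi u.
Proof. by move=> h; rewrite -scaleN1r in_dualZ// mulN1r. Qed.

Lemma in_dualB phi u v : in_dual phi -> phi (u - v) = phi u - phi v.
Proof. by move=> h; rewrite in_dualD// in_dualN. Qed.

Lemma in_dual_bounded phi : in_dual phi -> exists2 C, 0 <= C &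
  forall v, `|phi v| <= C * `|v|.
Proof.
move=> hp; have := hp.2 0; rewrite /continuous_at (in_dual0 hp).
move=> /cvgrPdist_lt/(_ _ ltr01)/nbhs_ballP[d /= d0 hd].
exists (2 / d); first by rewrite divr_ge0// ltW.
move=> v; have [->|v0] := eqVneq v 0.
  by rewrite in_dual0// normr0 normr0 mulr0.
have v0' : 0 < `|v| by rewrite normr_gt0.
pose c := d / 2 / `|v|.
have c0 : 0 < c by rewrite !divr_gt0.
have : ball 0 d (c *: v).
  rewrite -ball_normE /= sub0r normrN normrZ gtr0_norm//.
  by rewrite /c divfK ?gt_eqF// ltr_pdivrMr// ltr_pMr// ltr1n.
move=> /hd; rewrite sub0r normrN in_dualZ// normrM gtr0_norm// => h.
have : `|phi v| < c^-1 by rewrite -[ltRHS]mulr1 mulrC ltr_pdivlMr// mulrC.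
by rewrite /c !invf_div => /ltW/le_trans; apply; rewrite mulrC.
Qed.

Lemma bounded_in_dual phi C : scalar phi -> (forall v, `|phi v| <= C * `|v|) ->
  in_dual phi.
Proof.
move=> sphi h; split=> // u; apply/cvgrPdist_lt => e e0.
have phiB v w : phi (v - w) = phi v - phi w.
  by rewrite (addrC v) -scaleN1r sphi mulN1r addrC.
have C0 : 0 < `|C| + 1 by rewrite ltr_wpDl.
near=> v; rewrite -phiB; apply: le_lt_trans (h _) _.
apply: (@le_lt_trans _ _ ((`|C| + 1) * `|u - v|)).
  by rewrite ler_wpM2r// (le_trans (ler_norm C))// lerDl.
rewrite mulrC -ltr_pdivlMr//; near: v.
by apply: cvgr_dist_lt; rewrite ?divr_gt0//.
Unshelve. all: end_near. Qed.

Lemma dual_norm_has_sup phi : in_dual phi ->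
  has_sup [set `|phi v| | v in [set v : W | `|v| <= 1]].
Proof.
move=> hp; split; first by exists `|phi 0|; exists 0 => //=; rewrite normr0.
have [C C0 hC] := in_dual_bounded hp; exists C => _ [v /= v1 <-].
by apply: le_trans (hC v) _; rewrite -[leRHS]mulr1 ler_wpM2l.
Qed.

Lemma dual_norm_ge0 phi : in_dual phi -> 0 <= dual_norm phi.
Proof.
move=> hp; have [_ hs] := dual_norm_has_sup hp.
apply: le_trans (normr_ge0 (phi 0)) _.
by apply: ub_le_sup => //; exists 0 => //=; rewrite normr0.
Qed.

Lemma dual_norm_ub phi v : in_dual phi -> `|phi v| <= dual_norm phi * `|v|.
Proof.
move=> hp; have [->|v0] := eqVneq v 0.
  by rewrite in_dual0// normr0 normr0 mulr0.
have v0' : 0 < `|v| by rewrite normr_gt0.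
rewrite -ler_pdivrMr//; have [_ hs] := dual_norm_has_sup hp.
apply: ub_le_sup => //; exists (`|v|^-1 *: v) => /=.
  by rewrite normrZ gtr0_norm ?invr_gt0// mulVf ?gt_eqF.
by rewrite in_dualZ// normrM gtr0_norm ?invr_gt0// mulrC.
Qed.

Lemma dual_norm_lt phi (e : R) v : in_dual phi -> dual_norm phi < e -> `|v| <= 1 ->
  `|phi v| < e.
Proof.
move=> hp he hv; apply: le_lt_trans he; apply: le_trans (dual_norm_ub v hp) _.
by rewrite -[leRHS]mulr1 ler_wpM2l// dual_norm_ge0.
Qed.

Lemma in_dualDfun phi psi (a : R) : in_dual phi -> in_dual psi ->
  in_dual (fun v => a * phi v + psi v).
Proof.
move=> h1 h2; split.
  by move=> b u v; rewrite h1.1 h2.1; ring.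
move=> u; apply: cvgD; last exact: h2.2.
by apply: cvgM; [exact: cvg_cst|exact: h1.2].
Qed.

Lemma in_dualBfun phi psi : in_dual phi -> in_dual psi ->
  in_dual (fun v => phi v - psi v).
Proof.
move=> h1 h2; have := in_dualDfun (-1) h2 h1.
by under eq_fun do rewrite mulN1r addrC.
Qed.

End DualSpace.

(** * Weak limits along ultrafilters and subsequences *)

Section WeakCompactness.
Context {R : realType} {W : completeNormedModType R}.
Hypothesis reflexive : reflexive_space W.

Lemma ultra_cvg (U : set_system nat) (a : nat -> R) (C : R) : UltraFilter U ->
  (forall j, `|a j| <= C) -> exists l : R, a @ U --> l.
Proof.
move=> UU aC; have UP : ProperFilter U by exact: ultra_proper.
have cC : compact [set` `[(- C), C]] by exact: segment_compact.
have [|l [_ lcl]] := cC (a @ U) _.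
  rewrite nbhs_filterE /fmap /=; apply: filterE => j.
  by rewrite /= in_itv /= -ler_norml.
exists l; apply/cvgrPdist_lt => e e0.
have [//|nU] := in_ultra_setVsetC [set j | `|l - a j| < e] UU.
exfalso; have [|x [[j nj <-] bx]] := lcl (a @` (~` [set j | `|l - a j| < e])) (ball l e) _ (nbhsx_ballx _ _ e0).
  rewrite nbhs_filterE /fmap /=; apply: (filterS _ nU) => j nj; by exists j.
by apply: nj; move: bx; rewrite -ball_normE.
Qed.

Definition ultra_weak_limit (U : set_system nat) (u : nat -> W) (x : W) :=
  forall phi, in_dual phi -> phi (u j) @[j --> U] --> phi x.

(** Bounded real sequences converge along an ultrafilter, so the limit of [phi (u j)] is a bounded
    functional of [phi]; reflexivity represents it by a point. *)
Lemma exists_ultra_weak_limit (U : set_system nat) (u : nat -> W) (C : R) :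
  UltraFilter U -> (forall j, `|u j| <= C) -> exists x, ultra_weak_limit U u x.
Proof.
move=> UU uC; have UP : ProperFilter U by exact: ultra_proper.
have C0 : 0 <= C by apply: le_trans (uC 0%N).
pose xi (phi : W -> R) : R := lim (phi (u j) @[j --> U]).
have xiE phi : in_dual phi -> phi (u j) @[j --> U] --> xi phi.
  move=> hp; have [l hl] : exists l : R, phi (u j) @[j --> U] --> l.
    apply: (@ultra_cvg U (phi \o u) (dual_norm phi * C)) => // j.
    by apply: le_trans (dual_norm_ub _ hp) _; rewrite ler_wpM2l ?dual_norm_ge0.
  by rewrite /xi (cvg_lim _ hl)//; exact: norm_hausdorff.
have [|| x hx] := reflexive (xi := xi).
- move=> a phi psi hp hq.
  have e1 := xiE _ (in_dualDfun a hp hq).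
  have e2 : (a * phi (u j) + psi (u j)) @[j --> U] --> a * xi phi + xi psi.
    by apply: cvgD; [apply: cvgM; [exact: cvg_cst|exact: xiE]|exact: xiE].
  exact: (cvg_unique _ e1 e2).
- exists C => phi hp; have h := xiE _ hp.
  have hn : `|phi (u j)| @[j --> U] --> `|xi phi| by apply: cvg_norm.
  apply: (closed_cvg (fun y : R => y <= C * dual_norm phi) _ _ _ hn).
    exact: closed_le.
  apply: filterE => j; apply: le_trans (dual_norm_ub _ hp) _.
  by rewrite mulrC ler_wpM2r ?dual_norm_ge0.
by exists x => phi hp; rewrite -hx//; exact: xiE.
Qed.

(** Coefficients are lists of any length, so that those with rational entries are enumerated by
    [pickle]. *)
Fixpoint lincomb (u : nat -> W) (n : nat) (a : seq R) : W :=
  if a is c :: a' then c *: u n + lincomb u n.+1 a' else 0.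

Fixpoint addl (a b : seq R) : seq R :=
  match a, b with
  | x :: a', y :: b' => (x + y) :: addl a' b'
  | [::], _ => b
  | _, [::] => a
  end.

Lemma lincombD u n a b : lincomb u n (addl a b) = lincomb u n a + lincomb u n b.
Proof.
elim: a b n => [|x a IH] [|y b] n //=; rewrite ?add0r ?addr0//.
by rewrite IH scalerDl addrACA.
Qed.

Lemma lincombZ u n c a : lincomb u n (map ( *%R c) a) = c *: lincomb u n a.
Proof.
elim: a n => [|x a IH] n /=; first by rewrite scaler0.
by rewrite IH scalerDr scalerA.
Qed.

Definition in_span (u : nat -> W) (x : W) :=
  forall e : R, 0 < e -> exists a, `|x - lincomb u 0 a| < e.

Lemma in_spanB u x y : in_span u x -> in_span u y -> in_span u (x - y).
Proof.
move=> hx hy e e0; have e2 : 0 < e / 2 by rewrite divr_gt0.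
have [a ha] := hx _ e2; have [b hb] := hy _ e2.
exists (addl a (map ( *%R (-1)) b)); rewrite lincombD lincombZ scaleN1r.
have -> : x - y - (lincomb u 0 a - lincomb u 0 b) =
   (x - lincomb u 0 a) - (y - lincomb u 0 b) by rewrite !opprD !opprK addrACA.
by rewrite (splitr e); apply: le_lt_trans (ler_normB _ _) _; apply: ltrD.
Qed.

(** Mazur's argument: the distance [p] to the span is sublinear. A linear [phi] below [p] with
    [phi x = p x] vanishes on the span, hence at the weak limit [x], so [p x = 0]. *)
Lemma ultra_weak_limit_in_span (U : set_system nat) (u v : nat -> W) x :
  ProperFilter U -> (forall j, exists i, v j = u i) ->
  ultra_weak_limit U v x -> in_span u x.
Proof.
move=> UP vu hx.
pose p y := inf [set `|y - lincomb u 0 a| | a in [set: seq R]].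
have plb y : lbound [set `|y - lincomb u 0 a| | a in [set: seq R]] 0.
  by move=> _ [a _ <-].
have p_le y a : p y <= `|y - lincomb u 0 a|.
  by apply: ge_inf; [exists 0; exact: plb|exists a].
have le_p c y : (forall a, c <= `|y - lincomb u 0 a|) -> c <= p y.
  move=> h; apply: lb_le_inf; first by exists `|y - lincomb u 0 [::]|; exists [::].
  by move=> _ [a _ <-].
have sp : sublinear p.
  split=> [y z|t y t0].
    rewrite -lerBlDr; apply: (le_p _ _) => a.
    rewrite lerBlDr -lerBlDl; apply: (le_p _ _) => b.
    rewrite lerBlDl; apply: le_trans (p_le _ (addl a b)) _.
    by rewrite lincombD opprD addrACA ler_normD.
  apply/eqP; rewrite eq_le; apply/andP; split.
    rewrite mulrC -ler_pdivrMr//; apply: (le_p _ _) => a.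
    rewrite ler_pdivrMr//; apply: le_trans (p_le _ (map ( *%R t) a)) _.
    by rewrite lincombZ -scalerBr normrZ gtr0_norm// mulrC.
  apply: (le_p _ _) => a.
  have -> : t *: y - lincomb u 0 a = t *: (y - lincomb u 0 (map ( *%R t^-1) a)).
    by rewrite lincombZ scalerBr scalerA divff ?gt_eqF// scale1r.
  by rewrite normrZ gtr0_norm// ler_pM2l.
have p0 : forall y, 0 <= p y by move=> y; apply: (le_p _ _) => a.
have pn y : p y <= `|y| by apply: le_trans (p_le _ [::]) _; rewrite subr0.
have [phi [sphi phix phip]] := hahn_banach x sp.
have dphi : in_dual phi.
  apply: (@bounded_in_dual _ _ _ 1) => // y; rewrite mul1r ler_norml.
  have := phip (- y); have := phip y; have := pn y; have := pn (- y).
  have -> : phi (- y) = - phi y.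
    by have := sphi (-1) y (- y); rewrite scaleN1r; have := sphi 1 (-y) y; have := sphi 1 0 0;
      rewrite !scale1r !mul1r !addr0 addNr; lra.
  by rewrite normrN; lra.
have phiu i : phi (u i) = 0.
  have pu : forall c : R, p (c *: u i) <= 0.
    move=> c; apply: le_trans (p_le _ (rcons (nseq i 0) c)) _.
    suff -> : lincomb u 0 (rcons (nseq i 0) c) = c *: u i by rewrite subrr normr0.
    have : forall n, lincomb u n (rcons (nseq i 0) c) = c *: u (n + i)%N.
      elim: (i) => [|k IH] n /=; first by rewrite addr0 addn0.
      by rewrite IH scale0r add0r addSnnS.
    by apply.
  have := le_trans (phip _) (pu 1); have := le_trans (phip _) (pu (-1)).
  by rewrite scale1r scaleN1r in_dualN//; lra.
have phix0 : phi x = 0.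
  have e1 := hx _ dphi.
  have e2 : phi (v j) @[j --> U] --> (0 : R).
    rewrite (_ : (fun j => phi (v j)) = fun=> 0); first exact: cvg_cst.
    by apply/funext => j; have [i ->] := vu j.
  exact: (cvg_unique _ e1 e2).
move=> e e0; apply: contrapT => /forallNP h.
have : e <= p x by apply: (le_p _ _) => a; rewrite leNgt; apply/negP/h.
by rewrite -phix phix0 leNgt e0.
Qed.

End WeakCompactness.

Section SequentialWeakCompactness.
Context {R : realType} {W : completeNormedModType R}.

Lemma norming_functional (y : W) : exists phi : W -> R,
  [/\ in_dual phi, phi y = `|y| & forall v, `|phi v| <= `|v|].
Proof.
have sp : sublinear (fun v : W => `|v|).
  split=> [u v|t v t0]; first exact: ler_normD.
  by rewrite normrZ gtr0_norm.
have [phi [sphi phiy phip]] := hahn_banach y sp.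
have phiN v : phi (- v) = - phi v.
  have phi0 : phi 0 = 0.
    by have := sphi 1 0 0; rewrite scale1r mul1r addr0; lra.
  by rewrite -scaleN1r -[X in phi X]addr0 sphi phi0 mulN1r addr0.
have h v : `|phi v| <= `|v|.
  rewrite ler_norml phip andbT lerNl -phiN.
  by apply: le_trans (phip _) _; rewrite normrN.
by exists phi; split=> //; apply: (@bounded_in_dual _ _ _ 1) => // v; rewrite mul1r.
Qed.

Lemma lincomb_rat (u : nat -> W) n (a : seq R) (e : R) : 0 < e ->
  exists r : seq rat, `|lincomb u n a - lincomb u n (map ratr r)| < e.
Proof.
elim: a n e => [|c a IH] n e e0 /=; first by exists [::]; rewrite subrr normr0.
have e2 : 0 < e / 2 by rewrite divr_gt0.
have [r hr] := IH n.+1 _ e2.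
have un : 0 < `|u n| + 1 by rewrite ltr_wpDl.
have d0 : 0 < e / 2 / (`|u n| + 1) by rewrite divr_gt0.
have cd : c - e / 2 / (`|u n| + 1) < c + e / 2 / (`|u n| + 1) by lra.
have [q] := rat_in_itvoo cd.
rewrite in_itv /= => hq; exists (q :: r) => /=.
rewrite opprD addrACA -scalerBl (splitr e).
apply: le_lt_trans (ler_normD _ _) _; rewrite normrZ; apply: ler_ltD => //.
apply: (@le_trans _ _ (`|c - ratr q| * (`|u n| + 1))); first by rewrite ler_wpM2l// lerDl.
by rewrite -ler_pdivlMr// ler_norml; lra.
Qed.

(** The closed span is separable: functionals norming the rational combinations detect each of its
    non-zero points, which is close to a combination of comparable norm. *)
Lemma norming_sequence (u : nat -> W) : exists phi : nat -> W -> R,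
  (forall l, in_dual (phi l)) /\
  forall x, in_span u x -> (forall l, phi l x = 0) -> x = 0.
Proof.
pose y l := lincomb u 0 (map ratr (odflt [::] (unpickle l : option (seq rat)))).
have [phi hphi] := choice (fun l => norming_functional (y l)).
exists phi; split=> [l|x hx phi0]; first by have [] := hphi l.
apply/eqP; rewrite -normr_eq0 eq_le normr_ge0 andbT; apply/ler_addgt0Pr => e e0.
rewrite add0r; have e4 : 0 < e / 4 by rewrite divr_gt0.
have [a ha] := hx _ e4; have [r hr] := lincomb_rat u 0 a e4.
have yE : y (pickle r) = lincomb u 0 (map ratr r) by rewrite /y pickleK.
have xy : `|x - y (pickle r)| < e / 2.
  rewrite yE -(subrKA (lincomb u 0 a)); apply: le_lt_trans (ler_normD _ _) _.
  by lra.
have [dphi phiy phile] := hphi (pickle r).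
have : `|y (pickle r)| <= `|x - y (pickle r)|.
  rewrite -phiy; apply: le_trans (phile _); rewrite in_dualB// phi0 sub0r normrN.
  exact: ler_norm.
have : `|x| <= `|x - y (pickle r)| + `|y (pickle r)|.
  by rewrite -{1}[x](subrK (y (pickle r))) ler_normD.
by lra.
Qed.

Lemma increasing_selection (P : nat -> nat -> Prop) :
  (forall j m, exists i, (m < i)%N /\ P j i) ->
  exists sigma : nat -> nat, (forall m n, (m < n)%N -> (sigma m < sigma n)%N) /\
    forall j, P j (sigma j).
Proof.
move=> h.
have [st hst] := choice (fun jm : nat * nat => h jm.1 jm.2).
pose sigma := fix s (j : nat) : nat := if j is k.+1 then st (j, s k) else st (0%N, 0%N).
exists sigma; split; last first.
  by case=> [|j]; [exact: (hst (0, 0)%N).2|exact: (hst (j.+1, sigma j)).2].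
have step j : (sigma j < sigma j.+1)%N by exact: (hst (j.+1, sigma j)).1.
move=> m n; elim: n => // n IH; rewrite ltnS leq_eqVlt => /orP[/eqP->//|/IH].
by move=> h'; exact: ltn_trans (step n).
Qed.

Lemma ultra_extension (D : set nat) : (forall N : nat, exists j, (N <= j)%N /\ D j) ->
  exists U : set_system nat, [/\ UltraFilter U, (\oo : set_system nat) `<=` U & U D].
Proof.
move=> h.
have PF : ProperFilter (within D (\oo : set_system nat)).
  apply: Build_ProperFilter.
  by move=> [N _ hN]; have [j [Nj Dj]] := h N; exact: (hN j Nj Dj).
have [U [UU sU]] := @ultraFilterLemma _ _ PF; exists U; split=> //.
  by move=> A A_oo; apply: sU; apply: filterS A_oo => j.
by apply: sU; exists 0%N.
Qed.

Hypothesis reflexive : reflexive_space W.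

(** It suffices to control the countable norming family: [sigma] makes it converge to its values at
    an ultrafilter limit [x]. If some [psi] stayed away from [psi x], an ultrafilter on the bad
    indices would give a second limit in the closed span with the same norming values, hence [x]
    again. *)
Lemma weak_sequential_compactness (u : nat -> W) (C : R) :
  (forall j, `|u j| <= C) ->
  exists sigma : nat -> nat, (forall m n, (m < n)%N -> (sigma m < sigma n)%N) /\
    exists x, weak_cvg (u \o sigma) x.
Proof.
move=> uC; have [phi [dphi hphi]] := norming_sequence u.
have [|U [UU sU _]] := ultra_extension (D := setT); first by move=> N; exists N.
have UP : ProperFilter U by exact: ultra_proper.
have [x hx] := exists_ultra_weak_limit reflexive UU uC.
have [sigma [sincr hsigma]] : exists sigma : nat -> nat,
    (forall m n, (m < n)%N -> (sigma m < sigma n)%N) /\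
    forall j l, (l <= j)%N -> `|phi l x - phi l (u (sigma j))| < j.+1%:R^-1.
  apply: (increasing_selection (P := fun j i => forall l, (l <= j)%N ->
     `|phi l x - phi l (u i)| < j.+1%:R^-1)) => j m.
  have Um : U [set i | (m < i)%N] by apply: sU; exists m.+1.
  have Uj : U [set i | forall l, (l <= j)%N -> `|phi l x - phi l (u i)| < j.+1%:R^-1].
    have Ul l : U [set i | `|phi l x - phi l (u i)| < j.+1%:R^-1].
      have /cvgrPdist_lt := hx _ (dphi l).
      by move=> /(_ j.+1%:R^-1); rewrite invr_gt0 ltr0n => /(_ isT).
    have : forall k, U [set i | forall l, (l < k)%N -> `|phi l x - phi l (u i)| < j.+1%:R^-1].
      elim=> [|k IH]; first exact: filterE.
      apply: filterS2 IH (Ul k) => i h1 h2 l; rewrite ltnS leq_eqVlt => /orP[/eqP->//|].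
      exact: h1.
    by move=> /(_ j.+1).
  by have [i [? ?]] := filter_ex (filterI Um Uj); exists i.
exists sigma; split=> //; exists x => psi dpsi.
have sigma_ge j : (j <= sigma j)%N.
  by elim: j => // j IH; apply: leq_ltn_trans IH _; exact: sincr.
have xs : in_span u x by apply: (ultra_weak_limit_in_span UP _ hx) => j; exists j.
apply/cvgrPdist_lt => e e0; apply: contrapT => nn.
have [|U' [UU' sU' UD]] := ultra_extension
    (D := [set j | e <= `|psi x - psi (u (sigma j))|]).
  move=> N; apply: contrapT => hN; apply: nn; exists N => // j /= Nj.
  by rewrite ltNge; apply/negP => he; apply: hN; exists j.
have UP' : ProperFilter U' by exact: ultra_proper.
have [|x' hx'] := exists_ultra_weak_limit reflexive UU' (u := u \o sigma) (C := C).
  by move=> j; exact: uC.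
have xs' : in_span u x'.
  by apply: (ultra_weak_limit_in_span UP' _ hx') => j; exists (sigma j).
have phix l : phi l x' = phi l x.
  have e1 : phi l (u (sigma j)) @[j --> U'] --> phi l x' by exact: hx'.
  have e2 : phi l (u (sigma j)) @[j --> U'] --> phi l x.
    apply/cvgrPdist_lt => d d0.
    apply: sU'; have [N _ hN] := near_infty_natSinv_lt (PosNum d0).
    exists (maxn N l) => // j /=; rewrite geq_max => /andP[Nj lj].
    by apply: lt_trans (hsigma _ _ lj) _; exact: hN.
  exact: (cvg_unique _ e1 e2).
have xx' : x' = x.
  apply/eqP; rewrite -subr_eq0; apply/eqP; apply: hphi; first exact: in_spanB.
  by move=> l; rewrite in_dualB// phix subrr.
have /cvgrPdist_lt/(_ _ e0) h := hx' _ dpsi; rewrite xx' in h.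
have [j [/= h1 h2]] := filter_ex (filterI h UD).
by move: h1; rewrite ltNge h2.
Qed.

End SequentialWeakCompactness.

(** * Deformations along a pseudo-gradient *)

Section LipschitzSup.
Context {R : realType} {W : normedModType R}.
Implicit Types (P : W -> R -> Prop) (u : W) (r : R).

(** [P u r] is thought of as a property of the ball of centre [u] and radius [r] that passes to
    balls inside it. This makes [lipsup P] Lipschitz and turns such properties into continuous radii
    and cut-offs. *)
Definition shrinking P := forall u u' r r', P u r -> r' + `|u - u'| <= r -> P u' r'.

(* The largest radius at most 1 for which P holds; it is positive exactly where
   P holds for some positive radius. *)
Definition lipsup P u : R := sup [set r | 0 <= r <= 1 /\ (r = 0 \/ P u r)].

Lemma lipsup_has_sup P u : has_sup [set r | 0 <= r <= 1 /\ (r = 0 \/ P u r)].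
Proof.
split; first by exists 0; split; [rewrite lexx ler01|left].
by exists 1 => r [/andP[]].
Qed.

Lemma lipsup_ge0 P u : 0 <= lipsup P u.
Proof.
apply: ub_le_sup; first exact: (lipsup_has_sup P u).2.
by split; [rewrite lexx ler01|left].
Qed.

Lemma lipsup_le1 P u : lipsup P u <= 1.
Proof. by apply: ge_sup => [|r [/andP[]]//]; exact: (lipsup_has_sup P u).1. Qed.

Lemma le_lipsup P u r : 0 <= r <= 1 -> P u r -> r <= lipsup P u.
Proof. by move=> hr hP; apply: ub_le_sup; [exact: (lipsup_has_sup P u).2|split=> //; right]. Qed.

Lemma lt_lipsup P u r : shrinking P -> 0 <= r -> r < lipsup P u -> P u r.
Proof.
move=> sP r0 /sup_gt -/(_ (lipsup_has_sup P u).1)[t [ht [->|Pt]] rt].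
  by move: rt; rewrite ltNge r0.
by apply: sP Pt _; rewrite subrr normr0 addr0 ltW.
Qed.

Lemma lipsup_lip P u u' : shrinking P -> `|lipsup P u - lipsup P u'| <= `|u - u'|.
Proof.
move=> sP; suff h v v' : lipsup P v - lipsup P v' <= `|v - v'|.
  by rewrite ler_norml h andbT lerNl opprB (distrC u) h.
rewrite lerBlDr; apply: ge_sup => [|r [/andP[r0 r1] hr]].
  exact: (lipsup_has_sup P v).1.
have [rv|vr] := leP r `|v - v'|.
  by apply: le_trans rv _; rewrite lerDl lipsup_ge0.
have Pr : P v r by case: hr vr => // ->; rewrite ltNge normr_ge0.
rewrite -lerBlDl; apply: le_lipsup; last by apply: sP Pr _; rewrite subrK.
by rewrite subr_ge0 ltW//= lerBlDr ler_wpDr.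
Qed.

Lemma le_lipsup_sub P P' u : (forall r, P u r -> P' u r) -> lipsup P u <= lipsup P' u.
Proof.
move=> PP'; apply: ge_sup => [|r [r01 [->|Pr]]].
- exact: (lipsup_has_sup P u).1.
- exact: lipsup_ge0.
- by apply: le_lipsup => //; exact: PP'.
Qed.

Lemma lipsup_continuous P : shrinking P -> continuous (lipsup P).
Proof.
move=> sP u; apply/cvgrPdist_lt => e e0; near=> u'.
apply: le_lt_trans (lipsup_lip u u' sP) _; near: u'.
by apply: cvgr_dist_lt.
Unshelve. all: end_near. Qed.

Lemma shrinking_ball (C : set W) : shrinking (fun u r => ball u r `<=` C).
Proof.
move=> u u' r r' h hr y; rewrite -ball_normE /= => uy; apply: h.
rewrite -ball_normE /= -(subrKA u'); apply: le_lt_trans (ler_normD _ _) _.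
by rewrite addrC; apply: lt_le_trans hr; rewrite ltrD2r.
Qed.

Lemma shrinking_ex (I : Type) (P : I -> W -> R -> Prop) (A : I -> Prop) :
  (forall i, shrinking (P i)) -> shrinking (fun u r => exists2 i, A i & P i u r).
Proof. by move=> sP u u' r r' [i Ai /sP h] hr; exists i => //; exact: h. Qed.

Lemma lipschitz_continuous (X : normedModType R) (f : W -> X) (c : R) :
  (forall u v, `|f u - f v| <= c * `|u - v|) -> continuous f.
Proof.
move=> h u; apply/cvgrPdist_lt => e e0; near=> v.
have c0 : 0 < `|c| + 1 by rewrite ltr_wpDl.
apply: le_lt_trans (h _ _) _.
apply: (@le_lt_trans _ _ ((`|c| + 1) * `|u - v|)).
  by rewrite ler_wpM2r// (le_trans (ler_norm c))// lerDl.
rewrite mulrC -ltr_pdivlMr//; near: v.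
by apply: cvgr_dist_lt; rewrite ?divr_gt0//.
Unshelve. all: end_near. Qed.

End LipschitzSup.

Lemma exists_well_order (T : eqType) : exists lt : T -> T -> Prop,
  (forall x y, x <> y -> lt x y \/ lt y x) /\
  forall A : set T, A !=set0 -> exists2 x, A x & forall y, A y -> ~ lt y x.
Proof.
have [le wo] := wochoice.well_ordering_principle T.
have tot := wochoice.wo_chainW (C := predT) (wochoice.withinW wo).
have anti := wochoice.wo_chain_antisymmetric (C := predT) (wochoice.withinW wo).
exists (fun x y => x != y /\ le x y); split.
  move=> x y /eqP xy; have /orP[h|h] := tot x y isT isT; [left|right] => //.
  by split=> //; rewrite eq_sym.
move=> A [a Aa]; have [|m [[Am lbm] _]] := wo [pred x | `[< A x >]].
  by exists a; exact/asboolP.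
exists m; first exact/asboolP.
move=> y Ay [ym le_ym]; have le_my : le m y by apply: lbm; exact/asboolP.
by move/eqP: ym; apply; apply: (anti y m isT isT); rewrite le_ym.
Qed.

Section HalfSeries.
Context {R : realType} {W : normedModType R} {X : completeNormedModType R}.
Variable f : nat -> W -> X.
Hypothesis f_lip : forall n x y, `|f n x - f n y| <= 2 * `|x - y|.
Hypothesis f_le1 : forall n x, `|f n x| <= 1.

Definition half_series x : X ^nat := series (fun n => (2^-1 : R) ^+ n.+1 *: f n x).

Lemma half_sum_le1 n : \sum_(0 <= k < n) (2^-1 : R) ^+ k.+1 <= 1.
Proof.
suff -> : \sum_(0 <= k < n) (2^-1 : R) ^+ k.+1 = 1 - 2^-1 ^+ n.
  by rewrite lerBlDr lerDl exprn_ge0.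
elim: n => [|n IH]; first by rewrite big_geq// expr0 subrr.
by rewrite big_nat_recr//= IH exprS; field.
Qed.

Lemma is_cvg_half_series x : cvgn (half_series x).
Proof.
apply: normed_cvg.
apply: (@series_le_cvg _ _ (geometric 2^-1 2^-1)) => [n|n|n|].
- exact: normr_ge0.
- by rewrite /geometric/= mulr_ge0// exprn_ge0.
- rewrite /geometric/= normrZ ger0_norm ?exprn_ge0// exprS.
  by rewrite -[leRHS]mulr1 ler_wpM2l// mulr_ge0// exprn_ge0.
- by apply: is_cvg_geometric_series; rewrite ger0_norm// invf_lt1// ltr1n.
Qed.

Lemma half_series_lip x y : `|lim (half_series x @ \oo) - lim (half_series y @ \oo)| <= 2 * `|x - y|.
Proof.
have c : (fun n => `|half_series x n - half_series y n|) @ \oo -->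
    `|lim (half_series x @ \oo) - lim (half_series y @ \oo)|.
  by apply: cvg_norm; apply: cvgB; exact: is_cvg_half_series.
apply: (closed_cvg (fun t : R => t <= 2 * `|x - y|) _ _ _ c); first exact: closed_le.
apply: filterE => n; rewrite /half_series /series /= -sumrB.
apply: le_trans (ler_norm_sum _ _ _) _.
apply: (@le_trans _ _ (\sum_(0 <= k < n) (2^-1 : R) ^+ k.+1 * (2 * `|x - y|))).
  apply: ler_sum => k _; rewrite -scalerBr normrZ ger0_norm ?exprn_ge0//.
  by rewrite ler_wpM2l// exprn_ge0.
by rewrite -mulr_suml -[leRHS]mul1r ler_wpM2r ?mulr_ge0// half_sum_le1.
Qed.

End HalfSeries.

(** * Lipschitz pseudo-gradient fields *)

Section PseudoGradient.
Context {R : realType} {W : completeNormedModType R}.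
Variables (D : W -> W -> R) (Q : set W) (rho : R).
Hypothesis D_dual : forall u, Q u -> in_dual (D u).
Hypothesis D_open : forall v, open [set u | Q u /\ rho < D u v].
Hypothesis D_large : forall u, Q u -> exists2 v, `|v| <= 1 & rho < D u v.

Let C v := [set u | `|v| <= 1 /\ Q u /\ rho < D u v].

Let open_C v : open (C v).
Proof.
have [v1|v1] := boolP (`|v| <= 1).
  have -> : C v = [set u | Q u /\ rho < D u v] by apply/seteqP; split=> u // [].
  exact: D_open.
have -> : C v = set0 by apply/seteqP; split=> u // -[h]; rewrite h in v1.
exact: open0.
Qed.

Let prec := projT1 (cid (exists_well_order W)).
Let prec_total : forall x y, x <> y -> prec x y \/ prec y x.
Proof. exact: (projT2 (cid (exists_well_order W))).1. Qed.
Let prec_min : forall A : set W, A !=set0 -> exists2 x, A x & forall y, A y -> ~ prec y x.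
Proof. exact: (projT2 (cid (exists_well_order W))).2. Qed.

Let P1 v (u : W) (r : R) := ball u r `<=` C v.
Let P2 v (u : W) (r : R) := exists2 w, prec w v & P1 w u r.

Let sP1 v : shrinking (P1 v).
Proof. exact: shrinking_ball. Qed.
Let sP2 v : shrinking (P2 v).
Proof. by apply: shrinking_ex => w; exact: sP1. Qed.

Let e n : R := 2^-1 ^+ n.

(* For fixed n at most one v has 0 < bump v n u: the partition of unity behind
   Stone's theorem, with directions v ordered by a well-order. *)
Let bump v n u : R :=
  Num.max 0 (Num.min (lipsup (P1 v) u - 2 * e n) (e n - lipsup (P2 v) u)).

Let bump_ge0 v n u : 0 <= bump v n u.
Proof. by rewrite le_max lexx. Qed.

Let bumpP v n u : 0 < bump v n u -> 2 * e n < lipsup (P1 v) u /\ lipsup (P2 v) u < e n.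
Proof. by rewrite lt_max ltxx/= lt_min !subr_gt0 => /andP[]. Qed.

Let bump_le1 v n u : bump v n u <= 1.
Proof.
rewrite ge_max ler01/= ge_min; apply/orP; left.
have e0 : 0 <= e n by rewrite exprn_ge0.
by have := lipsup_le1 (P1 v) u; lra.
Qed.

Let bump_lip v n u u' : bump v n u <= bump v n u' + `|u - u'|.
Proof.
have h1 := lipsup_lip u u' (@sP1 v); have h2 := lipsup_lip u u' (@sP2 v).
rewrite ge_max; apply/andP; split; first by rewrite addr_ge0.
rewrite -lerBlDr le_max; apply/orP; right.
rewrite le_min; apply/andP; split; rewrite lerBlDr ge_min; apply/orP; [left|right].
  by have := ler_norm (lipsup (P1 v) u - lipsup (P1 v) u'); lra.
have := ler_norm (lipsup (P2 v) u' - lipsup (P2 v) u).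
by rewrite distrC; lra.
Qed.

Let bump_uniq v w n u : 0 < bump v n u -> 0 < bump w n u -> v = w.
Proof.
suff h v' w' : prec v' w' -> 0 < bump v' n u -> ~ 0 < bump w' n u.
  move=> hv hw; apply: contrapT => /prec_total[/h|/h]; first by move=> /(_ hv).
  by move=> /(_ hw).
move=> vw /bumpP[h1 _] /bumpP[_ h2].
have e0 : 0 <= e n by rewrite exprn_ge0.
have : lipsup (P1 v') u <= lipsup (P2 w') u.
  by apply: le_lipsup_sub => r hr; exists v'.
by lra.
Qed.

Let bump_C v n u : 0 < bump v n u -> C v u.
Proof.
move=> /bumpP[h1 _].
have e0 : 0 < 2 * e n by rewrite mulr_gt0// exprn_gt0.
have h := lt_lipsup (@sP1 v) (ltW e0) h1.
by apply: h; exact: ballxx.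
Qed.

Let bump_cover u : Q u -> exists v n, 0 < bump v n u.
Proof.
(* [v] is the least direction whose set contains [u]. No earlier direction interferes, so the
   subtracted radius is 0 at [u], and a fine enough scale [n] gives a positive bump. *)
move=> Qu; have [v Cv vmin] : exists2 v, C v u & forall w, C w u -> ~ prec w v.
  by apply: (prec_min (A := [set v | C v u])); have [v v1 Dv] := D_large Qu; exists v.
have : nbhs u (C v) by apply: open_nbhs_nbhs; split => //; exact: open_C.
move=> /nbhs_ballP[d /= d0 hd].
have l1 : 0 < lipsup (P1 v) u.
  have m0 : 0 < Num.min d 1 by rewrite lt_min d0 ltr01.
  apply: lt_le_trans m0 _; apply: le_lipsup.
    by rewrite le_min (ltW d0) ler01 ge_min lexx orbT.
  by apply: subset_trans hd; apply: le_ball; rewrite ge_min lexx.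
have l2 : lipsup (P2 v) u = 0.
  apply/eqP; rewrite eq_le lipsup_ge0 andbT leNgt; apply/negP => l2.
  have l2' : lipsup (P2 v) u / 2 < lipsup (P2 v) u by rewrite ltr_pdivrMr// ltr_pMr// ltr1n.
  have l20 : 0 < lipsup (P2 v) u / 2 by rewrite divr_gt0.
  have [w wv hw] := lt_lipsup (@sP2 v) (ltW l20) l2'.
  by apply: (vmin w) => //; apply: hw; exact: ballxx.
have [n hn] : exists n, 2 * e n < lipsup (P1 v) u.
  have : (fun n => 2 * e n) @ \oo --> (2 * 0 : R).
    apply: cvgM; first exact: cvg_cst.
    by apply: cvg_expr; rewrite ger0_norm// invf_lt1// ltr1n.
  rewrite mulr0 => h.
  have hn : \forall n \near \oo, 2 * e n < lipsup (P1 v) u by exact: (cvgr_lt _ h).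
  by have [n ?] := filter_ex hn; exists n.
exists v, n; rewrite lt_max; apply/orP; right.
by rewrite lt_min subr_gt0 hn l2 subr0 exprn_gt0.
Qed.

Let pick n u : W := xget 0 [set v | 0 < bump v n u].

Let pickE v n u : 0 < bump v n u -> pick n u = v.
Proof.
move=> h; apply: (bump_uniq (n := n) (u := u)) => //.
by rewrite /pick; case: xgetP => [v' _ //|/(_ v)/(_ h)].
Qed.

Let mass n u : R := bump (pick n u) n u.
Let field n u : W := mass n u *: pick n u.

Let mass_ge v n u : bump v n u <= mass n u.
Proof.
have := bump_ge0 v n u; rewrite le_eqVlt => /orP[/eqP <-|/pickE h].
  exact: bump_ge0.
by rewrite /mass h.
Qed.

Let mass_lip n u u' : `|mass n u - mass n u'| <= 2 * `|u - u'|.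
Proof.
suff h v w : mass n v - mass n w <= `|v - w|.
  rewrite ler_norml; have := h u u'; have := h u' u; rewrite distrC.
  by have := normr_ge0 (u - u'); lra.
rewrite lerBlDr addrC; apply: le_trans (bump_lip _ _ _ w) _.
by rewrite lerD2r mass_ge.
Qed.

Let field_le n u : `|field n u| <= mass n u.
Proof.
rewrite normrZ ger0_norm; last exact: bump_ge0.
have := bump_ge0 (pick n u) n u; rewrite le_eqVlt => /orP[/eqP h|/bump_C[h _]].
  by rewrite /mass -h mul0r.
by rewrite -[leRHS]mulr1 ler_wpM2l// bump_ge0.
Qed.

Let field_lip n u u' : `|field n u - field n u'| <= 2 * `|u - u'|.
Proof.
have [pp|pp] := eqVneq (pick n u) (pick n u').
  rewrite /field pp -scalerBl normrZ.
  have [h|h] := boolP (`|pick n u'| <= 1).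
    by apply: le_trans (mass_lip n u u'); rewrite -[leRHS]mulr1 ler_wpM2l.
  have m0 v : pick n v = pick n u' -> mass n v = 0.
    move=> pv; apply/eqP; rewrite eq_le bump_ge0 andbT leNgt; apply/negP.
    by move=> /bump_C[]; rewrite pv => h'; rewrite h' in h.
  by rewrite !m0// subrr normr0 mul0r mulr_ge0.
(* When the active directions differ, the bump of each vanishes at the other point, so both masses
   are at most the distance. *)
have small v w : pick n v <> pick n w -> mass n v <= `|v - w|.
  move=> vw; apply: le_trans (bump_lip _ _ _ w) _.
  have := bump_ge0 (pick n v) n w; rewrite le_eqVlt => /orP[/eqP <-|/pickE h].
    by rewrite add0r.
  by exfalso; apply: vw; rewrite h.
apply: le_trans (ler_normB _ _) _.
have := field_le n u; have := field_le n u'; have := small u u' (elimN eqP pp).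
have pp' : pick n u' <> pick n u by move/eqP: pp => pp /esym.
by have := small u' u pp'; rewrite (distrC u'); lra.
Qed.

Let mass_le1 n u : `|mass n u| <= 1.
Proof. by rewrite ger0_norm ?bump_ge0// bump_le1. Qed.

Let field_le1 n u : `|field n u| <= 1.
Proof. by apply: le_trans (field_le n u) _; exact: bump_le1. Qed.

(** Each scale has at most one active direction at a point, and its field has Lipschitz constant 2;
    the weights [2^-(n+1)] preserve this for the sum. The total mass [m] bounds [|V|] and measures
    the descent, which replaces a normalisation of the field. *)
Lemma exists_pseudogradient : exists (V : W -> W) (m : W -> R),
  [/\ forall u u', `|V u - V u'| <= 2 * `|u - u'|,
      forall u, `|V u| <= m u,
      forall u, 0 <= m u <= 1,
      forall u, Q u -> 0 < m u /\ rho * m u <= D u (V u) &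
      forall u, ~ Q u -> m u = 0].
Proof.
pose V u := lim (half_series field u @ \oo).
pose m u := lim (half_series (X := R^o) mass u @ \oo).
have cV u : half_series field u @ \oo --> V u by exact: is_cvg_half_series.
have cm u : half_series (X := R^o) mass u @ \oo --> m u.
  exact: (is_cvg_half_series (X := R^o)).
exists V, m; split.
- exact: half_series_lip.
- move=> u; have c : (fun n => `|half_series field u n| - half_series (X := R^o) mass u n) @ \oo
      --> `|V u| - m u.
    by apply: cvgB; [apply: cvg_norm; exact: cV|exact: cm].
  rewrite -subr_le0.
  apply: (closed_cvg (fun t : R => t <= 0) _ _ _ c); first exact: closed_le.
  apply: filterE => n; rewrite subr_le0 /half_series /series /=.
  apply: le_trans (ler_norm_sum _ _ _) _; apply: ler_sum => k _.
  by rewrite normrZ ger0_norm ?exprn_ge0// ler_wpM2l ?exprn_ge0.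
- move=> u; apply/andP; split.
    apply: (closed_cvg (fun t : R => 0 <= t) _ _ _ (cm u)); first exact: closed_ge.
    apply: filterE => n; rewrite /half_series /series /=; apply: sumr_ge0 => k _.
    by rewrite mulr_ge0 ?exprn_ge0// bump_ge0.
  apply: (closed_cvg (fun t : R => t <= 1) _ _ _ (cm u)); first exact: closed_le.
  apply: filterE => n; apply: le_trans (half_sum_le1 (R := R) n).
  rewrite /half_series /series /=; apply: ler_sum => k _.
  by rewrite -[leRHS]mulr1 ler_wpM2l ?exprn_ge0// bump_le1.
- move=> u Qu; split.
    have [v [n hb]] := bump_cover Qu.
    have hm : 0 < mass n u by apply: lt_le_trans hb (mass_ge _ _ _).
    apply: (@lt_le_trans _ _ ((2^-1 : R) ^+ n.+1 * mass n u)); first by rewrite mulr_gt0 ?exprn_gt0.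
    apply: (closed_cvg (fun t : R => _ <= t) _ _ _ (cm u)); first exact: closed_ge.
    exists n.+1 => // k /= nk; rewrite /half_series /series /=.
    rewrite big_mkord (bigD1 (Ordinal nk))//= lerDl sumr_ge0// => i _.
    by rewrite mulr_ge0 ?exprn_ge0// bump_ge0.
  have dD := D_dual Qu.
  have cD : (fun n => D u (half_series field u n)) @ \oo --> D u (V u).
    by apply: (continuous_cvg _ (dD.2 (V u))); exact: cV.
  have c : (fun n => rho * half_series (X := R^o) mass u n - D u (half_series field u n)) @ \oo
      --> rho * m u - D u (V u).
    by apply: cvgB => //; apply: cvgM; [exact: cvg_cst|exact: cm].
  rewrite -subr_le0.
  apply: (closed_cvg (fun t : R => t <= 0) _ _ _ c); first exact: closed_le.
  apply: filterE => n; rewrite subr_le0 /half_series /series /=.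
  change (rho * (\sum_(0 <= k < n) 2^-1 ^+ k.+1 * mass k u) <=
    D u (\sum_(0 <= k < n) 2^-1 ^+ k.+1 *: field k u)).
  elim: n => [|n IH]; first by rewrite !big_geq// mulr0 in_dual0.
  rewrite !big_nat_recr//= (in_dualD _ _ dD) mulrDr lerD// !(in_dualZ _ _ dD).
  rewrite mulrCA ler_wpM2l ?exprn_ge0// mulrC.
  have := bump_ge0 (pick n u) n u; rewrite le_eqVlt => /orP[/eqP h|/bump_C[_ [_ h]]].
    by rewrite /mass -h !mul0r.
  by rewrite ler_wpM2l ?bump_ge0// ltW.
- move=> u nQ; have e0 : half_series (X := R^o) mass u = fun=> 0.
    apply/funext => n; rewrite /half_series /series /=; apply: big1 => k _.
    have := bump_ge0 (pick k u) k u; rewrite le_eqVlt => /orP[/eqP h|/bump_C[_ []]//].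
    by rewrite /mass -h scaler0.
  by rewrite /m e0; apply: lim_cst; exact: norm_hausdorff.
Qed.

End PseudoGradient.

(** * Discrete descent and the deformation *)

Section Deformation.
Context {R : realType} {W : completeNormedModType R}.
Variables (L : W -> R) (D : W -> W -> R).
Hypothesis L_derive : forall (u v : W) (t : R), u + t *: v != 0 ->
  is_derive t 1 (fun x : R => L (u + x *: v)) (D (u + t *: v) v).
Hypothesis L_cont : forall u, u != 0 -> {for u, continuous L}.
Hypothesis L_even : forall u, L (- u) = L u.
Hypothesis D_dual : forall u, u != 0 -> in_dual (D u).
Hypothesis D_cont : forall u, u != 0 -> forall e : R, 0 < e ->
  \forall y \near u, forall v, `|v| <= 1 -> `|D y v - D u v| < e.
Hypothesis D_odd : forall u v, D (- u) v = - D u v.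
Variables (Q : set W) (rho : R).
Hypothesis rho_gt0 : 0 < rho.
Hypothesis Q_open : open Q.
Hypothesis Q_sym : symmetric_set Q.
Hypothesis Q_neq0 : forall u, Q u -> u != 0.
Hypothesis Q_large : forall u, Q u -> exists2 v, `|v| <= 1 & rho < D u v.

(** A ball in which a step is safe: 0 lies outside, and the derivative oscillates by at most half of
    the descent rate. *)
Let Good (u : W) (r : R) := forall y z, `|y - u| < r -> `|z - u| < r ->
  y != 0 /\ forall v, `|v| <= 1 -> `|D y v - D z v| <= rho / 2.

Let sGood : shrinking Good.
Proof.
move=> u u' r r' h hr y z hy hz.
have sm x : `|x - u'| < r' -> `|x - u| < r.
  move=> hx; rewrite -(subrKA u'); apply: le_lt_trans (ler_normD _ _) _.
  by apply: lt_le_trans hr; rewrite (distrC u) ltrD2r.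
by apply: h; exact: sm.
Qed.

Let tau := lipsup Good.

Let tau_gt0 u : u != 0 -> 0 < tau u.
Proof.
move=> u0; have r4 : 0 < rho / 4 by rewrite divr_gt0.
have [d /= d0 hd] := (nbhs_ballP _ _).1 (D_cont u0 r4).
have nu : 0 < `|u| by rewrite normr_gt0.
pose r := Num.min 1 (Num.min d `|u|).
have r0 : 0 < r by rewrite !lt_min ltr01 d0.
apply: (lt_le_trans r0); apply: le_lipsup; first by rewrite (ltW r0)/= ge_min lexx.
move=> y z hy hz; split.
  apply/eqP => y0; move: hy; rewrite y0 sub0r normrN !lt_min.
  by rewrite ltxx !andbF.
have dd x : `|x - u| < r -> ball u d x.
  by rewrite -ball_normE /= distrC !lt_min => /andP[_ /andP[]].
move=> v v1; have h1 := hd _ (dd _ hy) _ v1; have h2 := hd _ (dd _ hz) _ v1.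
rewrite -(subrKA (D u v)); apply: le_trans (ler_normD _ _) _.
by rewrite (distrC (D u v)); lra.
Qed.

Let tauN u : tau (- u) = tau u.
Proof.
suff h v r : Good v r -> Good (- v) r.
  rewrite /tau -[lipsup Good (- u)]/(lipsup (fun v => Good (- v)) u).
  apply/eqP; rewrite eq_le; apply/andP; split; apply: le_lipsup_sub => r.
    by move=> /h; rewrite opprK.
  exact: h.
move=> hv y z hy hz.
have e' x : `|x - - v| = `|- x - v|.
  by rewrite -[RHS]normrN [in RHS]opprB !opprK [in RHS]addrC.
rewrite !e' in hy hz; have [y0 h] := hv _ _ hy hz.
split; first by rewrite -oppr_eq0.
by move=> w /h; rewrite !D_odd -opprD normrN.
Qed.

(** The odd part of a pseudo-gradient field. Outside [Q] the mass is 0 and the field vanishes, so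
    the descent inequality extends to every non-zero point. *)
Lemma odd_pseudogradient : exists (V : W -> W) (m : W -> R),
  [/\ continuous V, forall u, V (- u) = - V u, forall u, `|V u| <= m u,
    forall u, `|V u| <= 1 &
    (forall u, Q u -> 0 < m u) /\
    (forall u, u != 0 -> rho * m u <= D u (V u))].
Proof.
have Dop v : open [set u | Q u /\ rho < D u v].
  rewrite openE => u [Qu hu].
  have u0 := Q_neq0 Qu.
  have c : {for u, continuous (fun y => D y v)}.
    apply/cvgrPdist_lt => e e0.
    have v0 : 0 < `|v| + 1 by rewrite ltr_wpDl.
    have /D_cont := u0; move=> /(_ (e / (`|v| + 1))); rewrite divr_gt0// => /(_ isT) h.
    have nz : \forall y \near u, y != 0.
      have nu : 0 < `|u| by rewrite normr_gt0.
      apply/nbhs_ballP; exists `|u| => // y; rewrite -ball_normE /=.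
      by apply: contraTneq => ->; rewrite subr0 ltxx.
    apply: filterS2 h nz => y hy y0.
    have := hy ((`|v| + 1)^-1 *: v); rewrite normrZ gtr0_norm ?invr_gt0//.
    rewrite mulrC ler_pdivrMr// mul1r lerDl ler01 => /(_ isT).
    rewrite (in_dualZ _ _ (D_dual y0)) (in_dualZ _ _ (D_dual u0)) -mulrBr normrM.
    rewrite gtr0_norm ?invr_gt0// mulrC ltr_pdivlMr// divfK ?gt_eqF//.
    by rewrite distrC.
  have h1 : \forall y \near u, rho < D y v by exact: (cvgr_gt _ c).
  have h2 : \forall y \near u, Q y by apply: open_nbhs_nbhs.
  by apply: filterS2 h1 h2.
have dD u : Q u -> in_dual (D u) by move=> /Q_neq0; exact: D_dual.
have [V [m [lipV Vm m01 hQ hnQ]]] := exists_pseudogradient dD Dop Q_large.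
have cV : continuous V by exact: lipschitz_continuous lipV.
pose V' u := 2^-1 *: (V u - V (- u)); pose m' u := 2^-1 * (m u + m (- u)).
have V'm' u : `|V' u| <= m' u.
  rewrite normrZ ger0_norm// ler_pM2l// (le_trans (ler_normB _ _))//.
  by rewrite lerD.
exists V', m'; split => //.
- move=> u; apply: cvgZr; apply: cvgB; first exact: cV.
  apply: continuous_comp; last exact: cV.
  exact: opp_continuous.
- by move=> u; rewrite /V' opprK -scalerN opprB.
- move=> u; apply: le_trans (V'm' u) _; rewrite /m'.
  by have := m01 u; have := m01 (- u); move=> /andP[_ h1] /andP[_ h2]; lra.
split.
  move=> u Qu; rewrite /m'; have [h _] := hQ _ Qu; have [h' _] := hQ _ (Q_sym Qu).
  by lra.
move=> u u0; have [Qu|nQu] := pselect (Q u); last first.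
  have nQ' : ~ Q (- u) by move=> /Q_sym; rewrite opprK.
  have m0 := hnQ _ nQu; have m0' := hnQ _ nQ'.
  have : `|V' u| <= 0 by rewrite (le_trans (V'm' u))// /m' m0 m0' addr0 mulr0.
  rewrite normr_le0 => /eqP ->; rewrite in_dual0; last exact: D_dual.
  by rewrite /m' m0 m0' addr0 mulr0 mulr0.
have du := D_dual u0.
rewrite /V' (in_dualZ _ _ du) (in_dualB _ _ du).
have [_ h1] := hQ _ Qu; have [_ h2] := hQ _ (Q_sym Qu).
rewrite D_odd in h2; rewrite /m'; lra.
Qed.

Variables (V : W -> W) (m : W -> R).
Hypothesis V_cont : continuous V.
Hypothesis V_odd : forall u, V (- u) = - V u.
Hypothesis V_le : forall u, `|V u| <= m u.
Hypothesis V_le1 : forall u, `|V u| <= 1.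
Hypothesis m_gt0 : forall u, Q u -> 0 < m u.
Hypothesis V_large : forall u, u != 0 -> rho * m u <= D u (V u).

Let step (x : R) (u : W) := u - (x * (tau u / 2)) *: V u.

Let step0 u : step 0 u = u.
Proof. by rewrite /step mul0r scale0r subr0. Qed.

Let stepN x u : step x (- u) = - step x u.
Proof. by rewrite /step tauN V_odd scalerN opprD. Qed.

Let tau_cont : continuous tau.
Proof. exact: lipsup_continuous. Qed.

Let step_cont (T : topologicalType) (x : T -> R) (h : T -> W) (t0 : T) :
  {for t0, continuous x} -> {for t0, continuous h} ->
  {for t0, continuous (fun t => step (x t) (h t))}.
Proof.
move=> cx ch; apply: cvgB; first exact: ch.
apply: cvgZ; last by apply: (continuous_comp ch); exact: V_cont.
apply: cvgM; first exact: cx.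
apply: cvgM; last exact: cvg_cst.
by apply: (continuous_comp ch); exact: tau_cont.
Qed.

(** The mean value theorem along the step: at its start the field decreases [L] at rate at least
    [rho * m u], hence [rho * |V u|], and the oscillation allowed by [Good] consumes at most half of
    it. *)
Let step_descent x u : u != 0 -> 0 <= x <= 1 ->
  step x u != 0 /\ L (step x u) <= L u - rho / 2 * `|step x u - u|.
Proof.
move=> u0 /andP[x0 x1].
have t0 := tau_gt0 u0.
pose c := x * (tau u / 2).
have c0 : 0 <= c by rewrite mulr_ge0// divr_ge0// ltW.
have ct : c <= tau u / 2 by rewrite -[leRHS]mul1r ler_wpM2r// divr_ge0// ltW.
(* Any factor strictly between one half and 1 would do: the supremum need not be attained, and the
   step has length at most [tau u / 2]. *)
have ht : 3 / 4 * tau u < lipsup Good u by rewrite -/(tau u); lra.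
have hG := lt_lipsup sGood (_ : 0 <= 3 / 4 * tau u) ht.
have {}hG : Good u (3 / 4 * tau u) by apply: hG; rewrite mulr_ge0// ltW.
have near_u t : 0 <= t <= c -> `|u + t *: (- V u) - u| < 3 / 4 * tau u.
  move=> /andP[t0' tc]; rewrite addrAC subrr add0r normrZ normrN ger0_norm//.
  apply: (@le_lt_trans _ _ (tau u / 2)); last by lra.
  apply: le_trans (_ : t * 1 <= _); first by rewrite ler_wpM2l.
  by rewrite mulr1 (le_trans tc).
have nz t : 0 <= t <= c -> u + t *: (- V u) != 0.
  move=> /near_u h; exact: (hG _ _ h h).1.
have stepE : step x u = u + c *: (- V u) by rewrite /step scalerN.
rewrite stepE; split; first by apply: nz; rewrite c0 lexx.
have [c00|cn0] := eqVneq c 0.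
  by rewrite c00 scale0r addr0 subrr normr0 mulr0 subr0.
have cgt0 : 0 < c by rewrite lt_neqAle eq_sym cn0.
have der t : 0 <= t <= c -> is_derive t 1 (fun y : R => L (u + y *: (- V u)))
    (D (u + t *: (- V u)) (- V u)) by move=> /nz; exact: L_derive.
have [||t] := @MVT _ (fun y : R => L (u + y *: (- V u)))
    (fun t => D (u + t *: (- V u)) (- V u)) 0 c cgt0.
- by move=> t; rewrite in_itv /= => /andP[h1 h2]; apply: der; rewrite !ltW.
- apply: derivable_within_continuous => t; rewrite in_itv /= => ht'.
  by have [] := der _ ht'.
rewrite in_itv /= => /andP[h1 h2].
rewrite scale0r addr0 subr0 => e.
have tc : 0 <= t <= c by rewrite !ltW.
have dt := D_dual (nz _ tc).
have -> : L (u + c *: (- V u)) = L u + D (u + t *: (- V u)) (- V u) * c by lra.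
rewrite (in_dualN _ dt) addrAC subrr add0r normrZ normrN (ger0_norm c0).
rewrite lerD2l mulNr lerN2 mulrA mulrC mulrCA mulrA ler_pM2r//.
have osc : `|D (u + t *: (- V u)) (V u) - D u (V u)| <= rho / 2 * `|V u|.
  have [V0|Vn0] := eqVneq (V u) 0.
    have z (phi : W -> R) : in_dual phi -> phi (V u) = 0.
      by move=> hphi; rewrite V0 in_dual0.
    by rewrite (z _ dt) (z _ (D_dual u0)) subr0 normr0 V0 normr0 mulr0.
  have Vgt0 : 0 < `|V u| by rewrite normr_gt0.
  have uu : `|u - u| < 3 / 4 * tau u by rewrite subrr normr0 mulr_gt0.
  have := (hG _ _ (near_u _ tc) uu).2 (`|V u|^-1 *: V u).
  rewrite normrZ gtr0_norm ?invr_gt0// mulVf ?gt_eqF// lexx => /(_ isT).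
  rewrite (in_dualZ _ _ dt) (in_dualZ _ _ (D_dual u0)) -mulrBr normrM.
  by rewrite gtr0_norm ?invr_gt0// mulrC ler_pdivrMr.
have := V_large u0; have := V_le u.
move=> Vm hV; have rm : rho * `|V u| <= rho * m u by rewrite ler_pM2l.
have := ler_norm (D u (V u) - D (u + t *: (- V u)) (V u)).
by rewrite distrC; lra.
Qed.

Variables (M : set W) (d eps : R).
Hypothesis eps_gt0 : 0 < eps.
Hypothesis M_le : forall u, M u -> L u <= d + eps.
Hypothesis M_near : forall u w, M u -> `|w - u| <= 4 * eps / rho ->
  w != 0 /\ (d - eps <= L w <= d + eps -> Q w).

Let T := step 1.

Let M_neq0 u : M u -> u != 0.
Proof.
move=> Mu; apply: (M_near Mu _).1.
by rewrite subrr normr0 divr_ge0 ?mulr_ge0 ?ltW.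
Qed.

Let one01 : ((0 : R) <= (1 : R) <= (1 : R))%R.
Proof. by apply/andP; split. Qed.

Let iterT_neq0 n u : u != 0 -> iter n T u != 0.
Proof. by move=> u0; elim: n => //= n IH; have [] := step_descent IH one01. Qed.

(** Otherwise the path has finite length and converges to some [w] in the strip. Then [T w = w], so
    [V w = 0] because [tau w > 0], against the positivity of [m] on [Q]. *)
Let iterT_exit u : M u -> exists n, L (iter n T u) < d - eps.
Proof.
move=> Mu; apply: contrapT => /forallNP hn.
have {}hn n : d - eps <= L (iter n T u) by rewrite leNgt; apply/negP/hn.
have u0 := M_neq0 Mu.
have r2 : 0 < rho / 2 by rewrite divr_gt0.
pose un n := iter n T u.
have un0 n : un n != 0 by exact: iterT_neq0.
have desc n : rho / 2 * `|un n.+1 - un n| <= L (un n) - L (un n.+1).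
  have [_] := step_descent (un0 n) one01; rewrite -/(T _) -[T (un n)]/(un n.+1).
  by lra.
pose a n := un n.+1 - un n.
have serE n : series a n = un n - un 0%N.
  by rewrite /series /= telescope_sumr.
have nserE n : rho / 2 * (\sum_(0 <= k < n) `|a k|) <= L u - L (un n).
  elim: n => [|n IH]; first by rewrite big_geq// mulr0 subrr.
  by rewrite big_nat_recr//= mulrDr; have := desc n; rewrite -/(a n); lra.
(* [L] can lose at most [2 * eps], and it loses at least [rho / 2] per unit of length; this is the
   origin of the radius in [M_near]. *)
have nser_le n : \sum_(0 <= k < n) `|a k| <= 4 * eps / rho.
  rewrite -(ler_pM2l r2); apply: le_trans (nserE n) _.
  have -> : rho / 2 * (4 * eps / rho) = 2 * eps by field; rewrite gt_eqF.
  by have := hn n; have := M_le Mu; lra.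
have /normed_cvg cs : cvgn [normed series a].
  apply: nondecreasing_is_cvgn.
    by apply: nondecreasing_series => n _ _; exact: normr_ge0.
  by exists (4 * eps / rho) => _ [n _ <-]; exact: nser_le.
pose w := lim (series a @ \oo) + u.
have uw : un n @[n --> \oo] --> w.
  have -> : un = (fun n => series a n + u).
    by apply/funext => n; rewrite serE subrK.
  by apply: cvgD; [exact: cs|exact: cvg_cst].
have wu : `|w - u| <= 4 * eps / rho.
  have c : (fun n => `|un n - u|) @ \oo --> `|w - u|.
    by apply: cvg_norm; apply: cvgB; [exact: uw|exact: cvg_cst].
  apply: (closed_cvg (fun t : R => t <= 4 * eps / rho) _ _ _ c); first exact: closed_le.
  apply: filterE => n; rewrite -[u]/(un 0%N) -serE.
  by apply: le_trans (nser_le n); exact: ler_norm_sum.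
have [w0 hQ] := M_near Mu wu.
have Lw : L (un n) @[n --> \oo] --> L w by apply: (continuous_cvg _ (L_cont w0)).
have Qw : Q w.
  apply: hQ; apply/andP; split.
    apply: (closed_cvg (fun t : R => d - eps <= t) _ _ _ Lw); first exact: closed_ge.
    exact: filterE.
  apply: (closed_cvg (fun t : R => t <= d + eps) _ _ _ Lw); first exact: closed_le.
  apply: filterE => n; apply: le_trans (M_le Mu).
  rewrite -subr_ge0; apply: le_trans (nserE n).
  by rewrite mulr_ge0 ?(ltW r2)// sumr_ge0.
have Tw : T w = w.
  have c1 : T (un n) @[n --> \oo] --> T w.
    apply: (continuous_cvg _ _ uw).
    by apply: (@step_cont W (fun=> 1) id); [exact: cvg_cst|exact: cvg_id].
  have c2 : T (un n) @[n --> \oo] --> w.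
    by have := uw; rewrite -cvg_shiftS.
  exact: (cvg_unique _ c1 c2).
have V0 : V w = 0.
  move: Tw; rewrite /T /step mul1r => /eqP; rewrite subr_eq addrC -subr_eq subrr eq_sym.
  rewrite scaler_eq0 => /orP[|/eqP//].
  by rewrite gt_eqF// divr_gt0// tau_gt0.
have := V_large w0; rewrite V0 in_dual0; last exact: D_dual.
by rewrite leNgt mulr_gt0// m_gt0.
Qed.

Let U n := [set u | u != 0 /\ L (iter n T u) < d - eps].

Let T_cont : continuous T.
Proof. by move=> u; apply: (@step_cont W (fun=> 1) id); [exact: cvg_cst|exact: cvg_id]. Qed.

Let iterT_cont n : continuous (iter n T).
Proof.
elim: n => [|n IH] u; first exact: cvg_id.
by apply: (continuous_comp (IH u)); exact: T_cont.
Qed.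

Let open_U n : open (U n).
Proof.
rewrite openE => u [u0 hu].
have nz : \forall y \near u, y != 0.
  have nu : 0 < `|u| by rewrite normr_gt0.
  apply/nbhs_ballP; exists `|u| => // y; rewrite -ball_normE /=.
  by apply: contraTneq => ->; rewrite subr0 ltxx.
have c : {for u, continuous (fun y => L (iter n T y))}.
  apply: (@continuous_comp _ _ _ (iter n T) L); first exact: iterT_cont.
  by apply: L_cont; exact: iterT_neq0.
have h : \forall y \near u, L (iter n T y) < d - eps by exact: (cvgr_lt _ c).
by apply: filterS2 nz h.
Qed.

(** The bound on [r] couples the radius to the number [n] of steps that carry the ball below the
    strip. A positive [kappa] thereby yields the continuous bound [2 / kappa] on the exit time. *)
Let Exit (u : W) (r : R) := exists2 n, r <= n.+1%:R^-1 & ball u r `<=` U n.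

Let sExit : shrinking Exit.
Proof.
move=> u u' r r' [n rn hb] hr; exists n.
  by apply: le_trans rn; apply: le_trans hr; rewrite lerDl.
exact: (shrinking_ball hb).
Qed.

Let kappa := lipsup Exit.

Let kappa_gt0 u : M u -> 0 < kappa u.
Proof.
move=> Mu; have [n hn] := iterT_exit Mu.
have : nbhs u (U n) by apply: open_nbhs_nbhs; split; [exact: open_U|split=> //; exact: M_neq0].
move=> /nbhs_ballP[e /= e0 he].
have i0 : 0 < n.+1%:R^-1 :> R by rewrite invr_gt0 ltr0n.
pose r := Num.min e n.+1%:R^-1.
have r0 : 0 < r by rewrite lt_min e0.
apply: (lt_le_trans r0); apply: le_lipsup.
  rewrite (ltW r0)/= ge_min; apply/orP; right; rewrite invf_le1 ?ltr0n// ler1n//.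
exists n; first by rewrite ge_min lexx orbT.
by apply: subset_trans he; apply: le_ball; rewrite ge_min lexx.
Qed.

Let iterTN n u : iter n T (- u) = - iter n T u.
Proof. by elim: n => //= n ->; exact: stepN. Qed.

Let ExitN v r : Exit v r -> Exit (- v) r.
Proof.
move=> [n rn hb]; exists n => // y; rewrite -ball_normE /= => hy.
have /hb[y0 hL] : ball v r (- y) by rewrite -ball_normE /= opprK -normrN opprD.
split; first by rewrite -oppr_eq0.
by move: hL; rewrite iterTN L_even.
Qed.

Let kappaN u : kappa (- u) = kappa u.
Proof.
rewrite /kappa -[lipsup Exit (- u)]/(lipsup (fun v => Exit (- v)) u).
apply/eqP; rewrite eq_le; apply/andP; split; apply: le_lipsup_sub => r.
  by move=> /ExitN; rewrite opprK.
exact: ExitN.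
Qed.

Let nu u := 2 / kappa u.

Let nuP u : 0 < kappa u -> exists2 n, U n u & n.+1%:R <= nu u.
Proof.
move=> k0; have k2 : 0 < kappa u / 2 by rewrite divr_gt0.
have kl : kappa u / 2 < lipsup Exit u by rewrite ltr_pdivrMr// ltr_pMr// ltr1n.
have [n rn hb] := lt_lipsup sExit (ltW k2) kl.
exists n; first by apply: hb; exact: ballxx.
by rewrite /nu -[2]invrK -invfM mulrC -[leLHS]invrK lef_pV2 ?posrE ?invr_gt0 ?ltr0n.
Qed.

(** The step number [j] is full while [j + 1 <= nu u], absent once [nu u <= j] and partial in
    between, so that a varying number of steps depends continuously on [u]. *)
Let chi j u : R := Num.max 0 (Num.min 1 (nu u - j%:R)).

Let chi01 j u : 0 <= chi j u <= 1.
Proof. by rewrite le_max lexx/= ge_max ler01/= ge_min lexx. Qed.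

Let chiN j u : chi j (- u) = chi j u.
Proof. by rewrite /chi /nu kappaN. Qed.

Let chi_cont j u : 0 < kappa u -> {for u, continuous (chi j)}.
Proof.
move=> k0; apply: continuous_max; first exact: cvg_cst.
apply: continuous_min; first exact: cvg_cst.
apply: cvgB; last exact: cvg_cst.
apply: cvgM; first exact: cvg_cst.
apply: cvgV; first by rewrite gt_eqF.
exact: lipsup_continuous.
Qed.

Let flow := fix S (j : nat) (u : W) : W :=
  if j is i.+1 then step (chi i u) (S i u) else u.

Let flow_cont j u : 0 < kappa u -> {for u, continuous (flow j)}.
Proof.
move=> k0; elim: j => [|j IH]; first exact: cvg_id.
by apply: (@step_cont W (chi j) (flow j)) => //; exact: chi_cont.
Qed.

Let flowN j u : flow j (- u) = - flow j u.
Proof. by elim: j => //= j ->; rewrite chiN stepN. Qed.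

Let flow_descent i j u : u != 0 -> flow (i + j) u != 0 /\ L (flow (i + j) u) <= L (flow j u).
Proof.
move=> u0; have nz k : flow k u != 0.
  by elim: k => //= k IH; have [] := step_descent IH (chi01 k u).
split; first exact: nz.
elim: i => // i IH; rewrite addSn /=; apply: le_trans IH.
have [_ h] := step_descent (nz (i + j)) (chi01 (i + j) u).
by apply: le_trans h _; rewrite gerBl mulr_ge0// divr_ge0// ltW.
Qed.

Let flow_stable i j u : nu u <= j%:R -> flow (i + j) u = flow j u.
Proof.
move=> nj; elim: i => // i IH; rewrite addSn /= -IH.
have -> : chi (i + j) u = 0; last exact: step0.
apply/eqP; rewrite eq_le (andP (chi01 _ _)).1 andbT ge_max lexx/= ge_min.
apply/orP; right; rewrite subr_le0; apply: le_trans nj _.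
by rewrite ler_nat leq_addl.
Qed.

Let flow_full n u : n%:R <= nu u -> flow n u = iter n T u.
Proof.
elim: n => // n IH hn; rewrite /= -IH; last first.
  by apply: le_trans hn; rewrite ler_nat.
have -> // : chi n u = 1.
apply/eqP; rewrite eq_le (andP (chi01 _ _)).2/= le_max; apply/orP; right.
by rewrite le_min lexx/= lerBrDr nat1r.
Qed.

Let time u := (Num.truncn (nu u)).+1.

Lemma deformation : exists eta : W -> W,
  [/\ forall u, M u -> {for u, continuous eta},
      forall u, eta (- u) = - eta u &
      forall u, M u -> eta u != 0 /\ L (eta u) < d - eps].
Proof.
exists (fun u => flow (time u) u); split.
- move=> u Mu; have k0 := kappa_gt0 Mu.
  have nuc : {for u, continuous nu}.
    apply: cvgM; first exact: cvg_cst.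
    by apply: cvgV; [rewrite gt_eqF|exact: lipsup_continuous].
  have h : \forall y \near u, nu y < (time u)%:R.
    by apply: (cvgr_lt _ nuc); exact: truncnS_gt.
  (* All steps beyond [nu] are trivial, so near [u] the number of steps can be frozen at
     [time u]. *)
  have e : \forall y \near u, flow (time u) y = flow (time y) y.
    apply: filterS h => y hy.
    have hy' : nu y <= (time y)%:R by rewrite ltW// truncnS_gt.
    have [ty|ty] := leqP (time u) (time y).
      by rewrite -(subnK ty) flow_stable// ltW.
    by rewrite -(subnK (ltnW ty)) flow_stable.
  have c : flow (time u) y @[y --> u] --> flow (time u) u by exact: flow_cont.
  apply: (cvg_trans _ c); exact: near_eq_cvg.
- by move=> u; rewrite /time /nu kappaN flowN.
- move=> u Mu; have k0 := kappa_gt0 Mu; have u0 := M_neq0 Mu.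
  (* The first [n] steps are full and go below the strip; the later ones do not increase [L]. *)
  have [n [_ Un] hn] := nuP k0.
  have nt : (n <= time u)%N.
    rewrite -(ler_nat R) (le_trans _ (ltW (truncnS_gt _)))//.
    by apply: le_trans hn; rewrite ler_nat.
  have [h1 h2] := flow_descent (time u - n) n u0.
  rewrite subnK// in h1 h2; split=> //; apply: le_lt_trans h2 _.
  rewrite flow_full//; apply: le_trans hn; by rewrite ler_nat.
Qed.

End Deformation.

(** * Potential operators and the scaled framework *)

Section Potentials.
Context {R : realType} {W : completeNormedModType R}.
Implicit Types (p : W -> W -> R) (u v : W).

Definition gradient (P : W -> R) (u : W) (g : W -> R) :=
  differentiable P u /\ forall v, 'd P u v = g v.

Lemma gradient_is_derive P u g v : gradient P u g -> is_derive u v P (g v).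
Proof.
move=> [dP gP]; apply: DeriveDef; first exact: diff_derivable.
by rewrite deriveE.
Qed.

Lemma gradient_line P u v (t : R) g : gradient P (u + t *: v) g ->
  is_derive t 1 (fun x : R => P (u + x *: v)) (g v).
Proof.
move=> [dP gP].
have h : is_diff t (fun x : R => u + x *: v) (fun x => x *: v).
  rewrite (_ : (fun x : R => u + x *: v) = cst u + *:%R^~ v)//.
  apply: is_diff_eq (is_diffD (is_diff_cst u t) (is_diff_scalel t v)) _.
  by apply/funext => x /=; rewrite [LHS]add0r.
have dP' : is_diff (u + t *: v) P ('d P (u + t *: v)) by split.
have hc := @is_diff_comp _ _ _ _ (fun x : R => u + x *: v) _ P _ t h dP'.
have [dc e] := hc; apply: DeriveDef; first exact: diff_derivable.
by rewrite deriveE// e /= scale1r gP.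
Qed.

Lemma operator_cont p u : potential_operator p -> forall e : R, 0 < e ->
  \forall y \near u, forall v, `|v| <= 1 -> `|p y v - p u v| < e.
Proof.
move=> [dp cp _] e e0; have /cvgrPdist_lt/(_ _ e0) := cp u.
apply: filterS => y; rewrite sub0r normrN => h v v1.
apply: (@dual_norm_lt _ _ (fun v => p y v - p u v)) => //.
  exact: in_dualBfun.
exact: le_lt_trans (ler_norm _) h.
Qed.

Lemma operator_cvg p (T : Type) (F : set_system T) (y : T -> W) u v :
  ProperFilter F -> potential_operator p -> y @ F --> u ->
  p (y t) v @[t --> F] --> p u v.
Proof.
move=> FF hp yu; apply/cvgrPdist_lt => e e0.
have v0 : 0 < `|v| + 1 by rewrite ltr_wpDl.
have h : F [set t | forall w, `|w| <= 1 -> `|p (y t) w - p u w| < e / (`|v| + 1)].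
  exact: (yu _ (operator_cont u hp (divr_gt0 e0 v0))).
apply: filterS h => t /(_ ((`|v| + 1)^-1 *: v)).
rewrite normrZ gtr0_norm ?invr_gt0// mulrC ler_pdivrMr// mul1r lerDl ler01.
have [dp _ _] := hp.
move=> /(_ isT); rewrite !(in_dualZ _ _ (dp _)) -mulrBr normrM.
by rewrite gtr0_norm ?invr_gt0// mulrC ltr_pdivlMr// divfK ?gt_eqF// distrC.
Qed.

Lemma operator_line_cont p u (t : R) : potential_operator p ->
  {for t, continuous (fun x : R => p (x *: u) u)}.
Proof.
move=> hp; apply: (@operator_cvg p R (nbhs t) (fun x => x *: u)) => //.
by apply: cvgZ; [exact: cvg_id|exact: cvg_cst].
Qed.

Lemma line_integrable p u : potential_operator p ->
  lebesgue_measure.-integrable [set` `[0 : R, 1]] (EFin \o (fun t : R => p (t *: u) u)).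
Proof.
move=> hp; apply: continuous_compact_integrable; first exact: segment_compact.
by apply: continuous_subspaceT => t; exact: operator_line_cont.
Qed.

(** The fundamental theorem of calculus on the segment from 0 to [u]: the integral selects the
    primitive that vanishes at 0. *)
Lemma potentialE p P : potential_operator p ->
  (forall u, differentiable P u /\ forall v, 'd P u v = p u v) ->
  forall u, potential p u = P u - P 0.
Proof.
move=> hp hP u.
have dF (t : R) : is_derive t 1 (fun x : R => P (x *: u)) (p (t *: u) u).
  have := @gradient_line P 0 u t (p (0 + t *: u)) (hP _).
  by under eq_fun do rewrite add0r; rewrite add0r.
have := @continuous_FTC2 R (fun t => p (t *: u) u) (fun t => P (t *: u)) 0 1 ltr01.
have c : {within `[(0 : R), 1], continuous (fun t : R => p (t *: u) u)}.
  by apply: continuous_subspaceT => t; exact: operator_line_cont.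
move=> /(_ c) h; rewrite /potential /Rintegral h ?scale1r ?scale0r//.
  have cF (t : R) : {for t, continuous (fun x : R => P (x *: u))}.
    by apply: differentiable_continuous; apply/derivable1_diffP; have [] := dF t.
  split.
  - by move=> t _; have [] := dF t.
  - by apply: cvg_at_right_filter; exact: cF.
  - by apply: cvg_at_left_filter; exact: cF.
by move=> t _; rewrite derive1E; have [_ ->] := dF t.
Qed.

Lemma potential_gradient p u : potential_operator p -> gradient (potential p) u (p u).
Proof.
move=> hp; have [_ _ [P hP]] := hp.
have -> : potential p = P - cst (P 0) by apply/funext => v; rewrite (potentialE hp hP).
have [dP gP] := hP u.
have dP' : is_diff u P ('d P u) by split.
have h := is_diffB dP' (is_diff_cst (P 0) u).
have [dh e] := h; split=> [|v]; first exact: dh.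
by rewrite e /= -gP; exact: subr0.
Qed.

Lemma potential_cont p : potential_operator p -> continuous (potential p).
Proof.
by move=> hp u; apply: differentiable_continuous; have [] := potential_gradient u hp.
Qed.

Lemma potential0 p : potential_operator p -> potential p 0 = 0.
Proof. by move=> hp; have [_ _ [P hP]] := hp; rewrite (potentialE hp hP) subrr. Qed.

Lemma potential_even p : odd_operator p -> potential_operator p ->
  forall u, potential p (- u) = potential p u.
Proof.
move=> op [dp _ _] u; rewrite /potential; congr Rintegral; apply/funext => t.
by rewrite scalerN op in_dualN// opprK.
Qed.

Lemma potential_scaling p (sc : W -> R -> W) (s a : R) : is_scaling sc s ->
  potential_operator p -> homogeneous_operator sc a p ->
  forall u t, 0 <= t -> potential p (sc u t) = t `^ a * potential p u.
Proof.
move=> hs hp hh u t t0; rewrite /potential -RintegralZl//; last exact: line_integrable.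
congr Rintegral; apply/funext => x.
by rewrite -(scaling_scale hs)// hh.
Qed.

Lemma zero_potential p : potential_operator p -> (forall u, potential p u = 0) ->
  forall u v, p u v = 0.
Proof.
move=> hp h u v; have [_ <-] := potential_gradient u hp.
have -> : potential p = cst 0 by apply/funext.
by rewrite diff_cst.
Qed.

Lemma potential_MVT p u v : potential_operator p ->
  exists2 x : R, 0 < x < 1 & potential p v - potential p u = p (u + x *: (v - u)) (v - u).
Proof.
move=> hp.
have dF (t : R) : is_derive t 1 (fun x : R => potential p (u + x *: (v - u)))
    (p (u + t *: (v - u)) (v - u)).
  by apply: gradient_line; exact: potential_gradient.
have [|x] := @MVT _ (fun x : R => potential p (u + x *: (v - u))) _ 0 1 ltr01
    (fun x _ => dF x).
  by apply: derivable_within_continuous => x _; have [] := dF x.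
rewrite in_itv /= => /andP[x0 x1] e; exists x; first by rewrite x0.
by move: e; rewrite scale1r scale0r addr0 subrKC subr0 mulr1.
Qed.

End Potentials.

Section BoundedSets.
Context {R : realType} {W : normedModType R}.

Lemma bounded_setI (E : set W) (C : R) : (forall u, E u -> `|u| <= C) -> bounded_set E.
Proof. by move=> h; exists C; split=> [|x Cx u /h /le_trans]; [exact: num_real|apply; exact: ltW]. Qed.

Lemma bounded_setE (E : set W) : bounded_set E -> exists C : R, forall u, E u -> `|u| <= C.
Proof. by move=> [C [_ h]]; exists (C + 1) => u; apply: h; rewrite ltrDl. Qed.

End BoundedSets.

Lemma powR_cont {R : realType} (a x : R) : 0 < x ->
  {for x, continuous (fun y : R => y `^ a)}.
Proof.
move=> x0; apply: differentiable_continuous; apply/derivable1_diffP.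
by have [] := is_derive1_powR a x0.
Qed.

Lemma increasing_ge (sigma : nat -> nat) :
  (forall m n, (m < n)%N -> (sigma m < sigma n)%N) -> forall j, (j <= sigma j)%N.
Proof. by move=> h; elim=> // j IH; apply: leq_ltn_trans IH _; exact: h. Qed.

Lemma increasing_cvg (sigma : nat -> nat) :
  (forall m n, (m < n)%N -> (sigma m < sigma n)%N) -> sigma @ \oo --> (\oo : set_system nat).
Proof.
move=> h A [N _ hA]; exists N => // j /= Nj; apply: hA => /=.
exact: leq_trans Nj (increasing_ge h j).
Qed.

Section Scaling.
Context {R : realType} {W : completeNormedModType R}.
Variables (sc : W -> R -> W) (s : R).
Hypothesis hs : is_scaling sc s.

Lemma scalingN u t : 0 <= t -> sc (- u) t = - sc u t.
Proof. by move=> t0; rewrite -scaleN1r (scaling_scale hs)// scaleN1r. Qed.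

Lemma scalingK u t : 0 < t -> sc (sc u t) t^-1 = u.
Proof.
move=> t0; rewrite (scaling_comp hs) ?invr_ge0 ?ltW// divff ?gt_eqF//.
exact: (scaling1 hs).
Qed.

Lemma scalingKV u t : 0 < t -> sc (sc u t^-1) t = u.
Proof. by move=> t0; rewrite -{2}[t]invrK scalingK// invr_gt0. Qed.

Lemma scaling_of0 t : 0 <= t -> sc 0 t = 0.
Proof. by move=> t0; have := scaling_scale hs 0 0 t0; rewrite !scale0r. Qed.

Lemma scaling_neq0 u t : u != 0 -> 0 < t -> sc u t != 0.
Proof.
move=> u0 t0; apply: contra_neq u0 => h.
by rewrite -[u](scalingK _ t0) h scaling_of0// invr_ge0 ltW.
Qed.

Lemma scaling_cont (T : Type) (F : set_system T) (u : T -> W) (t : T -> R) (u0 : W) (t0 : R) :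
  ProperFilter F -> 0 < t0 -> u @ F --> u0 -> t @ F --> t0 ->
  sc (u x) (t x) @[x --> F] --> sc u0 t0.
Proof.
move=> FF t00 cu ct.
have h : {for (u0, t0), continuous (fun x : W * R => sc x.1 x.2)}.
  have sub : [set x : W * R | 0 < x.2] `<=` [set x : W * R | 0 <= x.2].
    by move=> x /= /ltW.
  have := continuous_subspaceW sub (scaling_continuous hs).
  rewrite continuous_open_subspace; first by apply; rewrite inE.
  rewrite (_ : [set x : W * R | 0 < x.2] = snd @^-1` [set y | 0 < y])//.
  by apply: open_comp => [x _|]; [exact: cvg_snd|exact: open_gt].
have hp : (u x, t x) @[x --> F] --> (u0, t0) by exact: (cvg_pair cu ct).
exact: (cvg_comp _ _ hp h).
Qed.

End Scaling.

(** * Weak compactness in the scaled framework *)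

Section FrameworkFacts.
Context {R : realType} {W : completeNormedModType R}.
Variables (sc : W -> R -> W) (s q r : R) (A B f g : W -> W -> R).
Hypothesis hframe : scaled_framework sc s q r A B f g.
Hypothesis hF : forall u : W, u != 0 -> 0 < potential f u.
Hypothesis hG : forall u : W, u != 0 -> potential g u = 0.

Local Notation I := (potential A).
Local Notation J := (potential B).
Local Notation F := (potential f).

Lemma fw_scaling : is_scaling sc s. Proof. exact: sf_scaling hframe. Qed.
Lemma fw_A : potential_operator A. Proof. by have [] := sf_A hframe. Qed.
Lemma fw_B : potential_operator B. Proof. by have [] := sf_B hframe. Qed.
Lemma fw_f : potential_operator f. Proof. by have [] := sf_f hframe. Qed.
Lemma fw_g : potential_operator g. Proof. by have [] := sf_g hframe. Qed.
Lemma fw_s0 : 0 < s. Proof. exact: scaling_exponent_gt0 fw_scaling. Qed.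
Lemma fw_q0 : 0 < q. Proof. by have [] := sf_exponents hframe. Qed.
Lemma fw_qs : q < s. Proof. by have [] := sf_exponents hframe. Qed.

Lemma fw_G u : potential g u = 0.
Proof. by have [->|/hG//] := eqVneq u 0; exact: potential0 fw_g. Qed.

Lemma fw_g0 u v : g u v = 0.
Proof. by apply: zero_potential; [exact: fw_g|exact: fw_G]. Qed.

Lemma fw_I_scaling u t : 0 <= t -> I (sc u t) = t `^ s * I u.
Proof. by move=> t0; apply: (potential_scaling fw_scaling fw_A) => //; have [] := sf_A hframe. Qed.
Lemma fw_J_scaling u t : 0 <= t -> J (sc u t) = t `^ s * J u.
Proof. by move=> t0; apply: (potential_scaling fw_scaling fw_B) => //; have [] := sf_B hframe. Qed.
Lemma fw_F_scaling u t : 0 <= t -> F (sc u t) = t `^ q * F u.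
Proof.
move=> t0; apply: (potential_scaling fw_scaling fw_f) => //.
exact: sf_f_homogeneous hframe.
Qed.

Lemma fw_I_even u : I (- u) = I u.
Proof. by apply: potential_even; have [] := sf_A hframe. Qed.
Lemma fw_J_even u : J (- u) = J u.
Proof. by apply: potential_even; have [] := sf_B hframe. Qed.
Lemma fw_F_even u : F (- u) = F u.
Proof. by apply: potential_even; have [] := sf_f hframe. Qed.

Lemma positive_potential (p : W -> W -> R) u : potential_operator p ->
  (forall v, v != 0 -> 0 < p v v) -> u != 0 -> 0 < potential p u.
Proof.
move=> hp pos u0; have [x /andP[x0 _]] := potential_MVT 0 u hp.
rewrite (potential0 hp) !subr0 add0r => ->.
have h := pos _ (_ : x *: u != 0); rewrite scaler_eq0 negb_or u0 gt_eqF// in h.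
have [dp _ _] := hp; have := h isT.
by rewrite (in_dualZ _ _ (dp _)) pmulr_rgt0.
Qed.

Lemma fw_I_gt0 u : u != 0 -> 0 < I u.
Proof. by apply: positive_potential; [exact: fw_A|exact: sf_A_gt0 hframe]. Qed.
Lemma fw_J_gt0 u : u != 0 -> 0 < J u.
Proof. by apply: positive_potential; [exact: fw_B|exact: sf_B_gt0 hframe]. Qed.

Lemma fw_J_eq0 u : J u = 0 -> u = 0.
Proof. by move=> h; apply/eqP; apply: contraTT (lexx (0 : R)) => /fw_J_gt0; rewrite h ltxx. Qed.
Lemma weak_cvg_dual_cvg (p : W -> W -> R) (u v : nat -> W) (u0 : W) (C : R) :
  potential_operator p -> weak_to_strong p -> weak_cvg u u0 -> weak_cvg v u0 ->
  (forall j, `|v j - u0| <= C) ->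
  p (u j) (v j - u0) @[j --> \oo] --> (0 : R).
Proof.
move=> hp wp cu cv vC; have [dp _ _] := hp.
have C0 : 0 <= C by apply: le_trans (vC 0%N).
have h1 : p u0 (v j - u0) @[j --> \oo] --> (0 : R).
  rewrite -(subrr (p u0 u0)).
  under eq_fun do rewrite (in_dualB _ _ (dp _)).
  by apply: cvgB; [exact: cv|exact: cvg_cst].
have h2 : p (u j) (v j - u0) - p u0 (v j - u0) @[j --> \oo] --> (0 : R).
  have hn := wp _ _ cu.
  apply/norm_cvg0P.
  have hC : dual_norm (fun w => p (u j) w - p u0 w) * C @[j --> \oo] --> (0 : R).
    by rewrite -(mul0r C); apply: cvgM; [exact: hn|exact: cvg_cst].
  apply: (squeeze_cvgr _ (cvg_cst 0) hC).
  apply: filterE => j; rewrite normr_ge0/=.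
  have dj := in_dualBfun (dp (u j)) (dp u0).
  apply: le_trans (dual_norm_ub (v j - u0) dj) _.
  by rewrite ler_wpM2l// dual_norm_ge0.
rewrite (_ : (fun j => _) = (fun j => (p (u j) (v j - u0) - p u0 (v j - u0)) + p u0 (v j - u0))); last first.
  by apply/funext => j; rewrite subrK.
by rewrite -[X in _ --> X]addr0; exact: cvgD h2 h1.
Qed.

(** The intermediate points of the mean value theorem lie on the segments from [u0] to [u j], so
    they too converge weakly to [u0]. *)
Lemma weak_cvg_potential (p : W -> W -> R) (u : nat -> W) (u0 : W) (C : R) :
  potential_operator p -> weak_to_strong p -> weak_cvg u u0 ->
  (forall j, `|u j| <= C) -> potential p (u j) @[j --> \oo] --> potential p u0.
Proof.
move=> hp wp cu uC.
have [x hx] := choice (fun j => proj1 (exists2P _ _) (potential_MVT u0 (u j) hp)).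
have cz : weak_cvg (fun j => u0 + x j *: (u j - u0)) u0.
  move=> phi dphi; apply/cvgrPdist_lt => e e0.
  have /cvgrPdist_lt/(_ _ e0) := cu _ dphi; apply: filterS => j hj.
  rewrite (in_dualD _ _ dphi) (in_dualZ _ _ dphi) (in_dualB _ _ dphi).
  rewrite opprD addrA subrr sub0r normrN normrM distrC (le_lt_trans _ hj)//.
  have [/andP[x0 x1] _] := hx j.
  by rewrite -[leRHS]mul1r ler_wpM2r// ger0_norm ltW.
have h := weak_cvg_dual_cvg (C := C + `|u0|) hp wp cz cu _.
have {}h : p (u0 + x j *: (u j - u0)) (u j - u0) @[j --> \oo] --> (0 : R).
  by apply: h => j; apply: le_trans (ler_normB _ _) _; rewrite lerD2r.
rewrite (_ : (fun j => _) =
    (fun j => p (u0 + x j *: (u j - u0)) (u j - u0) + potential p u0)); last first.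
  by apply/funext => j; have [_ <-] := hx j; rewrite subrK.
by rewrite -[X in _ --> X]add0r; apply: cvgD h _; exact: cvg_cst.
Qed.

Lemma fw_J_weak (u : nat -> W) u0 C : weak_cvg u u0 -> (forall j, `|u j| <= C) ->
  J (u j) @[j --> \oo] --> J u0.
Proof.
by move=> h1 h2; apply: (weak_cvg_potential fw_B _ h1 h2); exact: sf_B_compact hframe.
Qed.

Lemma fw_F_weak (u : nat -> W) u0 C : weak_cvg u u0 -> (forall j, `|u j| <= C) ->
  F (u j) @[j --> \oo] --> F u0.
Proof.
by move=> h1 h2; apply: (weak_cvg_potential fw_f _ h1 h2); exact: sf_f_compact hframe.
Qed.

Lemma fw_subsequence (u : nat -> W) C : (forall j, `|u j| <= C) ->
  exists sigma : nat -> nat, (forall m n, (m < n)%N -> (sigma m < sigma n)%N) /\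
  exists u0, [/\ weak_cvg (u \o sigma) u0, J (u (sigma j)) @[j --> \oo] --> J u0 &
     F (u (sigma j)) @[j --> \oo] --> F u0].
Proof.
move=> uC.
have [sigma [hs [u0 hu0]]] := weak_sequential_compactness (sf_reflexive hframe) uC.
exists sigma; split=> //; exists u0; split=> //.
  by apply: (@fw_J_weak (u \o sigma) _ C) => // j; exact: uC.
by apply: (@fw_F_weak (u \o sigma) _ C) => // j; exact: uC.
Qed.

Lemma exists_seq_natinv (P : R -> W -> Prop) :
  (forall e : R, 0 < e -> exists u, P e u) -> exists u : nat -> W, forall j, P j.+1%:R^-1 (u j).
Proof.
move=> h; have h' (j : nat) : exists u, P j.+1%:R^-1 u.
  by apply: h; rewrite invr_gt0 ltr0n.
by have [u hu] := choice h'; exists u.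
Qed.

Lemma cvg_natinv : (j.+1%:R^-1 : R) @[j --> \oo] --> (0 : R).
Proof. exact: cvg_harmonic. Qed.

Lemma unit_level_bounded : exists C : R, forall w, unit_level A w -> `|w| <= C.
Proof.
have [rho hrho] := sf_A_coercive hframe 2; exists rho => w w1.
rewrite leNgt; apply/negP => /ltW /hrho; rewrite [potential A w]w1.
by lra.
Qed.

Lemma unit_level_neq0 w : unit_level A w -> w != 0.
Proof.
move=> w1; apply/eqP => w0; move: w1; rewrite /unit_level/= w0 (potential0 fw_A).
by move/eqP; rewrite eq_sym oner_eq0.
Qed.

Lemma to_unit_level u : u != 0 -> exists2 t, 0 < t & unit_level A (sc u t).
Proof.
move=> u0; have I0 := fw_I_gt0 u0.
exists (I u `^ (- s^-1)); first exact: powR_gt0.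
rewrite /unit_level/= fw_I_scaling ?powR_ge0// -powRrM mulNr mulVf ?gt_eqF ?fw_s0//.
by rewrite powR_inv1 ?ltW// mulVf ?gt_eqF.
Qed.

Lemma bounded_J_le C : exists2 j2 : R, 0 < j2 & forall u, `|u| <= C -> J u <= j2.
Proof.
apply: contrapT => hn.
have [|u hu] := exists_seq_natinv (P := fun e u => `|u| <= C /\ e^-1 < J u).
  move=> e e0; apply: contrapT => /forallNP h; apply: hn.
  exists e^-1; first by rewrite invr_gt0.
  by move=> u uC; rewrite leNgt; apply/negP => ?; apply: (h u).
have [|sigma [hs [u0 [_ cJ _]]]] := @fw_subsequence u C; first by move=> j; have [] := hu j.
have h1 : \forall j \near \oo, J (u (sigma j)) < J u0 + 1.
  by apply: (cvgr_lt _ cJ); rewrite ltrDl.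
have h2 : \forall j \near \oo, J u0 + 1 < j.+1%:R.
  have := nbhs_infty_gtr (J u0 + 1); apply: filterS => j h.
  by apply: lt_le_trans h _; rewrite ler_nat.
have [j [h3 h4]] := filter_ex (filterI h1 h2).
have [_] := hu (sigma j); rewrite invrK => h5.
have : (j.+1%:R : R) <= (sigma j).+1%:R by rewrite ler_nat ltnS increasing_ge.
by lra.
Qed.

(** If [J] tended to 0 along a bounded sequence, a weak limit would have [J = 0], hence be 0, while
    weak continuity keeps [F] at least [a] there. *)
Lemma level_J_ge C a : 0 < a -> exists2 j1 : R, 0 < j1 & forall u, `|u| <= C -> a <= F u -> j1 <= J u.
Proof.
move=> a0; apply: contrapT => hn.
have [|u hu] := exists_seq_natinv (P := fun e u => [/\ `|u| <= C, a <= F u & J u < e]).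
  move=> e e0; apply: contrapT => /forallNP h; apply: hn.
  exists e => // u uC Fu; rewrite leNgt; apply/negP => ?; apply: (h u).
  by split.
have [|sigma [hs [u0 [_ cJ cF]]]] := @fw_subsequence u C; first by move=> j; have [] := hu j.
have Fu0 : a <= F u0.
  apply: (closed_cvg (fun t : R => a <= t) _ _ _ cF); first exact: closed_ge.
  by apply: filterE => j; have [] := hu (sigma j).
have Ju0 : J u0 = 0.
  have c : J (u (sigma j)) @[j --> \oo] --> (0 : R).
    have c0 := cvg_comp _ _ (increasing_cvg hs) cvg_natinv.
    apply: (squeeze_cvgr _ (cvg_cst 0) c0); apply: filterE => j /=.
    have [_ Fj Jj] := hu (sigma j); rewrite (ltW Jj) andbT ltW//.
    apply: fw_J_gt0; apply/eqP => u00; move: Fj; rewrite u00 (potential0 fw_f).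
    by rewrite leNgt a0.
  exact: (cvg_unique _ cJ c).
by move: Fu0; rewrite (fw_J_eq0 Ju0) (potential0 fw_f) leNgt a0.
Qed.

(** Along an unbounded family the factors [t] scaling it to the unit level would tend to 0. Then [F]
    of the rescaled points is asymptotically at most 0, so they tend weakly to 0 and [J] tends to 0,
    against [1 = I <= L J + th t^s]. *)
Lemma sublevel_bounded (L th a : R) : exists C : R, forall u, F u <= a -> u != 0 ->
  I u <= L * J u + th -> `|u| <= C.
Proof.
have [C hC] := unit_level_bounded.
suff [tau0 tau00 htau] : exists2 tau0 : R, 0 < tau0 & forall u t, F u <= a -> u != 0 ->
    I u <= L * J u + th -> 0 < t -> unit_level A (sc u t) -> tau0 <= t.
  have hb := scaling_bounded fw_scaling (tau0^-1) (bounded_setI hC).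
  have [C' hC'] := bounded_setE hb; exists C' => u Fu u0 Iu.
  have [t t0 ut] := to_unit_level u0; apply: hC'.
  exists (sc u t) => //; exists t^-1; last by rewrite (scalingK fw_scaling).
  by rewrite /= invr_ge0 (ltW t0)/= lef_pV2 ?posrE//; exact: htau ut.
apply: contrapT => hn.
(* The absolute values make the bounds monotone in [e] whatever the signs of [a] and [th]. *)
have [|w hw] := exists_seq_natinv (P := fun e w => [/\ unit_level A w, F w <= `|e `^ q * a| &
   1 <= L * J w + `|th * e `^ s|]).
  move=> e e0; apply: contrapT => /forallNP h; apply: hn; exists e => // u t Fu u0 Iu t0 ut.
  rewrite leNgt; apply/negP => te; apply: (h (sc u t)); split => //.
    rewrite fw_F_scaling ?(ltW t0)//.
    apply: le_trans (ler_wpM2l (powR_ge0 _ _) Fu) _; apply: le_trans (ler_norm _) _.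
    rewrite !normrM ler_wpM2r// !ger0_norm ?powR_ge0// ge0_ler_powR ?nnegrE ?ltW//.
    exact: fw_q0.
  rewrite -[leLHS]ut fw_I_scaling ?(ltW t0)// fw_J_scaling ?(ltW t0)//.
  apply: (@le_trans _ _ (t `^ s * (L * J u + th))); first by rewrite ler_wpM2l ?powR_ge0.
  rewrite mulrDr mulrCA lerD2l; apply: le_trans (ler_norm _) _.
  rewrite mulrC !normrM ler_wpM2l// !ger0_norm ?powR_ge0// ge0_ler_powR ?nnegrE ?ltW//.
  exact: fw_s0.
have [|sigma [hs [w0 [_ cJ cF]]]] := @fw_subsequence w C.
  by move=> j; have [/hC] := hw j.
have cpow (b : R) : 0 < b -> ((sigma j).+1%:R^-1 : R) `^ b @[j --> \oo] --> (0 : R).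
  move=> b0; have c0 := cvg_comp _ _ (increasing_cvg hs) cvg_natinv.
  apply/cvgrPdist_lt => e e0.
  have eb : 0 < e `^ b^-1 by exact: powR_gt0.
  have /cvgrPdist_lt/(_ _ eb) := c0; apply: filterS => j /=.
  rewrite sub0r normrN ger0_norm ?invr_ge0// => hj.
  rewrite sub0r normrN ger0_norm ?powR_ge0//.
  have -> : e = (e `^ b^-1) `^ b by rewrite -powRrM mulVf ?gt_eqF// powRr1// ltW.
  by rewrite gt0_ltr_powR// ?nnegrE ?invr_ge0 ?powR_ge0.
have Fw0 : F w0 <= 0.
  have c : `|(sigma j).+1%:R^-1 `^ q * a| - F (w (sigma j)) @[j --> \oo] --> `|0 * a| - F w0.
    apply: cvgB => //; apply: cvg_norm; apply: cvgM; last exact: cvg_cst.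
    exact: cpow fw_q0.
  rewrite mul0r normr0 sub0r in c; rewrite -oppr_ge0.
  apply: (closed_cvg (fun t : R => 0 <= t) _ _ _ c); first exact: closed_ge.
  by apply: filterE => j; rewrite subr_ge0; have [] := hw (sigma j).
have w00 : w0 = 0.
  by apply/eqP; apply: contraTT Fw0 => /hF; rewrite -ltNge.
have c : L * J (w (sigma j)) + `|th * (sigma j).+1%:R^-1 `^ s| @[j --> \oo] --> L * J w0 + `|th * 0|.
  apply: cvgD; first by apply: cvgM => //; exact: cvg_cst.
  by apply: cvg_norm; apply: cvgM; [exact: cvg_cst|exact: cpow fw_s0].
rewrite w00 (potential0 fw_B) !mulr0 normr0 addr0 in c.
have : (1 : R) <= 0.
  apply: (closed_cvg (fun t : R => 1 <= t) _ _ _ c); first exact: closed_ge.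
  by apply: filterE => j; have [] := hw (sigma j).
by rewrite ler10.
Qed.

(** Otherwise one picks [u_j] in [E] with [B (u_j) (u_i) = 0] for all [i < j]. A weak limit [u0]
    then annihilates the subsequence, so [B u0 u0 = 0] and [u0 = 0], although [J u0 >= j1]. *)
Lemma finite_separation (E : set W) (C j1 : R) : 0 < j1 ->
  (forall u, E u -> `|u| <= C /\ j1 <= J u) ->
  exists (n : nat) (v : nat -> W), forall u, E u -> exists2 i, (i < n)%N & B u (v i) != 0.
Proof.
move=> j10 hE; apply: contrapT => hn.
have [dB _ _] := fw_B.
have h (l : seq W) : exists u, E u /\ forall v, v \in l -> B u v = 0.
  apply: contrapT => /forallNP hl; apply: hn; exists (size l), (fun i => nth 0 l i) => u Eu.
  apply: contrapT => hi; apply: (hl u); split=> // v vl.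
  apply/eqP; apply: contrapT => /negP Bv; apply: hi; exists (index v l).
    by rewrite index_mem.
  by rewrite nth_index.
have [st hst] := choice h.
pose l := fix l (j : nat) : seq W := if j is i.+1 then st (l i) :: l i else [::].
pose u j := st (l j).
have uE j : E (u j) by exact: (hst _).1.
have uB i j : (i < j)%N -> B (u j) (u i) = 0.
  move=> ij; apply: (hst (l j)).2; elim: j ij => // j IH; rewrite ltnS leq_eqVlt.
  move=> /orP[/eqP ->|/IH h']; first by rewrite /= mem_head.
  by rewrite /= in_cons h' orbT.
have [|sigma [hs [u0 [cw cJ _]]]] := @fw_subsequence u C.
  by move=> j; exact: (hE _ (uE j)).1.
have Bu0 i : B u0 (u (sigma i)) = 0.
  have hn' := sf_B_compact hframe cw.
  have c : B (u (sigma j)) (u (sigma i)) - B u0 (u (sigma i)) @[j --> \oo] --> (0 : R).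
    apply/norm_cvg0P.
    have hC : dual_norm (fun w => B (u (sigma j)) w - B u0 w) * `|u (sigma i)| @[j --> \oo] --> (0 : R).
      by rewrite -(mul0r `|u (sigma i)|); apply: cvgM; [exact: hn'|exact: cvg_cst].
    apply: (squeeze_cvgr _ (cvg_cst 0) hC); apply: filterE => j; rewrite normr_ge0/=.
    exact: (dual_norm_ub _ (in_dualBfun (dB _) (dB _))).
  have c' : B (u (sigma j)) (u (sigma i)) - B u0 (u (sigma i)) @[j --> \oo] --> 0 - B u0 (u (sigma i)).
    apply: cvgB; last exact: cvg_cst.
    apply/cvgrPdist_lt => e e0; exists i.+1 => // j /= ij.
    by rewrite uB ?subrr ?normr0//; exact: hs.
  have e : 0 = 0 - B u0 (u (sigma i)) := cvg_unique (@norm_hausdorff _ _) c c'.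
  by apply/eqP; rewrite -oppr_eq0 -[X in X == _]sub0r -e.
have Bu00 : B u0 u0 = 0.
  have c := cw _ (dB u0).
  have c' : (B u0 \o (u \o sigma)) j @[j --> \oo] --> (0 : R).
    rewrite (_ : (fun j => _) = fun=> 0); first exact: cvg_cst.
    by apply/funext => j; exact: Bu0.
  exact: (cvg_unique _ c c').
have u00 : u0 = 0.
  by apply/eqP; apply: contraTT (lexx (0 : R)) => /(sf_B_gt0 hframe); rewrite Bu00 ltxx.
have : j1 <= J u0.
  apply: (closed_cvg (fun t : R => j1 <= t) _ _ _ cJ); first exact: closed_ge.
  by apply: filterE => j; exact: (hE _ (uE _)).2.
by rewrite u00 (potential0 fw_B) leNgt j10.
Qed.

End FrameworkFacts.

(** * Minimax levels *)

Section OddMaps.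
Context {R : realType} {W : normedModType R}.
Local Notation S := (@Sinfty R).

Lemma set_val_continuous (M : set W) : continuous (fun x : M => \val x : W).
Proof. exact: initial_continuous. Qed.

Lemma row_cvg (T : Type) (FF : set_system T) n (x : T -> 'rV[R]_n) (y : 'rV[R]_n) :
  Filter FF -> (forall i, x t 0 i @[t --> FF] --> y 0 i) -> x @ FF --> y.
Proof.
move=> hFF h U /nbhs_ballP[e /= e0 eU].
have h' : FF [set t | forall i, `|y 0 i - x t 0 i| < e].
  by apply: filter_forall => i; move: (h i) => /cvgrPdist_lt/(_ _ e0).
rewrite /= nbhs_simpl /=; apply: (filterS _ h') => t ht; apply: eU; split=> // i j.
by rewrite (ord1 i); exact: ht.
Qed.

Lemma odd_map_to_sphere (M : set W) n (phi : nat -> W -> R) :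
  (forall i u, M u -> {for u, continuous (phi i)}) ->
  (forall i u, phi i (- u) = - phi i u) ->
  (forall u, M u -> exists2 i, (i < n)%N & phi i u != 0) ->
  exists2 h : M -> S, continuous h & odd_map h.
Proof.
move=> cphi ophi phi0.
pose N u := Num.sqrt (\sum_(i < n) phi i u ^+ 2).
have N0 u : M u -> 0 < \sum_(i < n) phi i u ^+ 2.
  move=> /phi0[i lin p0]; rewrite (bigD1 (Ordinal lin))//=.
  by rewrite ltr_pwDl ?exprn_even_gt0// sumr_ge0// => j _; exact: sqr_ge0.
pose row u : 'rV[R]_n := \row_i (phi i u / N u).
have rowS u : M u -> S (rVpoly (row u)).
  move=> Mu; apply/rVpoly_psphere; have h := N0 _ Mu.
  under eq_bigr do rewrite mxE expr_div_n /N (sqr_sqrtr (ltW h)).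
  by rewrite -mulr_suml divff ?gt_eqF.
have rowN u : row (- u) = - row u.
  apply/rowP => i; rewrite !mxE ophi mulNr /N.
  by congr (- (_ / Num.sqrt _)); apply: eq_bigr => j _; rewrite ophi sqrrN.
have row_cont u : M u -> {for u, continuous row}.
  move=> Mu; apply: row_cvg => i; rewrite !mxE.
  under eq_fun do rewrite mxE.
  apply: cvgM; first exact: cphi.
  apply: cvgV; first by rewrite gt_eqF// sqrtr_gt0 N0.
  apply: (@continuous_comp _ _ _ (fun u => \sum_(i < n) phi i u ^+ 2) Num.sqrt).
    apply: (cvg_big (op := +%R)) => [|j _]; first exact: add_continuous.
    apply: (@continuous_comp _ _ _ (phi j) (fun y : R => y ^+ 2)); first exact: cphi.
    exact: exprn_continuous.
  exact: sqrt_continuous.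
exists (fun x : M => spt (rVpoly (row (\val x)))) => [x U /nbhs_Sinfty[Q [oQ Qx] QU]|x y e].
  have Mx : M (\val x) by exact: set_mem (valP x).
  rewrite val_spt in Qx; last exact: rowS.
  rewrite Rinfty_openE in oQ; have oQn := oQ n.
  have h1 : nbhs (row (\val x)) ((fun x : 'rV[R]_n => rVpoly x : Rinfty R) @^-1` Q).
    by apply: open_nbhs_nbhs; split.
  have h2 := row_cont _ Mx _ h1.
  have h3 : nbhs x [set y : M | Q (rVpoly (row (\val y)))] := @set_val_continuous M x _ h2.
  rewrite /= nbhs_simpl /=; apply: (filterS _ h3) => y Qy.
  by apply: QU => //; apply: rowS; exact: set_mem (valP y).
rewrite !val_spt; first by rewrite e rowN raddfN.
  by apply: rowS; exact: set_mem (valP x).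
by apply: rowS; exact: set_mem (valP y).
Qed.

Lemma opp_cont : continuous (-%R : W -> W).
Proof. exact: opp_continuous. Qed.

(** The functionals [phi] separate the image from 0 and so furnish the odd map to the sphere that
    monotonicity requires on its target. *)
Lemma fr_index_image (M : set W) (h : W -> W) k n (phi : nat -> W -> R) : (0 < k)%N ->
  symmetric_set M -> (k%:R%:E <= (fr_index M : \bar R))%E ->
  (forall u, M u -> {for u, continuous h}) -> (forall u, h (- u) = - h u) ->
  (forall i u, M u -> {for h u, continuous (phi i)}) ->
  (forall i u, phi i (- u) = - phi i u) ->
  (forall u, M u -> exists2 i, (i < n)%N & phi i (h u) != 0) ->
  symmetric_set (h @` M) /\ (k%:R%:E <= (fr_index (h @` M) : \bar R))%E.
Proof.
move=> k0 sM kM ch oh cphi ophi phi0; split.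
  by move=> _ [u Mu <-]; exists (- u); [exact: sM|exact: oh].
have [f cf of_] : exists2 f : (h @` M) -> S, continuous f & odd_map f.
  apply: (@odd_map_to_sphere _ n phi) => // [i _ [u Mu <-]|_ [u Mu <-]]; first exact: cphi.
  exact: phi0.
have hM (x : M) : (h @` M) (h (\val x)) by exists (\val x) => //; exact: set_mem (valP x).
apply: (@fr_index_mono _ _ _ M (h @` M) opp_cont sM (fun x => SigSub (mem_set (hM x))) f) => //.
  apply: continuous_comp_initial => x.
  have Mx : M (\val x) by exact: set_mem (valP x).
  apply: (@continuous_comp _ _ _ (fun x : M => \val x : W) h); last exact: ch.
  exact: set_val_continuous.
by move=> x y e; rewrite /= e oh.
Qed.

Lemma fr_index_separated (M : set W) n (phi : nat -> W -> R) : symmetric_set M ->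
  (forall i u, M u -> {for u, continuous (phi i)}) ->
  (forall i u, phi i (- u) = - phi i u) ->
  (forall u, M u -> exists2 i, (i < n)%N & phi i u != 0) ->
  forall k, (k%:R%:E <= (fr_index M : \bar R))%E -> (k <= n)%N.
Proof.
move=> sM cphi ophi phi0.
apply: (@fr_index_le _ _ M opp_cont sM n (fun i (x : M) => phi i (\val x))).
- move=> i x; apply: (@continuous_comp _ _ _ (fun x : M => \val x : W) (phi i)).
    exact: set_val_continuous.
  by apply: cphi; exact: set_mem (valP x).
- by move=> i x y ->.
- by move=> x; apply: phi0; exact: set_mem (valP x).
Qed.

End OddMaps.

Section Minimax.
Context {R : realType} {V : PreTopologicalZmodule.type}.
Implicit Types (N M : set V) (phi : V -> R).

Definition admissible N k M :=
  [/\ M `<=` N, symmetric_set M & (k%:R%:E <= (fr_index M : \bar R))%E].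

Lemma admissible_nonempty N k M : (0 < k)%N -> admissible N k M -> M !=set0.
Proof. by move=> k0 [_ _ /fr_index_geP[]]. Qed.

Lemma minimax_le N phi k M (x : R) : admissible N k M -> (forall u, M u -> phi u <= x) ->
  (minimax N phi k <= x%:E)%E.
Proof.
move=> aM h; apply: (@le_trans _ _ (ereal_sup [set (phi u)%:E | u in M])).
  by apply: ereal_inf_lbound => /=; exists M.
by apply: ge_ereal_sup => _ [u Mu <-]; rewrite lee_fin; exact: h.
Qed.

Lemma minimax_ge N phi k (x : \bar R) :
  (forall M (y : R), admissible N k M -> (forall u, M u -> phi u <= y) -> (x <= y%:E)%E) ->
  (0 < k)%N -> (x <= minimax N phi k)%E.
Proof.
move=> h k0; apply: le_ereal_inf_tmp => _ [M aM <-].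
have [u0 Mu0] := admissible_nonempty k0 aM.
case e : (ereal_sup _) => [y| |]; first 2 last.
- have : ((phi u0)%:E <= -oo)%E by rewrite -e; apply: ereal_sup_ubound; exists u0.
  by rewrite leeNy_eq.
- apply: (h _ _ aM) => u Mu; rewrite -lee_fin -e; apply: ereal_sup_ubound.
  by exists u.
- by rewrite leey.
Qed.

Lemma minimax_lt N phi k (x : R) : (minimax N phi k < x%:E)%E ->
  exists2 M, admissible N k M & forall u, M u -> phi u < x.
Proof.
move=> /ereal_inf_lt[_ [M aM <-] h]; exists M => // u Mu.
rewrite -lte_fin; apply: le_lt_trans h; apply: ereal_sup_ubound.
by exists u.
Qed.

Lemma minimax_comparison (V' : PreTopologicalZmodule.type) N phi (N' : set V') (phi' : V' -> R) k :
  (0 < k)%N ->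
  (forall M (y : R), admissible N k M -> (forall u, M u -> phi u <= y) ->
     exists2 M' : set V', [/\ M' `<=` N', symmetric_set M' &
       (k%:R%:E <= (fr_index M' : \bar R))%E] & forall u, M' u -> phi' u <= y) ->
  (minimax N' phi' k <= minimax N phi k)%E.
Proof.
move=> k0 h; apply: minimax_ge => // M y aM hy.
have [M' [M'N sM' kM'] hM'] := h _ _ aM hy.
apply: (@le_trans _ _ (ereal_sup [set (phi' u)%:E | u in M'])).
  by apply: ereal_inf_lbound => /=; exists M'.
by apply: ge_ereal_sup => _ [u Mu <-]; rewrite lee_fin; exact: hM'.
Qed.

Lemma minimax_mono N phi k l : (k <= l)%N -> (minimax N phi k <= minimax N phi l)%E.
Proof.
move=> kl; apply: ereal_inf_le_tmp => _ [M [MN sM lM] <-]; exists M => //; split=> //.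
by apply: le_trans lM; rewrite lee_fin ler_nat.
Qed.

End Minimax.

Lemma uniform_cvgB {R : realType} {W : normedModType R} (a b : W -> W -> R) (u : W) :
  (forall e : R, 0 < e -> \forall y \near u, forall v, `|v| <= 1 -> `|a y v - a u v| < e) ->
  (forall e : R, 0 < e -> \forall y \near u, forall v, `|v| <= 1 -> `|b y v - b u v| < e) ->
  forall e : R, 0 < e -> \forall y \near u, forall v, `|v| <= 1 ->
    `|(a y v - b y v) - (a u v - b u v)| < e.
Proof.
move=> ha hb e e0; have e2 : 0 < e / 2 by rewrite divr_gt0.
apply: filterS2 (ha _ e2) (hb _ e2) => y h1 h2 v v1.
have -> : (a y v - b y v) - (a u v - b u v) = (a y v - a u v) - (b y v - b u v) by ring.
rewrite (le_lt_trans (ler_normB _ _))// [ltRHS](splitr e) ltrD//.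
  exact: h1.
exact: h2.
Qed.

Lemma uniform_cvgM {R : realType} {W : completeNormedModType R} (a : W -> R) (b : W -> W -> R) (u : W) :
  {for u, continuous a} -> in_dual (b u) ->
  (forall e : R, 0 < e -> \forall y \near u, forall v, `|v| <= 1 -> `|b y v - b u v| < e) ->
  forall e : R, 0 < e -> \forall y \near u, forall v, `|v| <= 1 ->
    `|a y * b y v - a u * b u v| < e.
Proof.
move=> ca db hb e e0; have [K K0 hK] := in_dual_bounded db.
pose k := K + `|a u| + 1; have k0 : 0 < k by rewrite /k; have := normr_ge0 (a u); lra.
pose m := Num.min 1 (e / (2 * k)).
have m0 : 0 < m by rewrite lt_min ltr01/= divr_gt0// mulr_gt0.
have h1 : \forall y \near u, `|a u - a y| < m by move/cvgrPdist_lt/(_ _ m0): ca.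
apply: filterS2 h1 (hb _ m0) => y h1 h2 v v1.
have h3 := h2 _ v1; have h4 : `|b u v| <= K.
  by apply: le_trans (hK v) _; rewrite -[leRHS]mulr1 ler_wpM2l.
have -> : a y * b y v - a u * b u v =
   - ((a u - a y) * b u v) + (a u - (a u - a y)) * (b y v - b u v) by ring.
apply: (@le_lt_trans _ _ (m * K + (`|a u| + 1) * m)).
  apply: le_trans (ler_normD _ _) _; apply: lerD.
    by rewrite normrN normrM ler_pM// ltW.
  rewrite normrM ler_pM//; last exact: ltW.
  apply: le_trans (ler_normB _ _) _; rewrite lerD2l; apply: le_trans (ltW h1) _.
  by rewrite ge_min lexx.
have -> : m * K + (`|a u| + 1) * m = m * k by rewrite /k; ring.
apply: (@le_lt_trans _ _ (e / (2 * k) * k)).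
  by rewrite ler_wpM2r ?(ltW k0)// ge_min lexx orbT.
have -> : e / (2 * k) * k = e / 2 by field; rewrite gt_eqF.
by rewrite ltr_pdivrMr// ltr_pMr// ltrDl.
Qed.

(** * The Nehari set and the gradient of [lambda_fun] *)

Section Nehari.
Context {R : realType} {W : completeNormedModType R}.
Variables (sc : W -> R -> W) (s q r : R) (A B f g : W -> W -> R).
Hypothesis hframe : scaled_framework sc s q r A B f g.
Hypothesis hF : forall u : W, u != 0 -> 0 < potential f u.
Hypothesis hG : forall u : W, u != 0 -> potential g u = 0.

Local Notation I := (potential A).
Local Notation J := (potential B).
Local Notation F := (potential f).
Local Notation lambda := (lambda_fun A B f g).

(** The quotient rule, arranged to show the derivative of the energy with parameter [lambda c u],
    divided by [J u]. *)
Definition lambda_grad (c : R) (u v : W) : R := (A u v - f u v - lambda c u * B u v) / J u.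
Definition nehari_level (c : R) : R := - c * s / (s - q).
Definition nehari_proj (c : R) (u : W) : W := sc u ((nehari_level c / F u) `^ q^-1).

Let s0 : 0 < s := fw_s0 hframe.
Let q0 : 0 < q := fw_q0 hframe.
Let sq0 : 0 < s - q. Proof. by rewrite subr_gt0 (fw_qs hframe). Qed.

Let conj_exponents : (s / q)^-1 + (s / (s - q))^-1 = 1.
Proof. by rewrite !invf_div -mulrDl subrKC divff// gt_eqF. Qed.

Lemma lambda_funE c u : lambda c u = (I u - F u - c) / J u.
Proof. by rewrite /lambda_fun (fw_G hframe hG) subr0. Qed.

Lemma lambda_even c u : lambda c (- u) = lambda c u.
Proof. by rewrite !lambda_funE (fw_I_even hframe) (fw_J_even hframe) (fw_F_even hframe). Qed.

Lemma lambda_scaling c u t : u != 0 -> 0 < t ->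
  lambda c (sc u t) = I u / J u - (t `^ (q - s) * F u + c * t `^ (- s)) / J u.
Proof.
move=> u0 t0; have t0' := ltW t0; have J0 := fw_J_gt0 hframe u0.
rewrite lambda_funE (fw_I_scaling hframe)// (fw_J_scaling hframe)// (fw_F_scaling hframe)//.
rewrite powRN powRB; last by rewrite (gt_eqF t0) implybT.
have ts : t `^ s != 0 by rewrite gt_eqF// powR_gt0.
by field; rewrite ts gt_eqF.
Qed.

Lemma nehari_level_gt0 c : c < 0 -> 0 < nehari_level c.
Proof. by move=> c0; rewrite divr_gt0// mulr_gt0// oppr_gt0. Qed.

(** Along a ray the derivative is [((s - q) F (u_t) + s c) t^(-s-1) / J u], and only the first
    factor can vanish. *)
Lemma nehariP c w : c < 0 ->
  nehari sc A B f g c w <-> w != 0 /\ F w = nehari_level c.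
Proof.
move=> c0.
have key (u : W) (t : R) : u != 0 -> 0 < t ->
    is_derive t 1 (fun x : R => lambda c (sc u x))
      (((s - q) * F (sc u t) + s * c) * t `^ (- s - 1) / J u).
  move=> u0 t0; have J0 := fw_J_gt0 hframe u0.
  have e : \forall x \near t, I u / J u - (x `^ (q - s) * F u + c * x `^ (- s)) / J u
       = lambda c (sc u x).
    by near=> x; rewrite lambda_scaling//; near: x; exact: lt_nbhsr.
  apply: (near_eq_is_derive e).
  have d1 := is_derive1_powR (q - s) t0.
  have d2 := is_derive1_powR (- s) t0.
  have d := is_deriveB (is_derive_cst (I u / J u) t 1)
    (is_deriveZ ((J u)^-1) (is_deriveD (is_deriveZ (F u) d1) (is_deriveZ c d2))).
  rewrite (_ : (fun x : R => _) = cst (I u / J u) -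
    (J u)^-1 \*: (F u \*: (fun x : R => x `^ (q - s)) + c \*: (fun x : R => x `^ (- s)))).
    apply: is_derive_eq d _; rewrite (fw_F_scaling hframe) ?(ltW t0)//.
    rewrite [LHS]add0r /GRing.scale /=.
    have -> : t `^ (q - s - 1) = t `^ q * t `^ (- s - 1).
      by rewrite -powRD ?(gt_eqF t0) ?implybT//; congr (_ `^ _); ring.
    by field; rewrite gt_eqF.
  apply/funext => x; transitivity (I u / J u - (J u)^-1 * (F u * x `^ (q - s) + c * x `^ (- s))).
    by ring.
  by [].
split=> [[u [t [/(unit_level_neq0 hframe) u0 t0 d ->]]]|[w0 Fw]].
  split; first exact: (scaling_neq0 (fw_scaling hframe)).
  have J0 := fw_J_gt0 hframe u0.
  have [_ e1] := d; have [_ e2] := key _ _ u0 t0; move: e2; rewrite e1 => /eqP.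
  rewrite eq_sym !mulf_eq0 invr_eq0 (gt_eqF J0) orbF (gt_eqF (powR_gt0 _ t0)) orbF.
  move=> /eqP h; rewrite /nehari_level -[LHS](mulfK (lt0r_neq0 sq0)); congr (_ / _).
  by move: h; set x := F _; lra.
have [t t0 ut] := to_unit_level hframe w0.
exists (sc w t), t^-1; split=> //; first by rewrite invr_gt0.
  have d := key (sc w t) t^-1 (unit_level_neq0 hframe ut); rewrite invr_gt0 in d.
  apply: is_derive_eq (d t0) _; rewrite (scalingK (fw_scaling hframe))// Fw /nehari_level.
  have -> : (s - q) * (- c * s / (s - q)) + s * c = 0 by field; rewrite gt_eqF.
  by rewrite !mul0r.
by rewrite (scalingK (fw_scaling hframe)).
Unshelve. all: by end_near.
Qed.

Lemma nehari_proj_F c u : c < 0 -> u != 0 -> F (nehari_proj c u) = nehari_level c.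
Proof.
move=> c0 u0; have F0 := hF u0; have N0 := nehari_level_gt0 c0.
rewrite /nehari_proj (fw_F_scaling hframe) ?powR_ge0// -powRrM mulVf ?gt_eqF//.
by rewrite powRr1 ?divfK ?gt_eqF// ltW// divr_gt0.
Qed.

Lemma nehari_proj_neq0 c u : c < 0 -> u != 0 -> nehari_proj c u != 0.
Proof.
move=> c0 u0; apply: (scaling_neq0 (fw_scaling hframe)) => //.
by apply: powR_gt0; rewrite divr_gt0 ?hF// nehari_level_gt0.
Qed.

Lemma nehari_proj_odd c u : nehari_proj c (- u) = - nehari_proj c u.
Proof.
by rewrite /nehari_proj (fw_F_even hframe) (scalingN (fw_scaling hframe))// powR_ge0.
Qed.

Lemma nehari_proj_cont c u : c < 0 -> u != 0 -> {for u, continuous (nehari_proj c)}.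
Proof.
move=> c0 u0; have x0 : 0 < nehari_level c / F u by rewrite divr_gt0 ?hF ?nehari_level_gt0.
apply: (scaling_cont (fw_scaling hframe)); first exact: powR_gt0.
  exact: cvg_id.
apply: (@continuous_comp _ _ _ (fun u => nehari_level c / F u) (fun x : R => x `^ q^-1)).
  apply: cvgM; first exact: cvg_cst.
  by apply: cvgV; [rewrite gt_eqF ?hF|exact: (potential_cont (fw_f hframe))].
exact: powR_cont.
Qed.

Lemma nehari_proj_le c u : c < 0 -> u != 0 -> lambda c (nehari_proj c u) <= lambda c u.
Proof.
move=> c0 u0; have F0 := hF u0; have N0 := nehari_level_gt0 c0; have J0 := fw_J_gt0 hframe u0.
have := nehari_proj_F c0 u0; rewrite /nehari_proj.
set t := _ `^ _; have t0 : 0 < t by apply: powR_gt0; rewrite divr_gt0.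
rewrite (fw_F_scaling hframe) ?(ltW t0)// => e; rewrite lambda_scaling// lambda_funE.
have -> : (I u - F u - c) / J u = I u / J u - (F u + c) / J u by field; rewrite gt_eqF.
rewrite lerD2l lerN2 ler_pM2r ?invr_gt0//.
have tq0 : 0 < t `^ q by exact: powR_gt0.
have cE : c = - (t `^ q * F u * (s - q) / s).
  by rewrite e /nehari_level; field; rewrite !gt_eqF.
(* Young's inequality for [t^(-q)] and 1 with the conjugate exponents [s / q] and [s / (s - q)]. *)
have Y : t `^ (- q) <= t `^ (- s) * (q / s) + (s - q) / s.
  have sq : 0 < s / q by rewrite divr_gt0.
  have sq' : 0 < s / (s - q) by rewrite divr_gt0.
  have one (x : R) : (1 : R) `^ x = 1 by rewrite powR1.
  have e1 : (t `^ (- q)) `^ (s / q) = t `^ (- s).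
    by rewrite -powRrM; congr (_ `^ _); field; rewrite gt_eqF.
  have simp (a b d x : R) : b = d -> x = 1 -> a * 1 <= b / (s / q) + x / (s / (s - q)) ->
      a <= d * (q / s) + (s - q) / s.
    by move=> -> ->; rewrite mulr1 mul1r !invf_div.
  apply: (simp _ _ _ _ e1 (one (s / (s - q)))).
  exact: (conjugate_powR (powR_ge0 t (- q)) ler01 sq sq' conj_exponents).
have tE : t `^ (- q) * t `^ q = 1 by rewrite powRN mulVf// gt_eqF.
have -> : t `^ (q - s) = t `^ q * t `^ (- s) by rewrite -powRD ?(gt_eqF t0) ?implybT.
rewrite {1 2}cE -subr_ge0.
have -> : t `^ q * t `^ (- s) * F u + - (t `^ q * F u * (s - q) / s) * t `^ (- s) -
    (F u + - (t `^ q * F u * (s - q) / s)) =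
  F u * (t `^ q * (t `^ (- s) * (q / s) + (s - q) / s) - 1) by field; rewrite gt_eqF.
by rewrite pmulr_rge0// subr_ge0 -tE mulrC ler_pM2l.
Qed.

Lemma lambda_gradient c u : u != 0 -> gradient (lambda c) u (lambda_grad c u).
Proof.
move=> u0; have J0 := fw_J_gt0 hframe u0.
have [dI gI] := potential_gradient u (fw_A hframe).
have [dF gF] := potential_gradient u (fw_f hframe).
have [dJ gJ] := potential_gradient u (fw_B hframe).
have E : lambda c = (I - F - cst c) * (fun w => (J w)^-1).
  by apply/funext => w; rewrite lambda_funE.
have dN : differentiable (I - F - cst c) u.
  by apply: differentiableB => //; exact: differentiableB.
have dV : differentiable (fun w => (J w)^-1) u by apply: differentiableV => //; rewrite gt_eqF.
have dL : differentiable (lambda c) u by rewrite E; exact: differentiableM.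
split=> [|v]; first exact: dL.
rewrite -(deriveE _ dL) E.
have hI := gradient_is_derive v (potential_gradient u (fw_A hframe)).
have hFd := gradient_is_derive v (potential_gradient u (fw_f hframe)).
have hJ := gradient_is_derive v (potential_gradient u (fw_B hframe)).
have hV : is_derive u v (fun w => (J w)^-1) (- (J u) ^- 2 *: B u v).
  apply: DeriveDef; first exact: diff_derivable.
  have [hd e] := hJ; by rewrite (deriveV (lt0r_neq0 J0) hd) e.
have [_ ->] := is_deriveM (is_deriveB (is_deriveB hI hFd) (is_derive_cst c u v)) hV.
rewrite /lambda_grad lambda_funE; have -> : (I - F - cst c) u = I u - F u - c by [].
have sE (a b : R) : a *: b = a * b by [].
rewrite !sE.
generalize (A u v) (B u v) (f u v) (I u) (F u) => a1 b1 f1 i1 F1.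
by field; rewrite gt_eqF.
Qed.

Lemma lambda_cont c u : u != 0 -> {for u, continuous (lambda c)}.
Proof. by move=> u0; apply: differentiable_continuous; have [] := lambda_gradient c u0. Qed.

Lemma lambda_grad_dual c u : in_dual (lambda_grad c u).
Proof.
have [dA _ _] := fw_A hframe; have [dB _ _] := fw_B hframe; have [df _ _] := fw_f hframe.
have h := in_dualDfun (- lambda c u / J u) (dB u) (in_dualDfun ((J u)^-1) (dA u)
  (in_dualDfun (- (J u)^-1) (df u) (in_dualBfun (df u) (df u)))).
rewrite (_ : lambda_grad c u = (fun v => - lambda c u / J u * B u v +
  ((J u)^-1 * A u v + (- (J u)^-1 * f u v + (f u v - f u v)))))//.
by apply/funext => v; rewrite /lambda_grad; ring.
Qed.

Lemma lambda_grad_odd c u v : lambda_grad c (- u) v = - lambda_grad c u v.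
Proof.
have [oA _ _ _] := sf_A hframe; have [oB _ _ _] := sf_B hframe.
have [of_ _] := sf_f hframe.
by rewrite /lambda_grad lambda_even oA oB of_ (fw_J_even hframe); ring.
Qed.

Lemma lambda_grad_cont c u : u != 0 -> forall e : R, 0 < e ->
  \forall y \near u, forall v, `|v| <= 1 -> `|lambda_grad c y v - lambda_grad c u v| < e.
Proof.
move=> u0 e e0; have J0 := fw_J_gt0 hframe u0.
have [dA _ _] := fw_A hframe; have [dB _ _] := fw_B hframe; have [df _ _] := fw_f hframe.
have cA := operator_cont u (fw_A hframe).
have cB := operator_cont u (fw_B hframe).
have cf := operator_cont u (fw_f hframe).
have cl : {for u, continuous (lambda c)} by exact: lambda_cont.
have cJ : {for u, continuous (fun w => (J w)^-1)}.
  by apply: cvgV; [rewrite gt_eqF|exact: (potential_cont (fw_B hframe))].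
have h1 := uniform_cvgB (uniform_cvgB cA cf) (uniform_cvgM cl (dB u) cB).
have d1 : in_dual (fun v => A u v - f u v - lambda c u * B u v).
  have := in_dualDfun (- lambda c u) (dB u) (in_dualBfun (dA u) (df u)).
  by under eq_fun do rewrite mulNr addrC.
have := uniform_cvgM cJ d1 h1 e0; apply: filterS => y hy v v1.
by rewrite /lambda_grad ![_ / J _]mulrC; exact: hy.
Qed.

End Nehari.

Lemma continuous_compact_ub {R : realType} {T : topologicalType} (K : set T) (g : T -> R) :
  compact K -> (forall x, K x -> {for x, continuous g}) ->
  exists L : R, forall x, K x -> g x <= L.
Proof.
move=> cK cg.
have cw : {within K, continuous g}.
  by apply: continuous_in_subspaceT => x /set_mem Kx; exact: cg.
have [L hL] := bounded_setE (compact_bounded (continuous_compact cw cK)).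
exists L => x Kx; apply: le_trans (ler_norm _) _; apply: hL; by exists x.
Qed.

Lemma pcoef_continuous {R : realType} i : continuous (fun p : Rinfty R => pcoef p i).
Proof.
apply/continuousP => U oU; rewrite Rinfty_openE => n.
have c : continuous (fun x : 'rV[R]_n => pcoef (rVpoly x) i).
  rewrite (_ : (fun x => _) = fun x : 'rV[R]_n => if insub i is Some j then x 0 j else 0).
    case: insub => [j|]; first exact: coord_continuous.
    exact: cst_continuous.
  by apply/funext => x; rewrite /pcoef coef_rVpoly.
by have /continuousP h := c; exact: h.
Qed.

Lemma rVpoly_continuous {R : realType} n : continuous (fun x : 'rV[R]_n => rVpoly x : Rinfty R).
Proof. by apply/continuousP => U; rewrite Rinfty_openE => /(_ n). Qed.

Lemma exists_independent {R : realType} {W : completeNormedModType R} : infinite_dimensional W ->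
  exists e : nat -> W, forall n (a : nat -> R), \sum_(i < n) a i *: e i = 0 ->
    forall i, (i < n)%N -> a i = 0.
Proof.
move=> hdim.
have h (l : seq W) : exists u, forall a : nat -> R, u <> \sum_(i < size l) a i *: nth 0 l i.
  apply: contrapT => /forallNP hl; apply: hdim; exists (size l), (fun i => nth 0 l i) => u.
  have /existsNP[a /contrapT ua] := hl u.
  by exists (fun i => a i).
have [st hst] := choice h.
pose l := fix l (j : nat) : seq W := if j is i.+1 then rcons (l i) (st (l i)) else [::].
have sl j : size (l j) = j by elim: j => //= j IH; rewrite size_rcons IH.
have nl n i : (i < n)%N -> nth 0 (l n) i = st (l i).
  elim: n => // n IH; rewrite ltnS leq_eqVlt /= nth_rcons sl => /orP[/eqP ->|ni].
    by rewrite ltnn eqxx.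
  by rewrite ni IH.
exists (fun j => st (l j)); elim=> [//|n IH] a; rewrite big_ord_recr /= => e i.
have an : a n = 0.
  apply: contrapT => /eqP an0; apply: (hst (l n) (fun i => - (a n)^-1 * a i)).
  rewrite sl; under eq_bigr => j _ do rewrite nl// -scalerA.
  rewrite -scaler_sumr scaleNr; move/eqP: e; rewrite addr_eq0 => /eqP ->.
  by rewrite scalerN opprK scalerA mulVf// scale1r.
rewrite ltnS leq_eqVlt => /orP[/eqP -> //|]; apply: IH.
by move: e; rewrite an scale0r addr0.
Qed.

(** * The minimax levels [mu] as functions of [th] *)

Section Levels.
Context {R : realType} {W : completeNormedModType R}.
Variables (sc : W -> R -> W) (s q r : R) (A B f g : W -> W -> R).
Hypothesis hdim : infinite_dimensional W.
Hypothesis hframe : scaled_framework sc s q r A B f g.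
Hypothesis hF : forall u : W, u != 0 -> 0 < potential f u.
Hypothesis hG : forall u : W, u != 0 -> potential g u = 0.

Local Notation I := (potential A).
Local Notation J := (potential B).
Local Notation F := (potential f).
Local Notation lambda := (lambda_fun A B f g).
Local Notation level := (nehari_level s q).
Local Notation proj := (nehari_proj sc s q f).
Local Notation admissible := (@admissible R W).

Let s0 : 0 < s := fw_s0 hframe.
Let q0 : 0 < q := fw_q0 hframe.
Let sq0 : 0 < s - q. Proof. by rewrite subr_gt0 (fw_qs hframe). Qed.
Let kap : R := q / (s - q).
Let kap0 : 0 < kap. Proof. exact: divr_gt0. Qed.
Let neg1 : (-1 : R) < 0. Proof. by rewrite oppr_lt0. Qed.
Let level1 : 0 < level (-1) := nehari_level_gt0 hframe neg1.

Let kdiv (x a b : R) : 0 <= x -> 0 < a -> a <= b -> kap * x / b <= kap * x / a.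
Proof.
move=> x0 a0 ab; apply: ler_wpM2l; first exact: mulr_ge0 (ltW kap0) x0.
by rewrite lef_pV2 ?posrE// (lt_le_trans a0).
Qed.

Definition base : set W := [set v | v != 0 /\ F v = level (-1)].
Definition psi (th : R) (v : W) : R := (I v - q / (s - q) * th) / J v.
Definition mu (th : R) (k : nat) : R := fine (minimax base (psi th) k).

Let J_gt0 v : base v -> 0 < J v. Proof. by move=> [/(fw_J_gt0 hframe)]. Qed.

Lemma psiD th th' v : base v -> psi th' v = psi th v - kap * (th' - th) / J v.
Proof. by move=> /J_gt0 J0; rewrite /psi /kap; field; rewrite !gt_eqF. Qed.

(** One set of bounds serves all [th <= T]. The slope of [psi] in [th] is [- kap / J], so on a
    sublevel set it lies between two negative constants. *)
Lemma psi_sublevel (T L : R) : exists C j1 j2 : R, [/\ 0 < j1, 0 < j2 &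
  forall th v, th <= T -> base v -> psi th v <= L -> [/\ `|v| <= C, j1 <= J v & J v <= j2]].
Proof.
have [C hC] := sublevel_bounded hframe hF L (kap * T) (level (-1)).
have [j1 j10 h1] := level_J_ge hframe C level1.
have [j2 j20 h2] := bounded_J_le hframe C.
exists C, j1, j2; split=> // th v thT vb; have [v0 Fv] := vb.
rewrite /psi ler_pdivrMr ?J_gt0// => h.
have vC : `|v| <= C.
  apply: hC => //; first by rewrite Fv.
  have h' : kap * th <= kap * T by rewrite ler_pM2l.
  by move: h h'; rewrite -/kap; lra.
by split=> //; [apply: h1 => //; rewrite Fv|exact: h2].
Qed.

Lemma operator_sep_cont v u : {for u, continuous (fun u => B u v)}.
Proof.
apply: (@operator_cvg _ _ B W (nbhs u) id u v _ (fw_B hframe)); exact: cvg_id.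
Qed.

Lemma operator_sep_odd v u : B (- u) v = - B u v.
Proof. by have [oB _ _ _] := sf_B hframe. Qed.

Lemma image_index (M : set W) (h : W -> W) k (C j1 : R) : (0 < k)%N ->
  symmetric_set M -> (k%:R%:E <= (fr_index M : \bar R))%E ->
  (forall u, M u -> {for u, continuous h}) -> (forall u, h (- u) = - h u) -> 0 < j1 ->
  (forall u, M u -> `|h u| <= C /\ j1 <= J (h u)) ->
  symmetric_set (h @` M) /\ (k%:R%:E <= (fr_index (h @` M) : \bar R))%E.
Proof.
move=> k0 sM kM ch oh j10 hE.
have [|n [w hw]] := @finite_separation _ _ _ _ _ _ _ _ _ _ hframe (h @` M) C j1 j10.
  by move=> _ [u Mu <-]; exact: hE.
apply: (@fr_index_image _ _ M h k n (fun i u => B u (w i))) => //.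
- by move=> i u _; exact: operator_sep_cont.
- by move=> i u; exact: operator_sep_odd.
- by move=> u Mu; apply: hw; exists u.
Qed.

Lemma base_image (M : set W) (h : W -> W) k (th y : R) : (0 < k)%N ->
  symmetric_set M -> (k%:R%:E <= (fr_index M : \bar R))%E ->
  (forall u, M u -> {for u, continuous h}) -> (forall u, h (- u) = - h u) ->
  (forall u, M u -> base (h u) /\ psi th (h u) <= y) -> admissible base k (h @` M).
Proof.
move=> k0 sM kM ch oh hb; have [C [j1 [j2 [j10 _ hj]]]] := psi_sublevel th y.
have [|sN kN] := @image_index M h k C j1 k0 sM kM ch oh j10 => //.
  by move=> u /hb[bu pu]; have [] := hj _ _ (lexx _) bu pu.
by split=> // _ [u Mu <-]; have [] := hb _ Mu.
Qed.

Lemma base_index_le (th y : R) : exists n, forall M k, admissible base k M ->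
  (forall u, M u -> psi th u <= y) -> (k <= n)%N.
Proof.
have [C [j1 [j2 [j10 _ hj]]]] := psi_sublevel th y.
have [|n [w hw]] := @finite_separation _ _ _ _ _ _ _ _ _ _ hframe
    [set v | base v /\ psi th v <= y] C j1 j10.
  by move=> u [bu pu]; have [] := hj _ _ (lexx _) bu pu.
exists n => M k [Mb sM kM] hM.
apply: (@fr_index_separated _ _ M n (fun i u => B u (w i))) kM => //.
- by move=> i u _; exact: operator_sep_cont.
- by move=> i u; exact: operator_sep_odd.
- by move=> u Mu; apply: hw; split; [exact: Mb|exact: hM].
Qed.

(** Bounds [mu] from above: the unit sphere of a k-dimensional space, projected to the base set, is
    compact and has index at least [k]. *)
Lemma base_admissible k : (0 < k)%N ->
  exists M L, admissible base k M /\ forall v, M v -> psi 0 v <= L.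
Proof.
move=> k0; have [e he] := exists_independent hdim.
pose sum (p : Rinfty R) : W := \sum_(i < k) pcoef p i *: e i.
have sum0 p : psphere k p -> sum p != 0.
  move=> ps; apply/eqP => /he p0; have := (psphereP (proj2 ps)).1 ps.
  rewrite big1 => [/eqP|i _]; first by rewrite eq_sym oner_eq0.
  by rewrite p0// expr0n.
have sum_cont : continuous sum.
  apply: continuous_big => [|i _ p]; first exact: add_continuous.
  apply: (@continuous_comp _ _ _ (fun p => pcoef p i) (fun x : R => x *: e i)).
    exact: pcoef_continuous.
  by apply: cvgZ; [exact: cvg_id|exact: cvg_cst].
have sumN p : sum (- p) = - sum p.
  by rewrite /sum -sumrN; apply: eq_bigr => i _; rewrite pcoefN scaleNr.
pose h p := proj (-1) (sum p).
have hb p : psphere k p -> base (h p).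
  move=> /sum0 p0; split; first exact: (nehari_proj_neq0 hframe).
  exact: (nehari_proj_F hframe).
have h_cont p : psphere k p -> {for p, continuous h}.
  move=> /sum0 p0; apply: (@continuous_comp _ _ _ sum (proj (-1))); first exact: sum_cont.
  exact: (nehari_proj_cont hframe).
have hN p : h (- p) = - h p by rewrite /h sumN (nehari_proj_odd hframe).
pose K := [set x : 'rV[R]_k | @Sinfty R (rVpoly x)].
have Kp x : K x -> psphere k (rVpoly x) by move=> Kx; split=> //; exact: size_poly.
have hK (phi : W -> R) : (forall u, u != 0 -> {for u, continuous phi}) ->
    exists L, forall p, psphere k p -> phi (h p) <= L.
  move=> cphi; have [|L hL] := @continuous_compact_ub _ _ K (fun x => phi (h (rVpoly x)))
    (@compact_sphere R k); last first.
    exists L => p [Sp sp]; have := hL (poly_rV p); rewrite /K/= poly_rV_K//; exact.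
  move=> x Kx; apply: (@continuous_comp _ _ _ (fun x : 'rV[R]_k => rVpoly x : Rinfty R) (phi \o h)).
    exact: rVpoly_continuous.
  apply: (@continuous_comp _ _ _ h phi); first by apply: h_cont; exact: Kp.
  by apply: cphi; have [] := hb _ (Kp _ Kx).
have [C hC] := hK (fun u => `|u|) (fun u _ => @norm_continuous _ _ u).
have [|L hL] := hK (psi 0); last first.
  have [j1 j10 h1] := level_J_ge hframe C level1.
  have [|n [w hw]] := @finite_separation _ _ _ _ _ _ _ _ _ _ hframe
      (h @` psphere k) C j1 j10.
    move=> _ [p pp <-]; split; first exact: hC.
    by apply: h1; [exact: hC|have [_ ->] := hb _ pp].
  have [fs cfs ofs] : exists2 fs : (h @` psphere k) -> @Sinfty R, continuous fs & odd_map fs.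
    apply: (@odd_map_to_sphere _ _ _ n (fun i u => B u (w i))) => //.
    - by move=> i u _; exact: operator_sep_cont.
    - by move=> i u; exact: operator_sep_odd.
  have himg (x : psphere k) : (h @` psphere k) (h (\val x)).
    by exists (\val x) => //; exact: set_mem (valP x).
  exists (h @` psphere k), L; split; last by move=> _ [p pp <-]; exact: hL.
  split.
  - by move=> _ [p pp <-]; exact: hb.
  - by move=> _ [p pp <-]; exists (- p); [exact: psphereN|exact: hN].
  - apply: (@fr_index_mono _ _ _ (psphere k) (h @` psphere k) Rinfty_opp_continuous
      (@psphereN R k) (fun x => SigSub (mem_set (himg x))) fs) => //.
    + apply: continuous_comp_initial => x.
      apply: (@continuous_comp _ _ _ (fun x : psphere k => \val x : Rinfty R) h).
        exact: initial_continuous.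
      by apply: h_cont; exact: set_mem (valP x).
    + by move=> x y xy; rewrite /= xy hN.
    + exact: fr_index_psphere.
move=> u u0; have J0 := fw_J_gt0 hframe u0.
apply: cvgM; last by apply: cvgV; [rewrite gt_eqF|exact: (potential_cont (fw_B hframe))].
by apply: cvgB; [exact: (potential_cont (fw_A hframe))|exact: cvg_cst].
Qed.

Lemma psi_ge th : 0 <= th -> exists K, forall v, base v -> K <= psi th v.
Proof.
move=> th0; have [C [j1 [j2 [j10 _ hj]]]] := psi_sublevel th 0.
exists (- (kap * th / j1)) => v vb; have J0 := J_gt0 vb.
have k0 : 0 <= kap * th by rewrite mulr_ge0// ltW.
have [h|/ltW h] := leP (psi th v) 0; last first.
  by apply: le_trans h; rewrite oppr_le0 divr_ge0// ltW.
have [_ jv _] := hj _ _ (lexx _) vb h.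
have [v0 _] := vb; have I0 := fw_I_gt0 hframe v0.
apply: (@le_trans _ _ (- (kap * th / J v))).
  by rewrite lerN2 ler_wpM2l// lef_pV2 ?posrE.
by rewrite -mulNr /psi ler_pM2r ?invr_gt0// -/kap; lra.
Qed.

Lemma muE th k : 0 <= th -> (0 < k)%N -> minimax base (psi th) k = (mu th k)%:E.
Proof.
move=> th0 k0; rewrite /mu fineK//.
have [M [L [aM hL]]] := base_admissible k0.
have [K hK] := psi_ge th0.
rewrite fin_numE; apply/andP; split.
  rewrite -ltNye; apply: (@lt_le_trans _ _ K%:E); first exact: ltNyr.
  apply: minimax_ge => // N y aN hy; have [u Nu] := admissible_nonempty k0 aN.
  by rewrite lee_fin (le_trans (hK u _))//; [have [Nb _ _] := aN; exact: Nb|exact: hy].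
rewrite -ltey; apply: (@le_lt_trans _ _ L%:E); last exact: ltry.
apply: (minimax_le aM) => u Mu; apply: le_trans (hL _ Mu).
have [Mb _ _] := aM; rewrite (@psiD 0 th _ (Mb _ Mu)) lerBlDr lerDl.
rewrite subr0; apply: divr_ge0; last by rewrite ltW// J_gt0//; exact: Mb.
exact: mulr_ge0 (ltW kap0) th0.
Qed.

Lemma mu_le th k M (x : R) : 0 <= th -> (0 < k)%N -> admissible base k M ->
  (forall u, M u -> psi th u <= x) -> mu th k <= x.
Proof. by move=> th0 k0 aM h; rewrite -lee_fin -muE//; exact: minimax_le aM h. Qed.

Lemma mu_lt th k (x : R) : 0 <= th -> (0 < k)%N -> mu th k < x ->
  exists2 M, admissible base k M & forall u, M u -> psi th u < x.
Proof. by move=> th0 k0; rewrite -lte_fin -muE//; exact: minimax_lt. Qed.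

Lemma mu_mono th k l : 0 <= th -> (0 < k)%N -> (k <= l)%N -> mu th k <= mu th l.
Proof.
move=> th0 k0 kl; rewrite -lee_fin -!muE ?(leq_trans k0)//.
exact: minimax_mono.
Qed.

Lemma mu_unbounded th (x : R) : 0 <= th -> exists n, forall k, (n < k)%N -> x <= mu th k.
Proof.
move=> th0; have [n hn] := base_index_le th x; exists n => k nk.
have k0 : (0 < k)%N by exact: leq_trans nk.
rewrite leNgt; apply/negP => /(mu_lt th0 k0)[M aM hM].
by have := hn _ _ aM (fun u Mu => ltW (hM u Mu)); rewrite leqNgt nk.
Qed.

(** An almost optimal set for [th] is tested at [th']: there [J <= j2], so [psi] drops by at least
    [kap / j2 * (th' - th)]. *)
Lemma mu_decreasing th k : 0 <= th -> (0 < k)%N -> exists2 d : R, 0 < d &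
  forall th', th < th' -> mu th' k <= mu th k - d * (th' - th).
Proof.
move=> th0 k0; have [C [j1 [j2 [_ j20 hj]]]] := psi_sublevel th (mu th k + 1).
exists (kap / j2); first exact: divr_gt0.
move=> th' tt'; have th'0 : 0 <= th' by exact: le_trans (ltW tt').
(* Capping at 1 keeps the almost optimal set in the sublevel set for which [j2] was chosen. *)
apply/ler_addgt0Pl => e e0; pose e' := Num.min e 1.
have e'0 : 0 < e' by rewrite lt_min e0 ltr01.
have [|M aM hM] := @mu_lt th k (mu th k + e') th0 k0; first by rewrite ltrDl.
have [Mb _ _] := aM; apply: (mu_le th'0 k0 aM) => u Mu.
have ub := Mb _ Mu; have hu := ltW (hM _ Mu).
have h1 : mu th k + e' <= mu th k + 1 by rewrite lerD2l ge_min lexx orbT.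
have [_ _ J2] := hj _ _ (lexx _) ub (le_trans hu h1).
rewrite (psiD th _ ub).
have h2 : kap / j2 * (th' - th) <= kap * (th' - th) / J u.
  by rewrite mulrAC; apply: kdiv => //; [rewrite subr_ge0 ltW|exact: J_gt0].
have h3 : e' <= e by rewrite ge_min lexx.
lra.
Qed.

(** Conversely an almost optimal set for [th'] is tested at [th]. Since [mu] is at most [mu 0], a
    single sublevel bound covers all [th' <= T]. *)
Lemma mu_lipschitz (T : R) k : (0 < k)%N -> exists2 K : R, 0 < K &
  forall th th', 0 <= th -> th <= th' -> th' <= T -> mu th k <= mu th' k + K * (th' - th).
Proof.
move=> k0; have [C [j1 [j2 [j10 _ hj]]]] := psi_sublevel T (mu 0 k + 1).
exists (kap / j1); first exact: divr_gt0.
move=> th th' th0 tt' tT; have th'0 := le_trans th0 tt'.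
apply/ler_addgt0Pl => e e0; pose e' := Num.min e 1.
have e'0 : 0 < e' by rewrite lt_min e0 ltr01.
have [|M aM hM] := @mu_lt th' k (mu th' k + e') th'0 k0; first by rewrite ltrDl.
have [Mb _ _] := aM; apply: (mu_le th0 k0 aM) => u Mu.
have ub := Mb _ Mu; have hu := ltW (hM _ Mu).
have h1 : mu th' k + e' <= mu 0 k + 1.
  apply: lerD; last by rewrite ge_min lexx orbT.
  have [->//|/eqP n0] := eqVneq th' 0.
  have [d d0 hd] := mu_decreasing (lexx 0) k0.
  have tp : 0 < th' by rewrite lt_def th'0 andbT; apply/eqP.
  apply: le_trans (hd _ tp) _; rewrite lerBlDr lerDl subr0 mulr_ge0// ltW//.
have [_ J1 _] := hj _ _ tT ub (le_trans hu h1).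
rewrite (psiD th' _ ub).
have h2 : kap * (th' - th) / J u <= kap / j1 * (th' - th).
  by rewrite [leRHS]mulrAC; apply: kdiv => //; rewrite subr_ge0.
have h3 : e' <= e by rewrite ge_min lexx.
have -> : kap * (th - th') / J u = - (kap * (th' - th) / J u) by ring.
lra.
Qed.

End Levels.

(** * Identification of [lambda_ck] and [eigenvalue_k] with values of [mu] *)

Section LevelIdentities.
Context {R : realType} {W : completeNormedModType R}.
Variables (sc : W -> R -> W) (s q r : R) (A B f g : W -> W -> R).
Hypothesis hframe : scaled_framework sc s q r A B f g.
Hypothesis hF : forall u : W, u != 0 -> 0 < potential f u.
Hypothesis hG : forall u : W, u != 0 -> potential g u = 0.

Local Notation I := (potential A).
Local Notation J := (potential B).
Local Notation F := (potential f).
Local Notation lambda := (lambda_fun A B f g).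
Local Notation level := (nehari_level s q).
Local Notation proj := (nehari_proj sc s q f).
Local Notation base := (base s q f).
Local Notation psi := (psi s q A B).
Local Notation admissible := (@admissible R W).

Let s0 : 0 < s := fw_s0 hframe.
Let q0 : 0 < q := fw_q0 hframe.
Let sq0 : 0 < s - q. Proof. by rewrite subr_gt0 (fw_qs hframe). Qed.
Let hs : is_scaling sc s := fw_scaling hframe.

(** The power [q - s] of the scaling factor [(-c)^(1/q)] from the base set to the level [c]. *)
Definition theta (c : R) : R := (- c) `^ (1 - s / q).

Lemma theta_gt0 c : c < 0 -> 0 < theta c.
Proof. by move=> c0; apply: powR_gt0; rewrite oppr_gt0. Qed.

Lemma scaling_const_cont t u : 0 < t -> {for u, continuous (fun u => sc u t)}.
Proof. by move=> t0; apply: (scaling_cont hs _ t0); [exact: cvg_id|exact: cvg_cst]. Qed.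

Let tau (c : R) : R := (- c) `^ q^-1.

Let tau_gt0 c : c < 0 -> 0 < tau c.
Proof. by move=> c0; apply: powR_gt0; rewrite oppr_gt0. Qed.

Let tau_q c : c < 0 -> tau c `^ q = - c.
Proof.
by move=> c0; rewrite /tau -powRrM mulVf ?gt_eqF// powRr1// oppr_ge0 ltW.
Qed.

Let tau_level c v : c < 0 -> F (sc v (tau c)) = level c <-> F v = level (-1).
Proof.
move=> c0; have t0 := tau_gt0 c0; rewrite (fw_F_scaling hframe) ?(ltW t0)// tau_q//.
have -> : level c = - c * level (-1) by rewrite /nehari_level; field; rewrite gt_eqF.
by split=> [/mulfI|->//]; apply; rewrite oppr_eq0 lt_eqF.
Qed.

(** The coefficient [q / (s - q)] in [psi] is the value of [F] on the base set minus 1. *)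
Lemma lambda_tau c v : c < 0 -> base v -> lambda c (sc v (tau c)) = psi (theta c) v.
Proof.
move=> c0 [v0 Fv]; have t0 := tau_gt0 c0; have J0 := fw_J_gt0 hframe v0.
rewrite (lambda_scaling hframe hG)// Fv /psi /theta.
have -> : (- c) `^ (1 - s / q) = tau c `^ (q - s).
  by rewrite /tau -powRrM; congr (_ `^ _); field; rewrite gt_eqF.
have e : tau c `^ (- s) * - c = tau c `^ (q - s).
  by rewrite -(tau_q c0) -powRD ?(gt_eqF t0) ?implybT//; congr (_ `^ _); ring.
have -> : c * tau c `^ (- s) = - tau c `^ (q - s) by rewrite -e; ring.
by rewrite /nehari_level; field; rewrite !gt_eqF.
Qed.

Lemma lambda_ckE c k : c < 0 -> (0 < k)%N ->
  lambda_ck sc A B f g c k = minimax base (psi (theta c)) k.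
Proof.
move=> c0 k0; have t0 := tau_gt0 c0; have tv0 : 0 < (tau c)^-1 by rewrite invr_gt0.
apply/eqP; rewrite eq_le; apply/andP; split.
  apply: (minimax_comparison k0) => M y [Mb sM kM] hM.
  have [C [j1 [j2 [j10 _ hj]]]] := psi_sublevel hframe hF (theta c) y.
  have hb : bounded_set [set v | base v /\ psi (theta c) v <= y].
    by apply: (@bounded_setI _ _ _ C) => v [bv pv]; have [] := hj _ _ (lexx _) bv pv.
  have [C' hC'] := bounded_setE (scaling_bounded hs (tau c) hb).
  have [||||sN kN] := @image_index _ _ _ _ _ _ _ _ _ _ hframe M (fun u => sc u (tau c)) k C'
      (tau c `^ s * j1) k0 sM kM.
  - by move=> u _; exact: scaling_const_cont.
  - by move=> u; rewrite (scalingN hs)// ltW.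
  - by rewrite mulr_gt0// powR_gt0.
  - move=> u Mu; split.
      apply: hC'; exists u; first by split; [exact: Mb|exact: hM].
      by exists (tau c) => //=; rewrite lexx ltW.
    rewrite (fw_J_scaling hframe) ?(ltW t0)// ler_wpM2l ?powR_ge0//.
    by have [] := hj _ _ (lexx _) (Mb _ Mu) (hM _ Mu).
  exists ((fun u => sc u (tau c)) @` M).
    split=> // _ [u Mu <-]; apply/(nehariP hframe hG _ c0); have [u0 Fu] := Mb _ Mu.
    by split; [exact: (scaling_neq0 hs)|exact/tau_level].
  by move=> _ [u Mu <-]; rewrite lambda_tau//; [exact: hM|exact: Mb].
apply: (minimax_comparison k0) => M y [Mn sM kM] hM.
have hb u : M u -> base (sc u (tau c)^-1).
  move=> /Mn/(nehariP hframe hG _ c0)[u0 Fu]; split; first exact: (scaling_neq0 hs).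
  by apply/(tau_level _ c0); rewrite (scalingKV hs).
have hp u : M u -> psi (theta c) (sc u (tau c)^-1) <= y.
  by move=> Mu; rewrite -lambda_tau//; [rewrite (scalingKV hs)//; exact: hM|exact: hb].
have [|||Nb sN kN] := @base_image _ _ _ _ _ _ _ _ _ _ hframe hF M (fun u => sc u (tau c)^-1)
    k (theta c) y k0 sM kM.
- by move=> u _; exact: scaling_const_cont.
- by move=> u; rewrite (scalingN hs)// ltW.
- by move=> u Mu; split; [exact: hb|exact: hp].
exists ((fun u => sc u (tau c)^-1) @` M); first by split.
by move=> _ [u Mu <-]; exact: hp.
Qed.

Lemma ratio_scaling u t : u != 0 -> 0 < t -> I (sc u t) / J (sc u t) = I u / J u.
Proof.
move=> u0 t0; have J0 := fw_J_gt0 hframe u0.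
rewrite (fw_I_scaling hframe) ?(ltW t0)// (fw_J_scaling hframe) ?(ltW t0)//.
by rewrite -mulf_div divff ?mul1r// gt_eqF// powR_gt0.
Qed.

Lemma psi0E u : psi 0 u = I u / J u.
Proof. by rewrite /psi mulr0 subr0. Qed.

(** [psi 0 = I / J] is invariant under scaling and equals [1 / J] on the unit level, so radial
    projection in either direction preserves the bounds. *)
Lemma eigenvalue_kE k : (0 < k)%N -> eigenvalue_k A B k = minimax base (psi 0) k.
Proof.
move=> k0; have neg1 : (-1 : R) < 0 by rewrite oppr_lt0.
have [C hC] := unit_level_bounded hframe.
apply/eqP; rewrite eq_le; apply/andP; split; apply: (minimax_comparison k0).
  move=> M y aM hM; have [Mb sM kM] := aM.
  (* Positivity turns [1 / J <= y] into the lower bound [1 / y] for [J] that the index of the image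
     requires. *)
  have y0 : 0 < y.
    have [u Mu] := admissible_nonempty k0 aM; apply: lt_le_trans (hM _ Mu).
    have [u0 _] := Mb _ Mu; rewrite psi0E divr_gt0//; first exact: (fw_I_gt0 hframe).
    exact: (fw_J_gt0 hframe).
  pose h u := sc u (I u `^ (- s^-1)).
  have hx u : u != 0 -> 0 < I u `^ (- s^-1).
    by move=> u0; apply: powR_gt0; exact: (fw_I_gt0 hframe).
  have hu u : u != 0 -> unit_level A (h u).
    move=> u0; have I0 := fw_I_gt0 hframe u0.
    rewrite /unit_level/= /h (fw_I_scaling hframe) ?powR_ge0// -powRrM mulNr mulVf ?gt_eqF//.
    by rewrite powR_inv1 ?ltW// mulVf ?gt_eqF.
  have hJ u : M u -> (J (h u))^-1 <= y.
    move=> Mu; have [u0 _] := Mb _ Mu; have := hM _ Mu.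
    by rewrite psi0E -(ratio_scaling u0 (hx _ u0)) -/(h u) (hu _ u0) mul1r.
  have [||||sN kN] := @image_index _ _ _ _ _ _ _ _ _ _ hframe M h k C y^-1 k0 sM kM.
  - move=> u Mu; have [u0 _] := Mb _ Mu; apply: (scaling_cont hs _ (hx _ u0)); first exact: cvg_id.
    apply: (@continuous_comp _ _ _ I (fun x : R => x `^ (- s^-1))).
      exact: (potential_cont (fw_A hframe)).
    by apply: powR_cont; exact: (fw_I_gt0 hframe).
  - by move=> u; rewrite /h (fw_I_even hframe) (scalingN hs)// powR_ge0.
  - by rewrite invr_gt0.
  - move=> u Mu; have [u0 _] := Mb _ Mu; split; first by apply: hC; exact: hu.
    have J0 : 0 < J (h u) by apply: (fw_J_gt0 hframe); exact: (scaling_neq0 hs u0 (hx _ u0)).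
    by rewrite -[leRHS]invrK lef_pV2 ?posrE ?invr_gt0//; exact: hJ.
  exists (h @` M); last by move=> _ [u Mu <-]; exact: hJ.
  by split=> // _ [u Mu <-]; apply: hu; have [] := Mb _ Mu.
move=> M y [Mu1 sM kM] hM.
have n0 u : M u -> u != 0 by move=> /Mu1/(unit_level_neq0 hframe).
have hp u : M u -> psi 0 (proj (-1) u) <= y.
  move=> Mu; rewrite psi0E ratio_scaling ?n0//.
    by rewrite (Mu1 _ Mu) mul1r; exact: hM.
  by apply: powR_gt0; rewrite divr_gt0 ?hF ?n0// (nehari_level_gt0 hframe).
have hb u : M u -> base (proj (-1) u).
  move=> Mu; split; first exact: (nehari_proj_neq0 hframe hF neg1 (n0 _ Mu)).
  exact: (nehari_proj_F hframe hF neg1 (n0 _ Mu)).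
have [|||Nb sN kN] := @base_image _ _ _ _ _ _ _ _ _ _ hframe hF M (proj (-1)) k 0 y k0 sM kM.
- by move=> u Mu; exact: (nehari_proj_cont hframe hF neg1 (n0 _ Mu)).
- by move=> u; exact: (nehari_proj_odd hframe).
- by move=> u Mu; split; [exact: hb|exact: hp].
exists (proj (-1) @` M); first by split.
by move=> _ [u Mu <-]; exact: hp.
Qed.

End LevelIdentities.

(** * Critical points *)

Section CriticalPoints.
Context {R : realType} {W : completeNormedModType R}.
Variables (sc : W -> R -> W) (s q r : R) (A B f g : W -> W -> R).
Hypothesis hdim : infinite_dimensional W.
Hypothesis hframe : scaled_framework sc s q r A B f g.
Hypothesis hF : forall u : W, u != 0 -> 0 < potential f u.
Hypothesis hG : forall u : W, u != 0 -> potential g u = 0.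

Local Notation I := (potential A).
Local Notation J := (potential B).
Local Notation F := (potential f).
Local Notation lambda := (lambda_fun A B f g).
Local Notation level := (nehari_level s q).
Local Notation proj := (nehari_proj sc s q f).
Local Notation D := (lambda_grad A B f g).

Let cvg_natinv_sub (sigma : nat -> nat) : (forall m n, (m < n)%N -> (sigma m < sigma n)%N) ->
  ((sigma j).+1%:R^-1 : R) @[j --> \oo] --> (0 : R).
Proof. by move=> hs; exact: cvg_comp _ _ (increasing_cvg hs) cvg_natinv. Qed.

(** Sequences at vanishing distance share their weak limit, where [F] is weakly continuous.
    Uniformity keeps whole descent paths, of a length fixed in advance, near the Nehari level of
    [F]. *)
Lemma F_uniformly_continuous (C e : R) : 0 < e -> exists2 d : R, 0 < d &
  forall u w, `|u| <= C -> `|w - u| <= d -> `|F w - F u| < e.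
Proof.
move=> e0; apply: contrapT => hn.
have h (j : nat) : exists p : W * W, [/\ `|p.1| <= C, `|p.2 - p.1| <= j.+1%:R^-1 &
    e <= `|F p.2 - F p.1|].
  apply: contrapT => /forallNP h; apply: hn; exists j.+1%:R^-1; first by rewrite invr_gt0.
  move=> u w uC uw; rewrite ltNge; apply/negP => he; apply: (h (u, w)).
  by split.
have [p hp] := choice h.
have [|sigma [hs [u0 [cu _ cF]]]] := @fw_subsequence _ _ _ _ _ _ _ _ _ _ hframe (fun j => (p j).1) C.
  by move=> j; have [] := hp j.
have cw : weak_cvg (fun j => (p (sigma j)).2) u0.
  move=> phi dphi; have [K K0 hK] := in_dual_bounded dphi.
  rewrite (_ : (fun j => _) = (fun j => phi ((p (sigma j)).1) +
      phi ((p (sigma j)).2 - (p (sigma j)).1))); last first.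
    by apply/funext => j; rewrite (in_dualB _ _ dphi) addrC subrK.
  rewrite -[phi u0]addr0; apply: cvgD; first exact: cu.
  apply/norm_cvg0P.
  have c0 : K * (sigma j).+1%:R^-1 @[j --> \oo] --> (0 : R).
    by rewrite -(mulr0 K); apply: cvgM; [exact: cvg_cst|exact: cvg_natinv_sub].
  apply: (squeeze_cvgr _ (cvg_cst 0) c0); apply: filterE => j; rewrite normr_ge0/=.
  by apply: le_trans (hK _) _; rewrite ler_wpM2l//; have [] := hp (sigma j).
have cFw : F ((p (sigma j)).2) @[j --> \oo] --> F u0.
  apply: (fw_F_weak hframe (C := C + 1) cw) => j; have [h1 h2 _] := hp (sigma j).
  rewrite -[X in `|X|](subrK ((p (sigma j)).1)) addrC.
  apply: le_trans (ler_normD _ _) _; apply: lerD => //; apply: le_trans h2 _.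
  by rewrite invf_le1// ler1n.
have c : `|F ((p (sigma j)).2) - F ((p (sigma j)).1)| @[j --> \oo] --> `|F u0 - F u0|.
  by apply: cvg_norm; apply: cvgB.
rewrite subrr normr0 in c; have : e <= 0.
  apply: (closed_cvg (fun t : R => e <= t) _ _ _ c); first exact: closed_ge.
  by apply: filterE => j; have [] := hp (sigma j).
by rewrite leNgt e0.
Qed.

Lemma grad_le (c e : R) u v : (forall v, `|v| <= 1 -> D c u v <= e) -> `|D c u v| <= e * `|v|.
Proof.
move=> h; have dD := lambda_grad_dual hframe c u.
have [->|v0] := eqVneq v 0; first by rewrite (in_dual0 dD) !normr0 mulr0.
have v0' : 0 < `|v| by rewrite normr_gt0.
have key w : `|w| = `|v| -> D c u w <= e * `|v|.
  move=> wv; have := h (`|v|^-1 *: w); rewrite normrZ gtr0_norm ?invr_gt0// wv mulVf ?gt_eqF//.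
  by rewrite lexx (in_dualZ _ _ dD) => /(_ isT); rewrite mulrC ler_pdivrMr.
by rewrite ler_norml key// lerNl -(in_dualN _ dD) key// normrN.
Qed.

(** A failing sequence is bounded and almost critical, and its weak limit [u0] lies on the Nehari
    level, hence is non-zero. The gradient relation gives [A u_j (u_j - u0) -> 0], so (A7) yields
    strong convergence of a subsequence to a critical point at level [d], which is excluded. *)
Lemma palais_smale (c d : R) : c < 0 ->
  (forall u, u != 0 -> F u = level c -> lambda c u = d -> exists v, D c u v != 0) ->
  exists2 rho : R, 0 < rho & forall u, u != 0 -> `|F u - level c| < rho ->
    `|lambda c u - d| < rho -> exists2 v, `|v| <= 1 & rho < D c u v.
Proof.
move=> c0 hcrit; apply: contrapT => hn; have l0 := nehari_level_gt0 hframe c0.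
have [|u hu] := @exists_seq_natinv R W (fun e u => [/\ u != 0, `|F u - level c| < e,
    `|lambda c u - d| < e & forall v, `|v| <= 1 -> D c u v <= e]).
  move=> e e0; apply: contrapT => /forallNP h; apply: hn; exists e => // u u0 h1 h2.
  apply: contrapT => h3; apply: (h u); split=> // v v1.
  by rewrite leNgt; apply/negP => ?; apply: h3; exists v.
have inv1 j : (j.+1%:R^-1 : R) <= 1 by rewrite invf_le1// ler1n.
have [C hC] := sublevel_bounded hframe hF (d + 1) (level c + 1 + c) (level c + 1).
have uC j : `|u j| <= C.
  have [u0 h1 h2 _] := hu j; have J0 := fw_J_gt0 hframe u0.
  move: h1 h2 => /lt_le_trans/(_ (inv1 j)) h1 /lt_le_trans/(_ (inv1 j)) h2.
  have Fu : F (u j) <= level c + 1 by move: h1; rewrite ltr_norml => /andP[_]; lra.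
  apply: hC => //.
  have : lambda c (u j) <= d + 1 by move: h2; rewrite ltr_norml => /andP[_]; lra.
  by rewrite (lambda_funE hframe hG) ler_pdivrMr//; lra.
have [sigma [hs [u0 [cw cJ cF]]]] := fw_subsequence hframe uC.
pose y j := u (sigma j).
pose ep j : R := (sigma j).+1%:R^-1.
have cep : ep j @[j --> \oo] --> (0 : R) by exact: cvg_natinv_sub.
have Fu0 : F u0 = level c.
  have c1 : F (y j) @[j --> \oo] --> level c.
    apply/subr_cvg0/norm_cvg0P.
    apply: (squeeze_cvgr _ (cvg_cst 0) cep); apply: filterE => j; rewrite normr_ge0/= ltW//.
    by have [] := hu (sigma j).
  exact: (cvg_unique _ cF c1).
have u00 : u0 != 0.
  by apply: contraTneq l0 => e; rewrite -Fu0 e (potential0 (fw_f hframe)) ltxx.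
have cl : lambda c (y j) @[j --> \oo] --> d.
  apply/subr_cvg0/norm_cvg0P.
  apply: (squeeze_cvgr _ (cvg_cst 0) cep); apply: filterE => j; rewrite normr_ge0/= ltW//.
  by have [] := hu (sigma j).
have hD j v : `|D c (y j) v| <= ep j * `|v|.
  by apply: grad_le; have [] := hu (sigma j).
have yB j : `|y j - u0| <= C + `|u0| by apply: le_trans (ler_normB _ _) _; rewrite lerD2r; exact: uC.
have cA : A (y j) (y j - u0) @[j --> \oo] --> (0 : R).
  have cf := weak_cvg_dual_cvg (fw_f hframe) (sf_f_compact hframe) cw cw yB.
  have cB := weak_cvg_dual_cvg (fw_B hframe) (sf_B_compact hframe) cw cw yB.
  have cD : D c (y j) (y j - u0) @[j --> \oo] --> (0 : R).
    apply/norm_cvg0P.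
    have c1 : ep j * (C + `|u0|) @[j --> \oo] --> (0 : R).
      by rewrite -(mul0r (C + `|u0|)); apply: cvgM => //; exact: cvg_cst.
    apply: (squeeze_cvgr _ (cvg_cst 0) c1); apply: filterE => j; rewrite normr_ge0/=.
    by apply: le_trans (hD _ _) _; rewrite ler_wpM2l// invr_ge0.
  (* The definition of the gradient is solved for [A]; the three terms on the right tend to 0
     separately. *)
  rewrite (_ : (fun j => _) = (fun j => J (y j) * D c (y j) (y j - u0) + f (y j) (y j - u0) +
     lambda c (y j) * B (y j) (y j - u0))); last first.
    apply/funext => j; have [n0 _ _ _] := hu (sigma j); have J0 := fw_J_gt0 hframe n0.
    by rewrite /lambda_grad mulrC divfK ?gt_eqF//; ring.
  rewrite (_ : (0 : R) = J u0 * 0 + 0 + d * 0); last by ring.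
  by apply: cvgD; [apply: cvgD => //; apply: cvgM|apply: cvgM].
have [tau [ht cy]] := sf_A_compactness hframe cw cA.
have lu0 : lambda c u0 = d.
  have c1 : lambda c (y (tau j)) @[j --> \oo] --> lambda c u0.
    exact: (cvg_comp _ _ cy (lambda_cont hframe hG u00)).
  have c2 := cvg_comp _ _ (increasing_cvg ht) cl.
  exact: (cvg_unique _ c1 c2).
have [v0 Dv0] := hcrit _ u00 Fu0 lu0.
have dD := lambda_grad_dual hframe c u0.
have vp : 0 < `|v0| + 1 by rewrite ltr_wpDl.
pose v := (`|v0| + 1)^-1 *: v0.
have v1 : `|v| <= 1.
  by rewrite normrZ gtr0_norm ?invr_gt0// mulrC ler_pdivrMr// mul1r lerDl.
have Dv : 0 < `|D c u0 v| / 2.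
  rewrite divr_gt0// normr_gt0 (in_dualZ _ _ dD).
  by apply: mulf_neq0 => //; apply: invr_neq0; exact: lt0r_neq0.
have h1 : \forall j \near \oo, forall w, `|w| <= 1 ->
    `|D c (y (tau j)) w - D c u0 w| < `|D c u0 v| / 2.
  exact: (cy _ (@lambda_grad_cont _ _ _ _ _ _ _ _ _ _ hframe hG c u0 u00 _ Dv)).
have h2 : \forall j \near \oo, ep (tau j) < `|D c u0 v| / 2.
  have c2 := cvg_comp _ _ (increasing_cvg ht) cep.
  exact: (cvgr_lt _ c2).
have [j [h3 h4]] := filter_ex (filterI h1 h2).
have := h3 _ v1; have h5 := hD (tau j) v.
have h6 : ep (tau j) * `|v| <= ep (tau j).
  by rewrite -[leRHS]mulr1 ler_wpM2l// invr_ge0.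
have := ler_distD (D c (y (tau j)) v) 0 (D c u0 v); rewrite !sub0r !normrN.
lra.
Qed.

Local Notation mu := (mu s q A B f).
Local Notation theta := (theta s q).

Lemma exists_critical (c : R) k : c < 0 -> (0 < k)%N ->
  exists u, [/\ u != 0, F u = level c, lambda c u = mu (theta c) k & forall v, D c u v = 0].
Proof.
move=> c0 k0; have l0 := nehari_level_gt0 hframe c0; set d := mu _ _.
have th0 : 0 <= theta c by rewrite ltW// theta_gt0.
have dE : minimax (nehari sc A B f g c) (lambda c) k = d%:E.
  by rewrite -(muE hdim hframe hF th0 k0) -(lambda_ckE hframe hF hG c0 k0).
apply: contrapT => hn.
have [u u0 Fu lu|rho rho0 hrho] := @palais_smale c d c0.
  apply: contrapT => /forallNP h; apply: hn; exists u; split=> // v.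
  by apply/eqP; apply: contrapT => /negP; exact: h.
pose Q := [set u | [/\ u != 0, `|F u - level c| < rho & `|lambda c u - d| < rho]].
have oQ : open Q.
  rewrite openE => u [u0 h1 h2].
  have n1 : \forall w \near u, 0 < `|w|.
    by apply: (cvgr_gt _ (@norm_continuous _ _ u)); rewrite normr_gt0.
  have n2 : \forall w \near u, `|F w - level c| < rho.
    apply: (cvgr_lt _ _ _ h1); apply: cvg_norm; apply: cvgB; last exact: cvg_cst.
    exact: (potential_cont (fw_f hframe)).
  have n3 : \forall w \near u, `|lambda c w - d| < rho.
    apply: (cvgr_lt _ _ _ h2); apply: cvg_norm; apply: cvgB; last exact: cvg_cst.
    exact: (lambda_cont hframe hG u0).
  by apply: filterS3 n1 n2 n3 => w; rewrite normr_gt0 => w1 w2 w3; split.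
have sQ : symmetric_set Q.
  move=> u [u0 h1 h2]; split; first by rewrite oppr_eq0.
    by rewrite (fw_F_even hframe).
  by rewrite (lambda_even hframe hG).
have D_dual u : u != 0 -> in_dual (D c u) by move=> _; exact: (lambda_grad_dual hframe).
have D_cont (u : W) : u != 0 -> forall e : R, 0 < e -> \forall y \near u,
    forall v, `|v| <= 1 -> `|D c y v - D c u v| < e.
  by move=> u0 e e0; exact: (@lambda_grad_cont _ _ _ _ _ _ _ _ _ _ hframe hG c u u0 e e0).
have [V [m [Vc Vo Vm V1 [mQ Vl]]]] := odd_pseudogradient D_dual D_cont
  (fun u v => lambda_grad_odd hframe hG c u v) oQ sQ
  (fun u (hu : Q u) => let: And3 h _ _ := hu in h)
  (fun u (hu : Q u) => let: And3 h1 h2 h3 := hu in hrho u h1 h2 h3).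
have [C hC] := sublevel_bounded hframe hF (d + 1) (level c + c) (level c).
have hE u : u != 0 -> F u = level c -> lambda c u <= d + 1 -> `|u| <= C.
  move=> u0 Fu; have J0 := fw_J_gt0 hframe u0.
  by rewrite (lambda_funE hframe hG) ler_pdivrMr// => h; apply: hC; rewrite ?Fu//; lra.
have [j1 j10 h1] := level_J_ge hframe C l0.
(* A change of [F] below [level c] keeps the path away from 0; a change below [rho] keeps it where
   [palais_smale] applies. *)
have m0 : 0 < Num.min rho (level c) by rewrite lt_min rho0.
have [r0 r00 hr0] := F_uniformly_continuous C m0.
(* The bound 1 keeps [M] below [d + 1], [rho / 2] keeps the strip inside [Q], and [rho * r0 / 4]
   makes the path length [4 * eps / rho] at most [r0]. *)
pose eps := Num.min (Num.min 1 (rho / 2)) (rho * r0 / 4).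
have eps0 : 0 < eps by rewrite !lt_min ltr01 !divr_gt0// mulr_gt0.
have [e1 e2 e3] : [/\ eps <= 1, eps <= rho / 2 & eps <= rho * r0 / 4].
  by rewrite /eps !ge_min !lexx !orbT.
have [|M aM hM] := @minimax_lt _ _ (nehari sc A B f g c) (lambda c) k (d + eps).
  by rewrite dE lte_fin ltrDl.
have [MN sM kM] := aM.
have MP u : M u -> [/\ u != 0, F u = level c & `|u| <= C].
  move=> Mu; have /(nehariP hframe hG _ c0)[u0 Fu] := MN _ Mu; split=> //.
  by apply: hE => //; apply: le_trans (ltW (hM _ Mu)) _; rewrite lerD2l.
have [|||||eta [etac etao etal]] := @deformation _ _ (lambda c) (D c) _ _ _ D_dual D_cont
    (fun u v => lambda_grad_odd hframe hG c u v) Q rho rho0 V m Vc Vo Vm V1 mQ Vl M d eps eps0.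
- by move=> u v t ut; apply: gradient_line; exact: (lambda_gradient hframe hG).
- by move=> u u0; exact: (lambda_cont hframe hG u0).
- by move=> u; exact: (lambda_even hframe hG).
- by move=> u Mu; exact: ltW (hM _ Mu).
- move=> u w Mu uw; have [u0 Fu uC] := MP _ Mu.
  have uw' : `|w - u| <= r0.
    apply: le_trans uw _; rewrite ler_pdivrMr//; move: e3; rewrite ler_pdivlMr//.
    by rewrite [rho * r0]mulrC; lra.
  have := hr0 _ _ uC uw'; rewrite Fu lt_min => /andP[f1 f2].
  have w0 : w != 0.
    apply: contraTneq f2 => ->; rewrite (potential0 (fw_f hframe)) sub0r normrN -leNgt.
    exact: ler_norm.
  split=> // /andP[g1 g2]; split=> //; rewrite ltr_norml; apply/andP; split.
    by move: g1 e2 rho0; lra.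
  by move: g2 e2 rho0; lra.
have hp u : M u -> let w := proj c (eta u) in [/\ w != 0, F w = level c & lambda c w < d - eps].
  move=> Mu; have [n0 ll] := etal _ Mu; split.
  - exact: (nehari_proj_neq0 hframe hF c0 n0).
  - exact: (nehari_proj_F hframe hF c0 n0).
  - exact: le_lt_trans (nehari_proj_le hframe hF hG c0 n0) ll.
have [||||sN kN] := @image_index _ _ _ _ _ _ _ _ _ _ hframe M (proj c \o eta) k C j1 k0 sM kM.
- move=> u Mu; have [n0 _] := etal _ Mu.
  apply: (@continuous_comp _ _ _ eta (proj c)); first exact: etac.
  exact: (nehari_proj_cont hframe hF c0 n0).
- by move=> u; rewrite /= etao (nehari_proj_odd hframe).
- exact: j10.
- move=> u Mu; have [w0 Fw lw] := hp _ Mu.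
  have wC : `|proj c (eta u)| <= C by apply: hE => //; apply: le_trans (ltW lw) _; lra.
  by split=> //; apply: h1 => //; rewrite Fw.
have : (d%:E <= (d - eps)%:E)%E.
  rewrite -dE; apply: (@minimax_le _ _ _ _ _ ((proj c \o eta) @` M)).
    split=> // _ [u Mu <-]; apply/(nehariP hframe hG _ c0).
    by have [] := hp _ Mu.
  by move=> _ [u Mu <-]; have [_ _ h] := hp _ Mu; exact: ltW.
by rewrite lee_fin; move: eps0; lra.
Qed.

End CriticalPoints.

(** * Dependence on [c] and critical points of the energy *)

Section Branches.
Context {R : realType} {W : completeNormedModType R}.
Variables (sc : W -> R -> W) (s q r : R) (A B f g : W -> W -> R).
Hypothesis hdim : infinite_dimensional W.
Hypothesis hframe : scaled_framework sc s q r A B f g.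
Hypothesis hF : forall u : W, u != 0 -> 0 < potential f u.
Hypothesis hG : forall u : W, u != 0 -> potential g u = 0.

Local Notation I := (potential A).
Local Notation J := (potential B).
Local Notation F := (potential f).
Local Notation level := (nehari_level s q).
Local Notation mu := (mu s q A B f).
Local Notation theta := (theta s q).

Let s0 : 0 < s := fw_s0 hframe.
Let q0 : 0 < q := fw_q0 hframe.
Let sq0 : 0 < s - q. Proof. by rewrite subr_gt0 (fw_qs hframe). Qed.
Let m : R := s / q - 1.
Let m0 : 0 < m. Proof. by rewrite subr_gt0 ltr_pdivlMr// mul1r (fw_qs hframe). Qed.

Let thetaE c : theta c = ((- c) `^ m)^-1.
Proof. by rewrite /theta -powRN; congr (_ `^ _); rewrite /m; ring. Qed.

Lemma theta_lt c d : c < d -> d < 0 -> theta c < theta d.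
Proof.
move=> cd d0; have c0 : c < 0 by exact: lt_trans cd d0.
rewrite !thetaE ltf_pV2 ?posrE ?powR_gt0 ?oppr_gt0//.
by apply: gt0_ltr_powR; rewrite ?nnegrE ?oppr_ge0 ?ltW ?ltrN2.
Qed.

Lemma theta_le c d : c < 0 -> d < 0 -> theta c <= theta d -> c <= d.
Proof. by move=> c0 d0; rewrite !leNgt; apply: contra => /theta_lt; apply. Qed.

Lemma theta_surjective x : 0 < x -> exists2 c, c < 0 & theta c = x.
Proof.
move=> x0; exists (- (x `^ (- m^-1))); first by rewrite oppr_lt0 powR_gt0.
rewrite thetaE opprK -powRrM mulNr mulVf ?gt_eqF// powR_inv1 ?ltW//.
by rewrite invrK.
Qed.

Lemma theta_continuous c : c < 0 -> {for c, continuous theta}.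
Proof.
move=> c0; apply: (@continuous_comp _ _ _ (fun c : R => - c) (fun x : R => x `^ (1 - s / q))).
  exact: opp_continuous.
by apply: powR_cont; rewrite oppr_gt0.
Qed.

(** The absolute value extends [mu] continuously from the half-line to [R], so that limits at 0 and
    the intermediate value theorem need no one-sided form. *)
Lemma mu_abs_continuous k : (0 < k)%N -> continuous (fun th : R => mu `|th| k).
Proof.
move=> k0 x; have [K K0 hK] := mu_lipschitz hdim hframe hF (`|x| + 1) k0.
have dec a b : 0 <= a -> a <= b -> mu b k <= mu a k.
  move=> a0; rewrite le_eqVlt => /orP[/eqP ->//|ab].
  have [d d0 hd] := mu_decreasing hdim hframe hF a0 k0.
  by apply: le_trans (hd _ ab) _; rewrite gerBl mulr_ge0 ?ltW// subr_gt0.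
have lip a b : 0 <= a -> 0 <= b -> a <= `|x| + 1 -> b <= `|x| + 1 ->
    `|mu a k - mu b k| <= K * `|a - b|.
  wlog ab : a b / a <= b => [hw a0 b0 ax bx|a0 b0 ax bx].
    have [ab|/ltW ba] := leP a b; first exact: hw.
    by rewrite distrC [X in K * X]distrC; exact: hw.
  rewrite ger0_norm ?subr_ge0 ?dec// distrC [X in K * X]ger0_norm ?subr_ge0//.
  by rewrite lerBlDl; exact: hK.
apply/cvgrPdist_lt => e e0.
have eK : 0 < Num.min 1 (e / K) by rewrite lt_min ltr01 divr_gt0.
have h : \forall y \near x, `|x - y| < Num.min 1 (e / K).
  by apply/nbhs_ballP; exists (Num.min 1 (e / K)).
apply: filterS h => y; rewrite lt_min => /andP[h1 h2].
have h3 : `| `|x| - `|y| | <= `|x - y| by exact: ler_dist_dist.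
have h4 : `|y| <= `|x| + 1.
  by move: h3; rewrite ler_norml => /andP[h3 _]; move: h1 h3; lra.
apply: le_lt_trans (lip _ _ _ _ _ _) _ => //; first by rewrite lerDl.
rewrite mulrC -ltr_pdivlMr//; exact: le_lt_trans h3 h2.
Qed.

Lemma lambda_ck_mu c k : c < 0 -> (0 < k)%N ->
  lambda_ck sc A B f g c k = (mu (theta c) k)%:E.
Proof.
move=> c0 k0; rewrite (lambda_ckE hframe hF hG c0 k0) (muE hdim hframe hF _ k0)//.
by rewrite ltW// theta_gt0.
Qed.

Lemma mu_lt_decr k a b : (0 < k)%N -> 0 <= a -> a < b -> mu b k < mu a k.
Proof.
move=> k0 a0 ab; have [d d0 hd] := mu_decreasing hdim hframe hF a0 k0.
by apply: le_lt_trans (hd _ ab) _; rewrite gtrBl mulr_gt0// subr_gt0.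
Qed.

Lemma energy_gradient lam u :
  gradient (energy A B f g lam) u (fun v => A u v - lam * B u v - f u v).
Proof.
have [dI gI] := potential_gradient u (fw_A hframe).
have [dF gF] := potential_gradient u (fw_f hframe).
have [dJ gJ] := potential_gradient u (fw_B hframe).
have E : energy A B f g lam = I - lam *: J - F.
  by apply/funext => w; rewrite /energy (fw_G hframe hG) subr0.
have hI : is_diff u I ('d I u) by split.
have hFd : is_diff u F ('d F u) by split.
have hJ : is_diff u J ('d J u) by split.
have h := is_diffB (is_diffB hI (is_diffZ lam hJ)) hFd.
rewrite E; have [dh e] := h; split=> [|v]; first exact: dh.
by rewrite e /= -gI -gF -gJ.
Qed.

Lemma energy_critical_point lam u :
  critical_point (energy A B f g lam) u <-> forall v, A u v = lam * B u v + f u v.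
Proof.
have [dE gE] := energy_gradient lam u; split=> [[_ h] v|h].
  by have := h v; rewrite gE; lra.
by split=> // v; rewrite gE h; ring.
Qed.

Lemma lambda_critical_energy c lam u : u != 0 -> lambda_fun A B f g c u = lam ->
  (forall v, lambda_grad A B f g c u v = 0) ->
  (forall v, A u v = lam * B u v + f u v) /\ energy A B f g lam u = c.
Proof.
move=> u0 lu h; have J0 := fw_J_gt0 hframe u0; split=> [v|].
  have /eqP := h v; rewrite /lambda_grad mulf_eq0 invr_eq0 (gt_eqF J0) orbF lu => /eqP.
  by lra.
rewrite /energy (fw_G hframe hG) subr0 -lu (lambda_funE hframe hG).
by rewrite divfK ?gt_eqF//; ring.
Qed.

(** If [F] tends to 0 along critical points, a weak limit has [F = 0], so it is 0. The equation then
    gives [A u_j u_j -> 0], and (A7) turns weak into strong convergence. *)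
Lemma small_critical_point lam e : 0 < e -> exists2 d : R, 0 < d & forall u,
  (forall v, A u v = lam * B u v + f u v) -> I u <= lam * J u + F u -> F u <= d -> `|u| < e.
Proof.
move=> e0; apply: contrapT => hn.
have [|u hu] := @exists_seq_natinv R W (fun d u => [/\ forall v, A u v = lam * B u v + f u v,
    I u <= lam * J u + F u, F u <= d & e <= `|u|]).
  move=> d d0; apply: contrapT => /forallNP h; apply: hn; exists d => // u h1 h2 h3.
  by rewrite ltNge; apply/negP => h4; apply: (h u).
have [C hC] := sublevel_bounded hframe hF lam 1 1.
have uC j : `|u j| <= C.
  have [_ h2 h3 h4] := hu j.
  have F1 : F (u j) <= 1 by apply: le_trans h3 _; rewrite invf_le1// ler1n.
  apply: hC => //; first by rewrite -normr_gt0 (lt_le_trans e0).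
  by apply: le_trans h2 _; rewrite lerD2l.
have [sigma [hs [u0 [cw _ cF]]]] := fw_subsequence hframe uC.
have u00 : u0 = 0.
  apply/eqP; apply: contraT => /hF; rewrite ltNge => /negP; case.
  have c : (sigma j).+1%:R^-1 - F (u (sigma j)) @[j --> \oo] --> 0 - F u0.
    by apply: cvgB => //; exact: cvg_comp _ _ (increasing_cvg hs) cvg_natinv.
  rewrite sub0r in c; rewrite -oppr_ge0.
  apply: (closed_cvg (fun t : R => 0 <= t) _ _ _ c); first exact: closed_ge.
  by apply: filterE => j; rewrite subr_ge0; have [] := hu (sigma j).
have yB j : `|(u \o sigma) j - u0| <= C by rewrite u00 subr0; exact: uC.
have cf := weak_cvg_dual_cvg (fw_f hframe) (sf_f_compact hframe) cw cw yB.
have cB := weak_cvg_dual_cvg (fw_B hframe) (sf_B_compact hframe) cw cw yB.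
have cA : A ((u \o sigma) j) ((u \o sigma) j - u0) @[j --> \oo] --> (0 : R).
  rewrite (_ : (fun j => _) = (fun j => lam * B ((u \o sigma) j) ((u \o sigma) j - u0) +
      f ((u \o sigma) j) ((u \o sigma) j - u0))); last first.
    by apply/funext => j; have [] := hu (sigma j).
  rewrite (_ : (0 : R) = lam * 0 + 0); last by ring.
  by apply: cvgD => //; apply: cvgM => //; exact: cvg_cst.
have [tau [ht cy]] := sf_A_compactness hframe cw cA.
have c : `|u (sigma (tau j))| @[j --> \oo] --> `|u0| by exact: cvg_norm.
have : e <= `|u0|.
  apply: (closed_cvg (fun t : R => e <= t) _ _ _ c); first exact: closed_ge.
  by apply: filterE => j; have [] := hu (sigma (tau j)).
by rewrite u00 normr0 leNgt e0.
Qed.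

Lemma exists_level lam k : (0 < k)%N -> lam < mu 0 k -> exists2 c, c < 0 & mu (theta c) k = lam.
Proof.
move=> k0 lk; have [d d0 hd] := mu_decreasing hdim hframe hF (lexx 0) k0.
(* Here the linear upper bound for [mu] reaches [lam]. *)
pose T := (mu 0 k - lam) / d.
have T0 : 0 < T by rewrite divr_gt0// subr_gt0.
have muT : mu T k <= lam.
  apply: le_trans (hd _ T0) _; rewrite subr0 /T mulrC divfK ?gt_eqF//; lra.
have [|x /itvP hx xl] := @IVT R (fun th : R => mu `|th| k) 0 T lam (ltW T0)
    (continuous_subspaceT (mu_abs_continuous k0)).
  by rewrite normr0 (gtr0_norm T0) ge_min le_max (ltW lk) muT orbT.
have x0 : 0 < x.
  rewrite lt_def hx andbT; apply/eqP => xe; move: xl lk; rewrite xe normr0 => ->.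
  by rewrite ltxx.
have [c c0 cx] := theta_surjective x0; exists c => //.
by rewrite cx -xl gtr0_norm.
Qed.

End Branches.

Theorem theorem2p19 (R : realType) (W : completeNormedModType R)
    (hdim : infinite_dimensional W)
    (sc : W -> R -> W) (s q r : R) (A B f g : W -> W -> R)
    (hframe : scaled_framework sc s q r A B f g)
    (hF : forall u : W, u != 0 -> 0 < potential f u)
    (hG : forall u : W, u != 0 -> potential g u = 0)
    (hh : forall (c : R) (u : W), nehari sc A B f g c u ->
            ~ (forall v, nehari_h s q r f g u v = 0)) :
  [/\ (* (i) *)
      (forall c : R, c < 0 ->
        [/\ nondecreasing_seq (fun k => lambda_ck sc A B f g c k.+1),
            lambda_ck sc A B f g c k.+1 @[k --> \oo] --> +oo%E &
            forall k : nat, (1 <= k)%N ->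
              [/\ lambda_ck sc A B f g c k \is a fin_num,
                  (exists u : W, [/\ u != 0,
                     critical_point (lambda_fun A B f g c) u &
                     (lambda_fun A B f g c u)%:E = lambda_ck sc A B f g c k]) &
                  exists u : W, [/\ u != 0,
                    critical_point
                      (energy A B f g (fine (lambda_ck sc A B f g c k))) u &
                    energy A B f g (fine (lambda_ck sc A B f g c k)) u = c]]]),
      (* (ii) *)
      (forall k : nat, (1 <= k)%N ->
        [/\ {within [set c : R | c < 0],
               continuous (fun c => fine (lambda_ck sc A B f g c k))},
            (forall c d : R, c < d -> d < 0 ->
               fine (lambda_ck sc A B f g d k)
                 < fine (lambda_ck sc A B f g c k)),
            fine (lambda_ck sc A B f g c k) @[c --> (0 : R)^'-]
              --> ninfty_nbhs R &
            lambda_ck sc A B f g c k @[c --> ninfty_nbhs R]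
              --> eigenvalue_k A B k]) &
      (* (iii) *)
      forall lambda : R,
        (exists v : nat -> W,
          [/\ forall k, v k != 0 /\ critical_point (energy A B f g lambda) (v k),
              nondecreasing_seq (fun k => energy A B f g lambda (v k)),
              energy A B f g lambda (v k) @[k --> \oo] --> (0 : R) &
              `|v k| @[k --> \oo] --> (0 : R)]) /\
        ~ (exists u : W, [/\ u != 0, critical_point (energy A B f g lambda) u &
             0 <= energy A B f g lambda u])].
Proof.
have muE' c k (c0 : c < 0) (k0 : (0 < k)%N) := lambda_ck_mu hdim hframe hF hG c0 k0.
have th0 c (c0 : c < 0) : 0 <= theta s q c by rewrite ltW// theta_gt0.
have crit c k : c < 0 -> (0 < k)%N -> exists u, [/\ u != 0,
    potential f u = nehari_level s q c,
    critical_point (lambda_fun A B f g c) u,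
    lambda_fun A B f g c u = mu s q A B f (theta s q c) k &
    (forall v, A u v = mu s q A B f (theta s q c) k * B u v + f u v) /\
    energy A B f g (mu s q A B f (theta s q c) k) u = c].
  move=> c0 k0; have [u [u0 Fu lu Du]] := exists_critical hdim hframe hF hG c0 k0.
  exists u; split=> //.
    have [dl gl] := @lambda_gradient _ _ _ _ _ _ _ _ _ _ hframe hG c u u0.
    by split=> // v; rewrite gl.
  exact: (lambda_critical_energy hframe hG u0 lu Du).
split.
- move=> c c0; split.
  + move=> k l kl; rewrite !muE'// lee_fin.
    exact: (mu_mono hdim hframe hF (th0 _ c0)).
  + apply/cvgeyPge => x.
    have [n hn] := mu_unbounded hdim hframe hF x (th0 _ c0).
    exists n => // k /= nk; rewrite muE'// lee_fin; exact: hn.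
  + move=> k k0; rewrite muE'//=; have [u [u0 _ cu lu [Au Eu]]] := crit c k c0 k0.
    split=> //; exists u; split; [exact: u0|exact: cu|by rewrite lu|exact: u0| |exact: Eu].
    exact/(energy_critical_point hframe hG).
- move=> k k0; split.
  + rewrite continuous_open_subspace; last exact: open_lt.
    move=> c /set_mem c0.
    have e : \forall d \near c, mu s q A B f `|theta s q d| k = fine (lambda_ck sc A B f g d k).
      near=> d; have d0 : d < 0 by near: d; exact: lt_nbhsl.
      by rewrite muE'//= ger0_norm// th0.
    have cc : {for c, continuous (fun d => mu s q A B f `|theta s q d| k)}.
      apply: (@continuous_comp _ _ _ (theta s q) (fun th : R => mu s q A B f `|th| k)).
        exact: theta_continuous.
      exact: (mu_abs_continuous hdim hframe hF k0).
    rewrite /continuous_at -(nbhs_singleton e).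
    by apply: cvg_trans cc; exact: near_eq_cvg.
  + move=> c d cd d0; have c0 := lt_trans cd d0; rewrite !muE'//=.
    apply: (mu_lt_decr hdim hframe hF k0); first exact: th0.
    exact: (theta_lt hframe cd d0).
  + apply/cvgrNyPle => x.
    have [d d0 hd] := mu_decreasing hdim hframe hF (lexx 0) k0.
    (* Beyond [T] the linear upper bound for [mu] is below [x]; the 1 makes [T] positive, hence a
       value of [theta]. *)
    pose T := Num.max 1 ((mu s q A B f 0 k - x) / d).
    have T0 : 0 < T by rewrite lt_max ltr01.
    have [c c0 cT] := theta_surjective hframe T0.
    near=> a; have a0 : a < 0 by near: a; exact: nbhs_left_lt.
    have ca : c < a by near: a; exact: nbhs_left_gt.
    rewrite muE'//=; have h := theta_lt hframe ca a0; rewrite cT in h.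
    apply: le_trans (hd _ (lt_trans T0 h)) _; rewrite subr0.
    have : (mu s q A B f 0 k - x) / d <= theta s q a.
      by apply: le_trans (ltW h); rewrite le_max lexx orbT.
    by rewrite ler_pdivrMr// mulrC; lra.
  + rewrite (eigenvalue_kE hframe hF k0) (muE hdim hframe hF (lexx 0) k0).
    have e : \forall c \near ninfty_nbhs R,
        (mu s q A B f `|theta s q c| k)%:E = lambda_ck sc A B f g c k.
      near=> c; have c0 : c < 0 by near: c; exact: nbhs_ninfty_lt.
      by rewrite muE'//= ger0_norm// th0.
    have ct : theta s q c @[c --> ninfty_nbhs R] --> (0 : R).
      apply/cvgrPdist_lt => x x0; have [c c0 cx] := theta_surjective hframe x0.
      near=> a; have ac : a < c by near: a; apply: nbhs_ninfty_lt; exact: num_real.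
      rewrite sub0r normrN ger0_norm; last by apply: th0; exact: lt_trans ac c0.
      by rewrite -cx; exact: (theta_lt hframe ac c0).
    have m0 : {for 0, continuous (fun th : R => mu s q A B f `|th| k)}.
      exact: (mu_abs_continuous hdim hframe hF k0).
    have cm : mu s q A B f `|theta s q c| k @[c --> ninfty_nbhs R] --> mu s q A B f 0 k.
      by have := cvg_comp _ _ ct m0; rewrite normr0.
    apply: cvg_trans; first by apply: near_eq_cvg; exact: e.
    by apply: cvg_EFin => //; exact: filterE.
move=> lam; split; last first.
  move=> [u [u0 /(energy_critical_point hframe hG) hu]].
  (* With these coefficients (H3) says that [s] times the energy is [- (s - q) F], which is
     negative. *)
  have := sf_Pohozaev hframe (alpha := 1) (beta := lam) (gamma := 1) (delta := 1) (u := u).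
  rewrite /energy !(fw_G hframe hG) => hP.
  have {}hP : s * 1 * potential A u = s * lam * potential B u + q * 1 * potential f u + r * 1 * 0.
    by apply: hP => v; rewrite (fw_g0 hframe hG) hu; ring.
  have Fu := hF u u0; have qs := fw_qs hframe; have s0 := fw_s0 hframe.
  rewrite subr0 => h.
  have : 0 <= s * (potential A u - lam * potential B u - potential f u).
    by rewrite mulr_ge0// ltW.
  have -> : s * (potential A u - lam * potential B u - potential f u) =
    - ((s - q) * potential f u) by move: hP; lra.
  by rewrite oppr_ge0 leNgt mulr_gt0// subr_gt0.
(* Past [n] the level [mu 0 k] exceeds [lam], so [mu (theta c) k = lam] is solvable with [c < 0]. *)
have [n hn] := mu_unbounded hdim hframe hF (lam + 1) (lexx 0).
pose k j := (n.+1 + j)%N.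
have k0 j : (0 < k j)%N by [].
have lk j : lam < mu s q A B f 0 (k j).
  by apply: lt_le_trans (hn (k j) _); [rewrite ltrDl|rewrite /k ltn_addr].
have [c hc] := choice (fun j => proj1 (exists2P _ _) (exists_level hdim hframe hF (k0 j) (lk j))).
have c0 j : c j < 0 by have [] := hc j.
have muc j : mu s q A B f (theta s q (c j)) (k j) = lam by have [] := hc j.
have [v hv] := choice (fun j => crit (c j) (k j) (c0 j) (k0 j)).
have v0 j : v j != 0 by have [] := hv j.
have vA j w : A (v j) w = lam * B (v j) w + f (v j) w.
  by have [_ _ _ _ [h _]] := hv j; rewrite h muc.
have vE j : energy A B f g lam (v j) = c j.
  by have [_ _ _ _ [_]] := hv j; rewrite muc.
(* [mu] grows with the index and decreases in [th], so a larger index attains [lam] at a larger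
   [th], and [theta] is increasing. *)
have c_mono i j : (i <= j)%N -> c i <= c j.
  move=> ij; apply: (theta_le hframe) => //; rewrite leNgt; apply/negP => h.
  have := mu_lt_decr hdim hframe hF (k0 j) (th0 _ (c0 j)) h.
  rewrite muc; apply/negP; rewrite -leNgt -(muc i).
  by apply: (mu_mono hdim hframe hF); [exact: th0| |rewrite leq_add2l].
(* If [c j <= - e], then [mu (theta (- e)) (k j) <= lam], which fails for large [j] as the levels at
   a fixed [th] are unbounded. *)
have c_cvg : c j @[j --> \oo] --> (0 : R).
  apply/cvgrPdist_lt => e e0.
  have ne : - e < 0 by rewrite oppr_lt0.
  have [N hN] := mu_unbounded hdim hframe hF (lam + 1) (th0 _ ne).
  exists N => // j /= Nj; rewrite sub0r normrN ltr0_norm// ltrNl.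
  rewrite ltNge; apply/negP => cj.
  have kN : (N < k j)%N by rewrite /k addSn ltnS (leq_trans Nj)// leq_addl.
  have h1 := hN _ kN; have h2 : theta s q (c j) <= theta s q (- e).
    move: cj; rewrite le_eqVlt => /orP[/eqP ->//|cj]; exact/ltW/(theta_lt hframe).
  have h3 : mu s q A B f (theta s q (- e)) (k j) <= lam.
    move: h2; rewrite le_eqVlt => /orP[/eqP <-|h2]; first by rewrite muc.
    rewrite -(muc j); apply: ltW.
    exact: (mu_lt_decr hdim hframe hF (k0 j) (th0 _ (c0 j)) h2).
  lra.
exists v; split.
- move=> j; split; [exact: v0|apply/(energy_critical_point hframe hG); exact: vA].
- by move=> i j ij; rewrite !vE; exact: c_mono.
- by under eq_fun do rewrite vE.
- apply/cvgrPdist_lt => e e0.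
  have [d d0 hd] := small_critical_point hframe hF lam e0.
  (* On the Nehari set [F] is proportional to [- c], so the convergence of [c j] forces that of
     [F (v j)]. *)
  have cF : potential f (v j) @[j --> \oo] --> (0 : R).
    have -> : (fun j => potential f (v j)) = (fun j => - c j * s / (s - q)).
      by apply/funext => j; have [_ ->] := hv j.
    rewrite (_ : (0 : R) = - 0 * s / (s - q)); last by rewrite oppr0 !mul0r.
    by do 2 (apply: cvgM; last exact: cvg_cst); exact: cvgN.
  have h : \forall j \near \oo, potential f (v j) < d by exact: (cvgr_lt _ cF).
  apply: filterS h => j Fd; rewrite sub0r normrN normr_id; apply: hd.
  + exact: vA.
  + have := vE j; rewrite /energy (fw_G hframe hG) subr0; have := c0 j; lra.
  + exact: ltW.
Unshelve. all: by end_near.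
Qed.
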